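(* Assume (A1) and (A2). Let $\Gamma\subset\mathbb{Z}^d$, $m>0$, $z\in\mathbb{C}\setminus\mathbb{R}$ with $|z|\le m$, and $s\in(0,1/3)$. Fix $L\ge \operatorname{diam}\Theta+2$. Then there exist constants $B_s$ and $C_s$, depending only on $d,\rho,u,m,s$, such that the following holds: if for some $b\in(0,1)$, for arbitrary $\Lambda\subset\Gamma$ and all $x\in\Lambda$, \[ \frac{B_s L^{3(d-1)}\,\Xi_s(\lambda)}{\lambda^{s/|\Theta|}}\sum_{w\in\partial^{\rm o}W_x}\mathbb{E}\bigl\{|G_{\Lambda\setminus W_x}(z;x,w)|^{s/(2|\Theta|)}\bigr\}<b, \] then for all $x,y\in\Gamma$ \[ \mathbb{E}\bigl\{|G_\Gamma(z;x,y)|^{s/(2|\Theta|)}\bigr\}\le A e^{-\mu|x-y|_\infty},\qquad A=\frac{C_s\Xi_s(\lambda)}{b},\quad \mu=\frac{|\ln b|}{L+\operatorname{diam}\Theta+2}. \]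
   Context: Let $d\ge 1$; $|x|_1=\sum_i|x_i|$, $|x|_\infty=\max_i|x_i|$. Discrete Laplacian $(\Delta\psi)(x)=\sum_{|e|_1=1}\psi(x+e)$. $\mu$ is a probability measure on $\mathbb{R}$, $\Omega=\times_{k\in\mathbb{Z}^d}\mathbb{R}$ with product measure $\mathbb{P}=\bigotimes_k\mu$, $\mathbb{E}$ expectation. $u:\mathbb{Z}^d\to\mathbb{R}$ has finite nonempty support $\Theta$, $0\in\Theta$, $|\Theta|$ its cardinality, $\operatorname{diam}\Theta=\max_{x,y\in\Theta}|x-y|_\infty$. $V_\omega(x)=\sum_k\omega_ku(x-k)$, $H_\omega=-\Delta+\lambda V_\omega$, $\lambda>0$. For $\Gamma\subset\mathbb{Z}^d$, $H_\Gamma$ is the restriction of $H_\omega$ to $\ell^2(\Gamma)$ and $G_\Gamma(z;x,y)=\langle\delta_x,(H_\Gamma-z)^{-1}\delta_y\rangle$; by convention $G_\Gamma(z;x,y)=0$ if $x\notin\Gamma$ or $y\notin\Gamma$. For $\Lambda\subset\mathbb{Z}^d$: $\partial^{\rm i}\Lambda=\{k\in\Lambda:\#\{j\in\Lambda:|k-j|_1=1\}<2d\}$, $\partial^{\rm o}\Lambda=\partial^{\rm i}(\mathbb{Z}^d\setminus\Lambda)$, $\Lambda^+=\Lambda\cup\partial^{\rm o}\Lambda$, and $\Theta_b=\Theta+b$. $\Lambda_{L,x}=\{k:|k-x|_\infty\le L\}$, $B_x=\partial^{\rm i}\Lambda_{L,x}$, $\hat W_x=\{k\in\Gamma: k\in\Theta_b\text{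 for some }b\in B_x\}$, $W_x=\hat W_x^+\cap\Gamma$. $\Xi_s(\lambda)=\max\{\lambda^{-s/(2|\Theta|)},\lambda^{-2s}\}$. (A1): $\mu$ has a bounded, compactly supported density $\rho$. (A2): $u(k)>0$ for all $k\in\partial^{\rm i}\Theta$. *)

(* Defs.v *)
From HB Require Import structures.
From mathcomp Require Import all_boot all_order all_algebra.
From mathcomp Require Import all_classical all_reals all_analysis.
From mathcomp Require Import finmap.
From mathcomp.real_closed Require Import complex.
Import ComplexField.Normc.

Set Implicit Arguments.
Unset Strict Implicit.
Unset Printing Implicit Defensive.

Import Order.TTheory GRing.Theory Num.Theory.
Import numFieldNormedType.Exports.

Local Open Scope classical_set_scope.
Local Open Scope ring_scope.

Notation Zd d := 'rV[int]_d.

Definition norm1 (d : nat) (x : Zd d) : nat := (\sum_(i < d) `|x ord0 i|)%N.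
Definition normoo (d : nat) (x : Zd d) : nat := (\max_(i < d) `|x ord0 i|)%N.

Definition unitv (d : nat) (i : 'I_d) : Zd d := \row_(j < d) (i == j)%:R.

(** inner boundary: points of L with fewer than 2d neighbours (|k-j|_1 = 1)
    in L; the 2d neighbours of k are k +- e_i. *)
Definition inner_bd (d : nat) (L : set (Zd d)) : set (Zd d) :=
  [set k | L k /\
     (\sum_(i < d) (nat_of_bool ((k + unitv i)%R \in L)
                      + nat_of_bool ((k - unitv i)%R \in L)) < 2 * d)%N].
Definition outer_bd (d : nat) (L : set (Zd d)) : set (Zd d) := inner_bd (~` L).
Definition plus_set (d : nat) (L : set (Zd d)) : set (Zd d) := L `|` outer_bd L.

Definition box (d : nat) (L : nat) (x : Zd d) : set (Zd d) :=
  [set k | (normoo (k - x) <= L)%N].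

Definition diam (d : nat) (Th : {fset Zd d}) : nat :=
  (\max_(a <- Th) \max_(c <- Th) normoo (a - c))%N.

Definition What (d : nat) (Gam : set (Zd d)) (Th : {fset Zd d}) (L : nat)
  (x : Zd d) : set (Zd d) :=
  [set k | Gam k /\ exists2 b, inner_bd (box L x) b & (k - b) \in Th].
Definition Wset (d : nat) (Gam : set (Zd d)) (Th : {fset Zd d}) (L : nat)
  (x : Zd d) : set (Zd d) :=
  plus_set (What Gam Th L x) `&` Gam.

Section Operator.
Variable R : realType.
Local Notation C := R[i].

(** V_omega(x) = sum_k omega_k u(x - k) = sum_{t in Theta} omega_{x-t} u(t)
    (u vanishes outside Theta). *)
Definition Vpot (d : nat) (u : Zd d -> R) (Th : {fset Zd d}) (om : Zd d -> R)
  (x : Zd d) : R := \sum_(t <- Th) om (x - t) * u t.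

(** g is the column y of (H_Gamma - z)^{-1}: g is in l^2(Gamma) (vanishes
    off Gamma, square summable) and (H_Gamma - z) g = delta_y on Gamma,
    with H = -Delta + lambda V and (Delta g)(x) = sum_{|e|_1=1} g(x+e). *)
Definition resolvent_col (d : nat) (u : Zd d -> R) (Th : {fset Zd d})
  (lam : R) (om : Zd d -> R) (Gam : set (Zd d)) (z : C) (y : Zd d)
  (g : Zd d -> C) : Prop :=
  [/\ (forall x, ~ Gam x -> g x = 0),
      (\esum_(x in [set: Zd d]) ((normc (g x)) ^+ 2)%:E < +oo)%E &
      (forall x, Gam x ->
        - (\sum_(i < d) (g (x + unitv i) + g (x - unitv i)))
        + ((lam * Vpot u Th om x)%:C)%C * g x - z * g x
        = (if x == y then 1 else 0))].

(** Green's function G_Gamma(z;x,y) = <delta_x,(H_Gamma - z)^{-1} delta_y>,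
    0 if x or y is not in Gamma. *)
Definition Green (d : nat) (u : Zd d -> R) (Th : {fset Zd d})
  (lam : R) (om : Zd d -> R) (Gam : set (Zd d)) (z : C) (x y : Zd d) : C :=
  match pselect (Gam y /\ exists g, resolvent_col u Th lam om Gam z y g) with
  | left e => projT1 (cid (proj2 e)) x
  | right _ => 0
  end.

Definition Xi (s lam : R) (nTh : nat) : R :=
  Num.max (lam `^ (- (s / (2 * nTh%:R)))) (lam `^ (- (2 * s))).

End Operator.

Definition mutually_independent (R : realType) (dT : measure_display)
  (T : measurableType dT) (P : probability T R) (I : choiceType)
  (X : I -> T -> R) : Prop :=
  forall (F : {fset I}) (A : I -> set R),
    (forall i, i \in F -> measurable (A i)) ->
    P (\bigcap_(i in [set` F]) (X i @^-1` A i)) =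
    (\prod_(i <- F) P (X i @^-1` A i))%E.

(* Main.v *)
Require Import Defs.
From HB Require Import structures.
From mathcomp Require Import all_boot all_order all_algebra.
From mathcomp Require Import all_classical all_reals all_analysis.
From mathcomp Require Import finmap.
From mathcomp.real_closed Require Import complex.
From mathcomp Require Import measurable_realfun lebesgue_integral.
From mathcomp Require Import perm.
From mathcomp Require Import zify ring lra.
Import ComplexField.Normc.
Import Order.TTheory GRing.Theory Num.Theory.
Import numFieldNormedType.Exports.
Local Open Scope classical_set_scope.
Local Open Scope ring_scope.

(* The moment exponent s / (2n), n = #Th, is so small that the Green function, which is a
   rational function of degree at most n in each single coupling, is comparable in mean
   with its values at a few complex values of that coupling. Displacing the couplings
   around x and y into the complex plane along a geometric scale makes the imaginary part
   of the potential large on a whole neighbourhood, with a definite sign wherever hopping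
   to the outside is possible, because u > 0 on the inner boundary of Th; an energy
   estimate for the equation multiplied by that sign pattern then bounds the displaced
   Green function. This yields an a-priori bound on fractional moments and, with a random
   weight of the same rational type carried along, a bound decoupling the middle factor in
     G_Lam(x,y) = sum G_(Lam \ W)(x,p) G_Lam(q',p') G_(Lam \ W)(q,y).
   The two outer factors depend on couplings inside and outside the sphere around x, hence
   are independent, and the smallness condition gains a factor b for each step of length
   L + diam Th + 2. Infinite volumes follow by exhaustion and Fatou's lemma. *)

(** * Independence and resampling *)

(** The restriction on [s] counts poles. In one coupling a weight has up to [2 n] poles and the
    Green function [n] more; the power [tau = s / (2 n)] of their product reduces to singularities
    of order one half, integrable uniformly for a bounded density, once [3 n tau <= 1 / 2], and
    [s < 1 / 3] gives this. Two obstacles shape the displacement. Since [u] may be negative inside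
    [Th], several displaced couplings can cancel at a site; on a geometric scale the last one felt
    there prevails, though with either sign. And the constants must not see the distance of [z] to
    the real axis, so away from the displaced couplings only the sign of the imaginary part may be
    used: a bond across a sign change must have both ends where the diagonal is large. The factor
    [lam ^ (- s / n)] of the decoupling bound comes from the end points of the middle factor being
    neither equal nor adjacent: at strong coupling the equation is then solved for its diagonal term
    once at either end. *)

Section Independence.
Local Open Scope ereal_scope.

(** Monotonicity read off the integral as a supremum over simple functions. It thus applies to the
    infinite-volume Green function, a pointwise choice about which no measurability is known. *)
Lemma le_lower_integral {R : realType} {dT : measure_display}
    {T : measurableType dT} (mu : {measure set T -> \bar R}) (f g : T -> \bar R) :
  (forall x, 0 <= f x) -> (forall x, f x <= g x) ->
  \int[mu]_x f x <= \int[mu]_x g x.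
Proof.
move=> f0 fg; have g0 x : 0 <= g x by exact: le_trans (fg x).
rewrite !ge0_integralTE//; apply: ereal_sup_le => _ [h hf <-].
by exists h => // x; apply: le_trans (fg x).
Qed.

Lemma integral_indep_pair {R : realType} {dT d1 d2 : measure_display}
    {T : measurableType dT} {T1 : measurableType d1} {T2 : measurableType d2}
    (P : probability T R) (Y1 : {mfun T >-> T1}) (Y2 : {mfun T >-> T2})
    (phi : T1 * T2 -> \bar R) :
  (forall A B, measurable A -> measurable B ->
     P (Y1 @^-1` A `&` Y2 @^-1` B) = P (Y1 @^-1` A) * P (Y2 @^-1` B)) ->
  measurable_fun setT phi -> (forall z, 0 <= phi z) ->
  \int[P]_t phi (Y1 t, Y2 t) =
  \int[P]_t2 \int[P]_t1 phi (Y1 t1, Y2 t2).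
Proof.
move=> ind mphi phi0.
pose Y : T -> T1 * T2 := fun t => (Y1 t, Y2 t).
have mY : measurable_fun setT Y by apply/measurable_fun_pairP; split.
pose YF : {mfun T >-> (T1 * T2)%type} := HB.pack Y (isMeasurableFun.Build _ _ _ _ _ mY).
pose P1 := distribution P Y1; pose P2 := distribution P Y2.
have EP X : measurable X -> (P1 \x P2) X = distribution P YF X.
  by apply: product_measure_unique => A B mA mB; rewrite /distribution/= /pushforward -ind.
transitivity (\int[distribution P YF]_z phi z).
  by rewrite /distribution ge0_integral_pushforward.
transitivity (\int[P1 \x P2]_z phi z).
  by apply: eq_measure_integral => A mA _; exact/esym/EP.
rewrite fubini_tonelli2// /P2 /distribution ge0_integral_pushforward//; last 2 first.
- exact: measurable_fun_fubini_tonelli_G.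
- by move=> y _; exact: integral_ge0.
apply: eq_integral => t2 _ /=.
rewrite /fubini_G /P1 /distribution ge0_integral_pushforward//.
exact: (measurableT_comp mphi (pair2_measurable _)).
Qed.

Section Family.
Context {R : realType} {dT : measure_display} {T : measurableType dT}.
Context (P : probability T R) {I : choiceType} (X : I -> T -> R).
Hypothesis mX : forall i, measurable_fun setT (X i).
Hypothesis indX : mutually_independent P X.

Definition cylinders (A : set I) : set (set T) :=
  [set B | exists (F : {fset I}) (S : I -> set R),
    [/\ (forall i, i \in F -> A i), (forall i, measurable (S i)) &
        B = \bigcap_(i in [set` F]) (X i @^-1` S i)]].

Lemma cylinders_measurable A : cylinders A `<=` measurable.
Proof.
move=> _ [F [S [_ mS ->]]]; apply: fin_bigcap_measurable => //.
by move=> i _; rewrite -[X in measurable X]setTI; exact: mX.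
Qed.

Lemma cylinders_setT A : cylinders A setT.
Proof.
by exists fset0, (fun=> setT); split => //; apply/esym/seteqP; split.
Qed.

Lemma cylinders_meet (F1 F2 : {fset I}) (S1 S2 : I -> set R) :
  \bigcap_(i in [set` F1]) (X i @^-1` S1 i) `&` \bigcap_(i in [set` F2]) (X i @^-1` S2 i)
  = \bigcap_(i in [set` (F1 `|` F2)%fset])
     (X i @^-1` ((if i \in F1 then S1 i else setT) `&` (if i \in F2 then S2 i else setT))).
Proof.
apply/seteqP; split=> t.
  move=> [h1 h2] i /= iF; split; case: ifPn => // iFF.
    exact: h1.
  exact: h2.
move=> h; split=> i /= iF.
  by have /= := h i; rewrite !inE iF => /(_ isT) [].
by have /= := h i; rewrite !inE iF orbT => /(_ isT) [].
Qed.

Lemma cylinders_setI A : setI_closed (cylinders A).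
Proof.
move=> _ _ [F1 [S1 [A1 m1 ->]]] [F2 [S2 [A2 m2 ->]]]; rewrite cylinders_meet.
eexists _, _; split; last reflexivity.
  by move=> i; rewrite inE => /orP[/A1|/A2].
by move=> i; apply: measurableI; case: ifP.
Qed.

Lemma cylinders_indep (A B : set I) a b : A `&` B = set0 ->
  cylinders A a -> cylinders B b -> P (a `&` b) = P a * P b.
Proof.
move=> AB [F1 [S1 [A1 m1 ->]]] [F2 [S2 [A2 m2 ->]]].
have dis i : i \in F1 -> i \in F2 -> False.
  by move=> /A1 Ai /A2 Bi; have : (A `&` B) i by []; rewrite AB.
rewrite cylinders_meet !indX//; last by move=> i _; apply: measurableI; case: ifP.
have p12 : perm_eq (F1 `|` F2)%fset (F1 ++ F2).
  apply: uniq_perm; first exact: fset_uniq.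
    rewrite cat_uniq !fset_uniq andbT /=; apply/hasPn => i i2; apply/negP => i1.
    exact: (dis i).
  by move=> i; rewrite mem_cat inE.
rewrite (perm_big _ p12) big_cat/=; congr (_ * _); apply: eq_big_seq => i iF; rewrite iF.
  by case: ifP => [/dis|_]; [case|rewrite setIT].
by case: ifP => [/dis|_]; [case|rewrite setTI].
Qed.

(** Uniqueness of finite measures on a pi-system, used twice: for fixed [e], the probability of the
    intersection with [e] and [P c * P e] are measures in [c] that agree on cylinders. Each pass
    extends one argument from cylinders to the generated sigma-algebra. *)
Lemma sigma_cylinders_indep (A B : set I) a b : A `&` B = set0 ->
  <<s cylinders A >> a -> <<s cylinders B >> b -> P (a `&` b) = P a * P b.
Proof.
move=> AB sa sb.
have key (D E : set I) c e : D `&` E = set0 ->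
    measurable e -> (forall c', cylinders D c' -> P (c' `&` e) = P c' * P e) ->
    <<s cylinders D >> c -> P (c `&` e) = P c * P e.
  move=> DE me h sc.
  have p0 : (0 <= fine (P e))%R by apply: fine_ge0.
  have -> : P c * P e = mscale (NngNum p0) P c.
    by rewrite /mscale/= fineK ?fin_num_measure// muleC.
  apply: (g_sigma_algebra_measure_unique (cylinders D) (@cylinders_measurable D)
     (fun=> setT) (fun=> @cylinders_setT D) _ (mrestr P me) (mscale (NngNum p0) P)) => //.
  - by rewrite bigcup_const//; exists 0%N.
  - exact: cylinders_setI.
  - move=> c' /h hc; apply: (etrans hc).
    by rewrite /= /mscale/= fineK ?fin_num_measure// muleC.
  - by move=> _; rewrite /= /mrestr setTI; apply: le_lt_trans (probability_le1 _ _) _ => //; rewrite ltry.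
have mb : measurable b.
  by move: b sb; apply: smallest_sub; [exact: sigma_algebra_measurable|exact: cylinders_measurable].
apply: (key A B) => // c' cc'; rewrite setIC muleC.
apply: (key B A) => //; first by rewrite setIC.
  exact: cylinders_measurable cc'.
by move=> d' cd; rewrite setIC muleC; apply: (cylinders_indep _ _ _ _ AB).
Qed.

(** [T] with only the events generated by the coordinates in [A]. The identity maps to this type for
    [A] and for its complement act as projections to two independent factors. *)
Definition TA (A : set I) := g_sigma_algebraType (cylinders A).

Lemma measurable_idA (A : set I) : measurable_fun setT (id : T -> TA A).
Proof.
move=> _ B mB; rewrite setTI preimage_id.
by move: B mB; apply: smallest_sub; [exact: sigma_algebra_measurable|exact: cylinders_measurable].
Qed.

Lemma measurable_coordA (A : set I) i : A i -> measurable_fun setT (X i : TA A -> R).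
Proof.
move=> Ai _ B mB; rewrite setTI; apply: sub_sigma_algebra.
exists [fset i]%fset, (fun=> B); split => //; first by move=> j; rewrite inE => /eqP->.
by apply/seteqP; split => [t Xt j /=|t /(_ i)]; [rewrite inE => /eqP->|rewrite /= inE eqxx; exact].
Qed.

(* Product measures only enter here: the law of t |-> (t, t) on the two generated
   sigma-algebras is the product of its marginals. *)
Lemma integral_resample (A : set I) (phi : (I -> R) -> \bar R) :
  (forall x, 0 <= phi x) ->
  (forall (d' : measure_display) (S : measurableType d') (Z : I -> S -> R),
     (forall i, measurable_fun setT (Z i)) ->
     measurable_fun setT (fun s => phi (Z^~ s))) ->
  \int[P]_t phi (X^~ t) =
  \int[P]_t2 \int[P]_t1 phi (fun i => if i \in A then X i t1 else X i t2).
Proof.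
move=> phi0 mphi.
pose Y1 : {mfun T >-> TA A} := HB.pack (id : T -> TA A)
  (isMeasurableFun.Build _ _ _ _ _ (@measurable_idA A)).
pose Y2 : {mfun T >-> TA (~` A)} := HB.pack (id : T -> TA (~` A))
  (isMeasurableFun.Build _ _ _ _ _ (@measurable_idA (~` A))).
pose f (z : TA A * TA (~` A)) := phi (fun i => if i \in A then X i z.1 else X i z.2).
have -> : \int[P]_t phi (X^~ t) = \int[P]_t f (Y1 t, Y2 t).
  by apply: eq_integral => t _; rewrite /f/=; congr phi; apply/funext => i; case: ifP.
rewrite integral_indep_pair//.
- move=> a b ma mb; apply: (@sigma_cylinders_indep A (~` A)) => //.
  by rewrite setICr.
(* The mixed family on the product of the two generated spaces is one more realization of the
   couplings; this is why the hypothesis on [phi] quantifies over all realizations. *)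
- pose Z i := if i \in A then (fun z : TA A * TA (~` A) => X i z.1) else (fun z => X i z.2).
  have -> : f = fun z => phi (Z^~ z).
    by apply/funext => z; rewrite /f; congr phi; apply/funext => i; rewrite /Z; case: ifP.
  apply: mphi => i; rewrite /Z; case: ifPn => iA.
    exact: (measurableT_comp (measurable_coordA A i (set_mem iA)) measurable_fst).
  have niA : (~` A) i by move=> Ai; rewrite mem_set in iA.
  exact: (measurableT_comp (measurable_coordA (~` A) i niA) measurable_snd).
- by move=> z; exact: phi0.
Qed.

End Family.
End Independence.

(** * Averaging a rational function of one random variable *)

Section ComplexNorm.
Context {R : realType}.
Implicit Types x y : R[i].

Lemma normc_ge0 x : 0 <= normc x.
Proof. by case: x => a b; rewrite sqrtr_ge0. Qed.

Lemma ler_normcD x y : normc (x + y) <= normc x + normc y.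
Proof. exact: le_normcD. Qed.

Lemma normc_opp x : normc (- x) = normc x.
Proof. exact: normcN. Qed.

Lemma normc_eq0 x : (normc x == 0) = (x == 0).
Proof. by apply/eqP/eqP => [/eq0_normc|->]; rewrite ?normc0. Qed.

Lemma normc_gt0 x : (0 < normc x) = (x != 0).
Proof. by rewrite lt_def normc_ge0 andbT normc_eq0. Qed.

Lemma normc_prod (I : Type) (s : seq I) (F : I -> R[i]) :
  normc (\prod_(i <- s) F i) = \prod_(i <- s) normc (F i).
Proof. by elim/big_rec2: _ => [|i a b _ <-]; rewrite ?normc1 ?normcM. Qed.

Lemma ler_normc_sum (I : Type) (s : seq I) (F : I -> R[i]) :
  normc (\sum_(i <- s) F i) <= \sum_(i <- s) normc (F i).
Proof.
elim/big_rec2: _ => [|i a b _ h]; first by rewrite normc0.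
by apply: le_trans (ler_normcD _ _) _; rewrite lerD2l.
Qed.

Lemma normc_real (a : R) : normc a%:C%C = `|a|.
Proof. by rewrite /= expr0n addr0 sqrtr_sqr. Qed.

Lemma ler_Re_normc x : `|complex.Re x| <= normc x.
Proof. by case: x => a b /=; rewrite -sqrtr_sqr ler_wsqrtr// lerDl sqr_ge0. Qed.

Lemma ler_Im_normc x : `|complex.Im x| <= normc x.
Proof. by case: x => a b /=; rewrite -sqrtr_sqr ler_wsqrtr// lerDr sqr_ge0. Qed.

Lemma sqr_normc_ReIm x : normc x ^+ 2 = complex.Re x ^+ 2 + complex.Im x ^+ 2.
Proof. by case: x => a b /=; rewrite sqr_sqrtr// addr_ge0 ?sqr_ge0. Qed.

End ComplexNorm.

Section RationalComparison.
Context {R : realType}.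
Implicit Types p q : {poly R[i]}.

Definition croots p : seq R[i] := sval (closed_field_poly_normal p).

Lemma crootsE p : p = lead_coef p *: \prod_(z <- croots p) ('X - z%:P).
Proof. by rewrite /croots; case: closed_field_poly_normal. Qed.

Lemma size_croots p n : (size p <= n.+1)%N -> p != 0 -> (size (croots p) <= n)%N.
Proof.
move=> sp p0; move: sp; rewrite {1}(crootsE p) size_scale ?lead_coef_eq0//.
by rewrite size_prod_XsubC.
Qed.

Lemma normc_horner_croots p x :
  normc p.[x] = normc (lead_coef p) * \prod_(z <- croots p) normc (x - z).
Proof.
rewrite {1}(crootsE p) hornerZ normcM; congr (_ * _).
by rewrite horner_prod normc_prod; apply: eq_bigr => z _; rewrite !hornerE.
Qed.

Lemma normc_horner_le p (N : nat) (x y : R[i]) (e D : R) :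
  (size p <= N.+1)%N -> 0 < e -> 0 <= D ->
  (forall z, z \in croots p -> e <= normc (y - z)) -> normc (x - y) <= D ->
  normc p.[x] <= (1 + D / e) ^+ N * normc p.[y].
Proof.
move=> sp e0 D0 hz hD.
have c1 : 1 <= 1 + D / e by rewrite lerDl divr_ge0// ltW.
have [->|p0] := eqVneq p 0; first by rewrite !horner0 normc0 mulr0.
rewrite !normc_horner_croots mulrCA ler_wpM2l ?normc_ge0//.
apply: (@le_trans _ _ ((1 + D / e) ^+ size (croots p) * \prod_(z <- croots p) normc (y - z))).
  elim: (croots p) hz => [|z s IH] hz; first by rewrite !big_nil expr0 mulr1.
  rewrite !big_cons /= exprS mulrACA; apply: ler_pM.
  - exact: normc_ge0.
  - by rewrite prodr_ge0// => i _; exact: normc_ge0.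
  - have hy := hz z (mem_head _ _).
    have -> : x - z = (x - y) + (y - z) by rewrite addrA subrK.
    apply: le_trans (ler_normcD _ _) _; rewrite mulrDl mul1r addrC lerD2l.
    apply: le_trans hD _; rewrite -mulrA ler_peMr// mulrC ler_pdivlMr// mul1r.
    exact: hy.
  - by apply: IH => w ws; apply: hz; rewrite in_cons ws orbT.
rewrite ler_wpM2r ?prodr_ge0// => [i _|]; first exact: normc_ge0.
by rewrite ler_weXn2l// size_croots.
Qed.

(** The comparison for denominators. Here the roots may come close to [x], so the quotient
    [D / |x - z|] stays and is integrated later as a pole. *)
Lemma normc_horner_ge q (x y : R[i]) (D : R) :
  q.[x] != 0 -> normc (x - y) <= D ->
  normc q.[y] <= normc q.[x] * \prod_(z <- croots q) (1 + D / normc (x - z)).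
Proof.
move=> qx hD; rewrite !normc_horner_croots -mulrA ler_wpM2l ?normc_ge0// -big_split /=.
have : \prod_(z <- croots q) normc (x - z) != 0.
  by move: qx; rewrite -normc_eq0 normc_horner_croots mulf_eq0 negb_or => /andP[].
elim: (croots q) => [|z s IH]; first by rewrite !big_nil.
rewrite !big_cons mulf_eq0 negb_or => /andP[xz /IH{}IH].
apply: ler_pM => //; first exact: normc_ge0.
  by rewrite prodr_ge0// => i _; exact: normc_ge0.
rewrite mulrDr mulr1 mulrCA divff// mulr1.
have -> : y - z = (x - z) + (y - x) by rewrite [RHS]addrC addrA subrK.
apply: le_trans (ler_normcD _ _) _; rewrite lerD2l.
by rewrite -normc_opp opprB.
Qed.

(** Pigeonhole: a root lies within [e] of at most one of [N + 1] points that are [2 e] apart, so [N]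
    roots leave a point free. *)
Lemma exists_far_point (N : nat) (pts : nat -> R[i]) (e : R) (rs : seq R[i]) :
  (forall i j, (i <= N)%N -> (j <= N)%N -> i != j -> e *+ 2 <= normc (pts i - pts j)) ->
  (size rs <= N)%N ->
  exists2 j, (j <= N)%N & forall z, z \in rs -> e <= normc (pts j - z).
Proof.
move=> sep srs; apply: contrapT => H.
have near (j : 'I_N.+1) : {k : 'I_(size rs) | normc (pts j - rs`_k) < e}.
  apply: cid; apply: contrapT => Hj; apply: H; exists (val j); first exact: (ltn_ord j).
  move=> z zrs; rewrite leNgt; apply/negP => hz; apply: Hj.
  have iz : (index z rs < size rs)%N by rewrite index_mem.
  by exists (Ordinal iz); rewrite /= nth_index.
pose f j := sval (near j).
have finj : injective f.
  move=> i j fij; apply: contrapT => ij.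
  have hi : normc (pts i - rs`_(f i)) < e := svalP (near i).
  have hj : normc (pts j - rs`_(f i)) < e by rewrite fij; exact: (svalP (near j)).
  have ij' : nat_of_ord i != j by apply/negP => /eqP/val_inj.
  have := sep i j (ltn_ord i) (ltn_ord j) ij'; apply/negP.
  rewrite -ltNge.
  have -> : pts i - pts j = (pts i - rs`_(f i)) + - (pts j - rs`_(f i)).
    by rewrite opprB addrA subrK.
  by apply: le_lt_trans (ler_normcD _ _) _; rewrite normc_opp mulr2n ltrD.
have := leq_card f finj; rewrite !card_ord => /leq_trans/(_ srs).
by rewrite ltnn.
Qed.

End RationalComparison.

Section ComplexMeasurable.
Context {R : realType} {d : measure_display} {S : measurableType d}.
Implicit Types f g : S -> R[i].

Definition cmeasurable f :=
  measurable_fun setT (fun s => complex.Re (f s)) /\ measurable_fun setT (fun s => complex.Im (f s)).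

Lemma cmeasurable_cst c : cmeasurable (fun=> c).
Proof. by split; exact: measurable_cst. Qed.

Lemma cmeasurable_real (h : S -> R) :
  measurable_fun setT h -> cmeasurable (fun s => (h s)%:C%C).
Proof. by move=> mh; split => //=; exact: measurable_cst. Qed.

Lemma cmeasurableD f g : cmeasurable f -> cmeasurable g -> cmeasurable (fun s => f s + g s).
Proof.
move=> [f1 f2] [g1 g2]; split.
  rewrite (_ : (fun s => _) = (fun s => complex.Re (f s) + complex.Re (g s))); first exact: measurable_funD.
  by apply/funext => s; case: (f s) (g s) => ? ? [].
rewrite (_ : (fun s => _) = (fun s => complex.Im (f s) + complex.Im (g s))); first exact: measurable_funD.
by apply/funext => s; case: (f s) (g s) => ? ? [].
Qed.

Lemma cmeasurableM f g : cmeasurable f -> cmeasurable g -> cmeasurable (fun s => f s * g s).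
Proof.
move=> [f1 f2] [g1 g2]; split.
  rewrite (_ : (fun s => _) = (fun s => complex.Re (f s) * complex.Re (g s) - complex.Im (f s) * complex.Im (g s))).
    by apply: measurable_funB; apply: measurable_funM.
  by apply/funext => s; case: (f s) (g s) => ? ? [].
rewrite (_ : (fun s => _) = (fun s => complex.Re (f s) * complex.Im (g s) + complex.Im (f s) * complex.Re (g s))).
  by apply: measurable_funD; apply: measurable_funM.
by apply/funext => s; case: (f s) (g s) => ? ? [].
Qed.

Lemma cmeasurable_sum (I : Type) (s : seq I) (F : I -> S -> R[i]) :
  (forall i, cmeasurable (F i)) -> cmeasurable (fun x => \sum_(i <- s) F i x).
Proof.
move=> h; elim: s => [|i s IH].
  by under eq_fun do rewrite big_nil; exact: cmeasurable_cst.
by under eq_fun do rewrite big_cons; exact: cmeasurableD.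
Qed.

Lemma cmeasurable_prod (I : Type) (s : seq I) (F : I -> S -> R[i]) :
  (forall i, cmeasurable (F i)) -> cmeasurable (fun x => \prod_(i <- s) F i x).
Proof.
move=> h; elim: s => [|i s IH].
  by under eq_fun do rewrite big_nil; exact: cmeasurable_cst.
by under eq_fun do rewrite big_cons; exact: cmeasurableM.
Qed.

Lemma cmeasurable_horner (p : {poly R[i]}) f :
  cmeasurable f -> cmeasurable (fun s => p.[f s]).
Proof.
move=> mf; under eq_fun do rewrite horner_coef.
apply: cmeasurable_sum => i; apply: cmeasurableM; first exact: cmeasurable_cst.
elim: (nat_of_ord i) => [|n IH]; first by under eq_fun do rewrite expr0; exact: cmeasurable_cst.
by under eq_fun do rewrite exprS; exact: cmeasurableM.
Qed.

Lemma cmeasurable_normc f : cmeasurable f -> measurable_fun setT (fun s => normc (f s)).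
Proof.
move=> [f1 f2].
rewrite (_ : (fun s => _) = (fun s => (complex.Re (f s) ^+ 2 + complex.Im (f s) ^+ 2) `^ (2^-1))).
  apply: (measurableT_comp (measurable_powR _)).
  by apply: measurable_funD; exact: measurable_funX.
apply/funext => s; rewrite powR12_sqrt ?addr_ge0 ?sqr_ge0//.
by case: (f s).
Qed.

(* The convention [x / 0 = 0] agrees with [0 `^ (- a) = 0]. *)
Lemma powR_ratio (a b t : R) : t != 0 -> 0 <= a -> 0 <= b ->
  (a / b) `^ t = a `^ t * b `^ (- t).
Proof.
move=> t0 a0 b0; rewrite powRM// ?invr_ge0//; congr (_ * _).
have [->|bn0] := eqVneq b 0; first by rewrite invr0 !powR0// oppr_eq0.
by rewrite -(powR_inv1 b0) -powRrM mulN1r.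
Qed.

Lemma cmeasurable_powR_ratio f g (t : R) : t != 0 -> cmeasurable f -> cmeasurable g ->
  measurable_fun setT (fun s => (normc (f s) / normc (g s)) `^ t).
Proof.
move=> t0 mf mg; under eq_fun do rewrite powR_ratio ?normc_ge0//.
by apply: measurable_funM; apply: (measurableT_comp (measurable_powR _));
  exact: cmeasurable_normc.
Qed.

End ComplexMeasurable.

Section PoleIntegrals.
Context {R : realType}.

(** The product is at most the [N]-th power of its largest factor, and [t N <= 1 / 2]. Bounding the
    maximum by a sum leaves one pole at a time, of order one half, to integrate. *)
Lemma powR_prod_le (I : Type) (rs : seq I) (a : I -> R) (N : nat) (t : R) :
  (forall i, 1 <= a i) -> (size rs <= N)%N -> 0 <= t -> t * N%:R <= 2^-1 ->
  (\prod_(i <- rs) a i) `^ t <= 1 + \sum_(i <- rs) (a i) `^ (2^-1).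
Proof.
move=> a1 srs t0 tN; set m := \big[Num.max/1]_(i <- rs) a i.
have m1 : 1 <= m by rewrite /m; elim/big_rec: _ => // i x _ x1; rewrite le_max x1 orbT.
have pm : 1 <= \prod_(i <- rs) a i <= m ^+ size rs.
  rewrite /m; elim: rs {m srs m1} => [|i s /andP[IH1 IH2]]; first by rewrite !big_nil expr0 lexx.
  rewrite !big_cons /= -[X in X <= _](mulr1 1) ler_pM//= exprS ler_pM ?le_max ?lexx//.
  - exact: le_trans (a1 i).
  - exact: le_trans IH1.
  - apply: le_trans IH2 _; apply: lerXn2r; rewrite ?nnegrE.
    + by elim/big_rec: _ => // j x _ x1; rewrite le_max x1 orbT.
    + by rewrite le_max (le_trans _ (a1 i)).
    + by rewrite le_max lexx orbT.
have p0 : 0 <= \prod_(i <- rs) a i by case/andP: pm => h _; exact: le_trans h.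
apply: (@le_trans _ _ (m `^ (2^-1))).
  apply: (@le_trans _ _ ((m ^+ N) `^ t)).
    apply: ge0_ler_powR => //; rewrite ?nnegrE// ?exprn_ge0// ?(le_trans _ m1)//.
    by case/andP: pm => _ h; apply: le_trans h _; rewrite ler_weXn2l.
  by rewrite -powR_mulrn ?(le_trans _ m1)// -powRrM mulrC ler_powR.
rewrite /m {m m1 pm p0 srs}; elim: rs => [|i s IH]; first by rewrite !big_nil powR1 addr0.
rewrite !big_cons addrCA.
have s0 : 0 <= \sum_(j <- s) a j `^ 2^-1 by apply: sumr_ge0 => j _; exact: powR_ge0.
set m := \big[_/_]_(_ <- s) _ in IH *.
have [h|h] := leP (a i) m; first by apply: le_trans IH _; rewrite lerDr powR_ge0.
by rewrite lerDl addr_ge0.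
Qed.

Lemma sum_inv_sqr_le (n : nat) : \sum_(0 <= j < n) (j.+1%:R ^+ 2)^-1 <= 2 :> R.
Proof.
have : \sum_(0 <= j < n.+1) (j.+1%:R ^+ 2)^-1 <= 2 - n.+1%:R^-1 :> R.
  elim: n => [|n IH]; first by rewrite big_nat1 expr1n invr1; lra.
  rewrite big_nat_recr//=; apply: le_trans (lerD IH (lexx _)) _.
  rewrite -addrA lerD2l -[n.+2%:R]natr1; set x : R := n.+1%:R.
  have x0 : 0 < x by rewrite ltr0n.
  have -> : - x^-1 + ((x + 1) ^+ 2)^-1 = - (x + 1)^-1 - (x * (x + 1) ^+ 2)^-1.
    by field; rewrite !gt_eqF// ltr_wpDl.
  by rewrite gerDl oppr_le0 invr_ge0 mulr_ge0// ?exprn_ge0// ?addr_ge0// ltW.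
move=> h; apply: le_trans (_ : _ <= 2 - n.+1%:R^-1) _; last by rewrite gerDl oppr_le0 invr_ge0.
by apply: le_trans h; rewrite [leRHS]big_nat_recr//= lerDl invr_ge0 exprn_ge0.
Qed.

(** A discrete layer-cake formula: the integer part of [y ^ (- 1 / 2)] counts the [j] with
    [y <= 1 / (j + 1) ^ 2], which turns the mean of a pole into probabilities of intervals. *)
Lemma inv_sqrt_le_count (y : R) : 0 <= y ->
  exists N : nat, (1 + y^-1) `^ 2^-1 <= 2 + \sum_(0 <= j < N) (y <= (j.+1%:R ^+ 2)^-1)%R%:R.
Proof.
rewrite le_eqVlt => /orP[/eqP<-|y0].
  by exists 0%N; rewrite big_nil invr0 addr0 powR1 addr0 ler1n.
pose q := Num.sqrt y^-1; exists (Num.truncn q).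
have q0 : 0 <= q := sqrtr_ge0 _.
have qq : q ^+ 2 = y^-1 by rewrite sqr_sqrtr// invr_ge0 ltW.
have /andP[lo hi] := truncn_itv q0.
apply: (@le_trans _ _ (1 + q)).
  rewrite powR12_sqrt; last by rewrite addr_ge0// invr_ge0 ltW.
  rewrite -(ger0_norm (addr_ge0 ler01 q0)) -sqrtr_sqr ler_wsqrtr// -qq sqrrD expr1n mul1r.
  by rewrite lerD2r lerDl mulrn_wge0.
have -> : \sum_(0 <= j < Num.truncn q) (y <= (j.+1%:R ^+ 2)^-1)%R%:R = (Num.truncn q)%:R :> R.
  rewrite (eq_big_nat _ _ (F2 := fun=> 1)); last first.
    move=> j /andP[_ jN]; suff -> : y <= (j.+1%:R ^+ 2)^-1 by [].
    rewrite -[leLHS]invrK lef_pV2 ?posrE ?exprn_gt0 ?invr_gt0// -qq.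
    by apply: lerXn2r; rewrite ?nnegrE//; apply: le_trans lo; rewrite ler_nat.
  by rewrite big_const_nat subn0 iter_addr addr0.
by move: hi; rewrite -natr1; lra.
Qed.

End PoleIntegrals.

Section OneVariable.
Context {R : realType} {dT : measure_display} {T : measurableType dT}.
Context (P : probability T R) (X : T -> R) (M K : R).
Hypothesis mX : measurable_fun setT X.
Hypothesis M0 : 0 <= M.
Hypothesis K0 : 0 <= K.
Hypothesis concX : forall c e : R, 0 <= e -> (P [set t | (`|X t - c| <= e)%R] <= (2 * M * e)%:E)%E.
Hypothesis bdX : P [set t | (K < `|X t|)%R] = 0%E.

Let msub (c e : R) : measurable [set t | `|X t - c| <= e].
Proof.
rewrite -[X in measurable X]setTI.
apply: (@measurable_fun_ler _ _ _ setT (fun t => `|X t - c|) (fun=> e)) => //.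
apply: measurableT_comp; first exact: normr_measurable.
by apply: measurable_funB.
Qed.

Lemma integral_inv_sqrt (c : R[i]) :
  (\int[P]_t ((1 + (normc ((X t)%:C%C - c))^-1) `^ 2^-1)%:E <= (2 + 4 * M)%:E)%E.
Proof.
(* It suffices to look at the real part of the pole. An interval of half-width [1 / (j + 1) ^ 2] has
   probability at most [2 M / (j + 1) ^ 2], and the inverse squares sum to at most 2, whence
   [4 M]. *)
pose A j := [set t | `|X t - complex.Re c| <= (j.+1%:R ^+ 2)^-1].
have mA j : measurable (A j) by exact: msub.
have mser : measurable_fun setT (fun t => \sum_(0 <= j <oo) (\1_(A j) t)%:E : \bar R)%E.
  apply: ge0_emeasurable_sum => [j t _ _|j _]; first by rewrite lee_fin.
  by apply/measurable_EFinP; exact: measurable_indic.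
apply: (@le_trans _ _ (\int[P]_t (2%:E + \sum_(0 <= j <oo) (\1_(A j) t)%:E))%E).
  apply: le_lower_integral => t; first by rewrite lee_fin powR_ge0.
  have [N hN] := inv_sqrt_le_count _ (normc_ge0 ((X t)%:C%C - c)).
  apply: (@le_trans _ _ (2%:E + \sum_(0 <= j < N) (\1_(A j) t)%:E)%E); last first.
    by rewrite leeD2l// nneseries_lim_ge// => j _ _; rewrite lee_fin.
  rewrite sumEFin -EFinD lee_fin; apply: le_trans hN _; rewrite lerD2l.
  apply: ler_sum => j _; rewrite indicE ler_nat; case: (leP (normc _)) => // h.
  rewrite mem_set//=; apply: le_trans h.
  by have := ler_Re_normc ((X t)%:C%C - c); case: (c).
rewrite ge0_integralD//; last first.
  by move=> t _; apply: nneseries_ge0 => j _ _; rewrite lee_fin.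
rewrite integral_cst// [X in (_ * X)%E](_ : _ = 1%E); last exact: probability_setT.
rewrite mule1 integral_nneseries//; last first.
  by move=> j; apply/measurable_EFinP; exact: measurable_indic.
rewrite [leRHS]EFinD leeD2l//.
apply: lime_le; first by apply: is_cvg_nneseries => j _ _; exact: integral_ge0.
apply: nearW => n; rewrite (_ : (4 * M) = 2 * M * 2); last by ring.
apply: (@le_trans _ _ (\sum_(0 <= j < n) (2 * M * (j.+1%:R ^+ 2)^-1)%:E)%E).
  apply: lee_sum => j _; rewrite integral_indic// setIT; apply: concX.
  by rewrite invr_ge0 exprn_ge0.
by rewrite sumEFin lee_fin -mulr_sumr ler_wpM2l// ?mulr_ge0// sum_inv_sqr_le.
Qed.

Definition poles (s : seq R[i]) (x : R[i]) : R := \prod_(z <- s) (1 + (normc (x - z))^-1).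

Lemma poles_ge1 s x : 1 <= poles s x.
Proof.
rewrite /poles; elim/big_rec: _ => // z y _ y1.
by rewrite -[leLHS](mulr1 1) ler_pM// lerDl invr_ge0 normc_ge0.
Qed.

Lemma poles_ge0 s x : 0 <= poles s x.
Proof. exact: le_trans (poles_ge1 _ _). Qed.

Lemma poles_scale s x (D : R) (N : nat) : 1 <= D -> (size s <= N)%N ->
  \prod_(z <- s) (1 + D / normc (x - z)) <= D ^+ N * poles s x.
Proof.
move=> D1 sN; have D0 : 0 <= D by exact: le_trans D1.
apply: (@le_trans _ _ (D ^+ size s * poles s x)); last first.
  by rewrite ler_wpM2r ?poles_ge0// ler_weXn2l.
rewrite /poles; elim: s {sN} => [|z s IH]; first by rewrite !big_nil expr0 mulr1.
rewrite !big_cons /= exprS mulrACA ler_pM//.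
- by rewrite addr_ge0// divr_ge0// normc_ge0.
- by apply: prodr_ge0 => w _; rewrite addr_ge0// divr_ge0// normc_ge0.
- by rewrite mulrDr mulr1 lerD2r.
Qed.

Let mpoles (s : seq R[i]) (t : R) :
  measurable_fun setT (fun w => poles s (X w)%:C%C `^ t).
Proof.
apply: (measurableT_comp (measurable_powR _)).
apply: measurable_prod => z _; apply: measurable_funD => //.
rewrite (_ : (fun x => _) = (fun x => (normc ((X x)%:C%C - z)) `^ (-1))); last first.
  by apply/funext => w; rewrite powR_inv1 ?normc_ge0.
apply: (measurableT_comp (measurable_powR _)); apply: cmeasurable_normc.
by apply: cmeasurableD; [exact: cmeasurable_real|exact: cmeasurable_cst].
Qed.

Lemma integral_poles (s : seq R[i]) (N : nat) (t : R) :
  (size s <= N)%N -> 0 <= t -> t * N%:R <= 2^-1 ->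
  (\int[P]_w (poles s (X w)%:C%C `^ t)%:E <= (1 + N%:R * (2 + 4 * M))%:E)%E.
Proof.
move=> sN t0 tN.
pose g (z : R[i]) w := (1 + (normc ((X w)%:C%C - z))^-1) `^ 2^-1.
have mg z : measurable_fun setT (g z).
  have := mpoles [:: z] 2^-1; rewrite /poles; under eq_fun do rewrite big_seq1.
  exact.
have g0 z w : 0 <= g z w by exact: powR_ge0.
apply: (@le_trans _ _ (\int[P]_w (1%:E + \sum_(z <- s) (g z w)%:E))%E).
  apply: le_lower_integral => w; first by rewrite lee_fin powR_ge0.
  rewrite sumEFin -EFinD lee_fin; apply: powR_prod_le sN t0 tN => z.
  by rewrite lerDl invr_ge0 normc_ge0.
rewrite ge0_integralD//; last 2 first.
- by move=> w _; apply: sume_ge0 => z _; rewrite lee_fin.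
- by apply: emeasurable_sum => z; exact/measurable_EFinP.
rewrite integral_cst// [X in (_ * X)%E](_ : _ = 1%E); last exact: probability_setT.
rewrite mule1 EFinD leeD2l// ge0_integral_sum//; last 2 first.
- by move=> z; exact/measurable_EFinP.
- by move=> z w _; rewrite lee_fin.
apply: (@le_trans _ _ (\sum_(z <- s) (2 + 4 * M)%:E)%E).
  by apply: lee_sum => z _; exact: integral_inv_sqrt.
rewrite sumEFin lee_fin big_const_seq count_predT iter_addr addr0 -[leLHS]mulr_natl.
by rewrite ler_wpM2r ?ler_nat// addr_ge0// mulr_ge0.
Qed.

Definition ratio (p q : {poly R[i]}) (x : R[i]) : R := normc p.[x] / normc q.[x].

Lemma ratio_ge0 p q x : 0 <= ratio p q x.
Proof. by rewrite divr_ge0 ?normc_ge0. Qed.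

Let mratio (p q : {poly R[i]}) (t : R) : 0 < t -> measurable_fun setT (fun w => ratio p q (X w)%:C%C `^ t).
Proof.
move=> t0; apply: cmeasurable_powR_ratio; first by rewrite gt_eqF.
  by apply: cmeasurable_horner; exact: cmeasurable_real.
by apply: cmeasurable_horner; exact: cmeasurable_real.
Qed.

Lemma ratio_le (p q : {poly R[i]}) (N : nat) (x y : R[i]) (e D : R) :
  (size p <= N.+1)%N -> (size q <= N.+1)%N -> 0 < e -> 1 <= D ->
  (forall z, z \in croots p -> e <= normc (y - z)) -> normc (x - y) <= D ->
  q.[x] != 0 -> q.[y] != 0 ->
  ratio p q x <= (1 + D / e) ^+ N * D ^+ N * ratio p q y * poles (croots q) x.
Proof.
move=> sp sq e0 D1 he hD qx qy; have D0 : 0 <= D by exact: le_trans D1.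
have q0 : q != 0 by apply: contraNneq qx => ->; rewrite horner0.
have h1 := normc_horner_le p N x y e D sp e0 D0 he hD.
have h2 : normc q.[y] <= normc q.[x] * (D ^+ N * poles (croots q) x).
  apply: le_trans (normc_horner_ge _ _ _ _ qx hD) _; rewrite ler_wpM2l ?normc_ge0//.
  by rewrite poles_scale// size_croots.
rewrite /ratio ler_pdivrMr ?normc_gt0//.
apply: le_trans h1 _; rewrite -!mulrA ler_wpM2l ?exprn_ge0 ?addr_ge0 ?divr_ge0 ?(ltW e0)//.
rewrite mulrCA ler_peMr ?normc_ge0// mulrCA ler_pdivlMl ?normc_gt0// mulr1.
by rewrite mulrC -mulrA [leRHS]mulrC -mulrA mulrC -!mulrA in h2 *.
Qed.

Lemma measure_near_roots (s : seq R[i]) (e : R) : 0 <= e ->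
  (P (\big[setU/set0]_(z <- s) [set t | (`|X t - complex.Re z| <= e)%R])
     <= ((size s)%:R * (2 * M * e))%:E)%E.
Proof.
move=> e0; elim: s => [|z s IH]; first by rewrite big_nil measure0 mul0r.
rewrite big_cons; apply: le_trans (measureU2 _ _ _) _; first exact: msub.
  by apply: bigsetU_measurable => y _; exact: msub.
rewrite /= -natr1 mulrDl mul1r addrC EFinD; apply: leeD => //.
exact: concX.
Qed.

(** [e] is so small that the [e]-neighbourhoods of at most [N] zeros have total probability at most
    one half, whence the leading 2. The number [1 + 2 K] bounds the distance between two values of
    the coupling and is at least 1. *)
Definition avg_const (N : nat) (t : R) : R :=
  let e := (4 * (M + 1) * N.+1%:R)^-1 in
  2 * ((1 + (1 + 2 * K) / e) ^+ N * (1 + 2 * K) ^+ N) `^ t.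

(* A rational function is, up to its poles, bounded by its average, since most
   points stay away from its zeros. *)
Lemma ratio_le_average (p q : {poly R[i]}) (N : nat) (t : R) (x : R) :
  (size p <= N.+1)%N -> (size q <= N.+1)%N -> 0 < t ->
  (forall r : R, q.[r%:C%C] != 0) -> `|x| <= K ->
  ((ratio p q x%:C%C `^ t)%:E <= (avg_const N t * poles (croots q) x%:C%C `^ t)%:E *
     \int[P]_w (ratio p q (X w)%:C%C `^ t)%:E)%E.
Proof.
move=> sp sq t0 qr xK; set J := (\int[P]_w _)%E.
have J0 : (0 <= J)%E by apply: integral_ge0 => w _; rewrite lee_fin powR_ge0.
have [->|p0] := eqVneq p 0.
  rewrite /ratio horner0 normc0 mul0r powR0 ?gt_eqF// mule_ge0// lee_fin.
  by rewrite !mulr_ge0// powR_ge0.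
rewrite /avg_const; set e := (4 * _ * _)^-1; set D := 1 + 2 * K.
set c := _ ^+ N * _.
have e0 : 0 < e by rewrite invr_gt0 !mulr_gt0// ltr_wpDl.
have D1 : 1 <= D by rewrite lerDl mulr_ge0.
have D0 : 0 <= D by exact: le_trans D1.
have c0 : 0 <= c.
  apply: mulr_ge0; apply: exprn_ge0 => //; apply: addr_ge0 => //.
  by apply: divr_ge0 => //; exact: ltW.
pose bad := [set w | K < `|X w|] `|` \big[setU/set0]_(z <- croots p) [set w | `|X w - complex.Re z| <= e].
have mK : measurable [set w | K < `|X w|].
  rewrite (_ : [set w | _] = ~` [set w | `|X w - 0| <= K]).
    by apply: measurableC; exact: msub.
  by apply/seteqP; split => w /=; rewrite subr0 ltNge => /negP.
have mbad : measurable bad.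
  apply: measurableU => //; apply: bigsetU_measurable => z _; exact: msub.
have Pbad : (P bad <= (2^-1)%:E)%E.
  apply: le_trans (measureU2 _ _ _) _ => //; first by apply: bigsetU_measurable => z _; exact: msub.
  rewrite [X in (X + _)%E](_ : _ = 0%E) ?add0e; last exact: bdX.
  apply: le_trans (measure_near_roots _ _ (ltW e0)) _; rewrite lee_fin.
  have sN : (size (croots p))%:R <= N.+1%:R :> R.
    by rewrite ler_nat; apply: leqW; exact: size_croots.
  apply: (@le_trans _ _ (N.+1%:R * (2 * (M + 1) * e))).
    apply: ler_pM => //; first by rewrite !mulr_ge0// ltW.
    by rewrite ler_wpM2r ?(ltW e0)// ler_wpM2l// lerDl.
  rewrite /e; have := ltr0Sn R N; have : 0 < M + 1 by rewrite ltr_wpDl.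
  move: (M + 1) (N.+1%:R) => a b a0 b0.
  by rewrite le_eqVlt; apply/orP; left; apply/eqP; field; rewrite !gt_eqF.
have Pgood : ((2^-1)%:E <= P (~` bad))%E.
  have /fineK Pf : P bad \is a fin_num by exact: fin_num_measure.
  by rewrite probability_setC//; move: Pbad; rewrite -Pf -EFinB !lee_fin; lra.
set kap := ratio p q x%:C%C `^ t; set B := (c * poles (croots q) x%:C%C) `^ t.
have k0 : 0 <= kap by exact: powR_ge0.
have key w : (~` bad) w -> kap <= B * ratio p q (X w)%:C%C `^ t.
  move=> /not_orP[wK wz].
  have wK' : `|X w| <= K by rewrite leNgt; apply/negP.
  rewrite -powRM ?ratio_ge0//; last by rewrite mulr_ge0// poles_ge0.
  apply: ge0_ler_powR; rewrite ?nnegrE ?ratio_ge0 ?(ltW t0)//.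
    by apply: mulr_ge0; [apply: mulr_ge0 => //; exact: poles_ge0|exact: ratio_ge0].
  rewrite mulrAC; apply: ratio_le => //.
    move=> z zp; rewrite leNgt; apply/negP => hz; apply: wz.
    rewrite -bigcup_seq; exists z => //=; apply: le_trans (ltW hz).
    by have := ler_Re_normc ((X w)%:C%C - z); case: (z).
  rewrite -rmorphB normc_real /D (le_trans (ler_normB _ _))//.
  by apply: le_trans (lerD xK wK') _; lra.
have : (kap%:E * P (~` bad) <= B%:E * J)%E.
  rewrite -ge0_integralZl//; last 3 first.
  - by apply/measurable_EFinP; exact: mratio.
  - by move=> w _; rewrite lee_fin powR_ge0.
  - by rewrite lee_fin powR_ge0.
  rewrite -[X in P X]setIT -integral_indic//; last exact: measurableC.
  rewrite -ge0_integralZl//; last first.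
    by apply/measurable_EFinP; apply: measurable_indic; exact: measurableC.
  apply: le_lower_integral => w; first by rewrite mule_ge0.
  rewrite -!EFinM lee_fin indicE; case: (boolP (w \in _)) => h.
    by rewrite mulr1; apply: key; exact: set_mem.
  by rewrite mulr0 mulr_ge0// powR_ge0.
move=> h.
have -> : 2 * c `^ t * poles (croots q) x%:C%C `^ t = 2 * B.
  by rewrite /B powRM ?poles_ge0// mulrA.
rewrite EFinM -muleA -[leLHS]mul1e.
rewrite (_ : 1%E = (2%:E * (2^-1)%:E))%E; last by rewrite -EFinM divff.
rewrite -muleA; apply: lee_wpmul2l => //; apply: le_trans h.
by rewrite muleC; apply: lee_wpmul2l.
Qed.

(** The factors come from replacing the first ratio by its average (degree [2 n]), from carrying the
    second one over to a complex point at distance at most [(K + 2) L], and from the [3 n] poles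
    left by both. *)
Definition resample_const (n : nat) (t : R) : R :=
  avg_const n.*2 t * ((1 + (K + 2) * (2 * n.+1%:R)) ^+ n * (K + 2) ^+ n) `^ t
    * (1 + (3 * n)%:R * (2 + 4 * M)).

(* The scale [L] is the size of the complex displacement: only the poles of the
   second factor see it, whence the power [L `^ (n t)]. *)
Lemma resample_one_variable (n : nat) (t L : R) (pts : nat -> R[i])
    (p1 q1 p2 q2 : {poly R[i]}) :
  0 < t -> t * (3 * n)%:R <= 2^-1 -> 1 <= L ->
  (forall i, (i <= n)%N -> normc (pts i) <= 2 * L) ->
  (forall i j, (i <= n)%N -> (j <= n)%N -> i != j -> L / n.+1%:R <= normc (pts i - pts j)) ->
  (size p1 <= n.*2.+1)%N -> (size q1 <= n.*2.+1)%N ->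
  (size p2 <= n.+1)%N -> (size q2 <= n.+1)%N ->
  (forall r : R, q1.[r%:C%C] != 0) -> (forall r : R, q2.[r%:C%C] != 0) ->
  (forall i, (i <= n)%N -> q2.[pts i] != 0) ->
  (\int[P]_w (ratio p1 q1 (X w)%:C%C `^ t * ratio p2 q2 (X w)%:C%C `^ t)%:E <=
   (resample_const n t * L `^ (n%:R * t) * \sum_(i < n.+1) ratio p2 q2 (pts i) `^ t)%:E *
     \int[P]_w (ratio p1 q1 (X w)%:C%C `^ t)%:E)%E.
Proof.
move=> t0 tn L1 hpt hsep sp1 sq1 sp2 sq2 q1r q2r q2p.
set J := (\int[P]_w (ratio p1 q1 _ `^ t)%:E)%E; set S := \sum_(i < _) _.
have J0 : (0 <= J)%E by apply: integral_ge0 => w _; rewrite lee_fin powR_ge0.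
have S0 : 0 <= S by apply: sumr_ge0 => i _; exact: powR_ge0.
have L0 : 0 < L by exact: lt_le_trans L1.
have K2 : 1 <= K + 2 by rewrite -[leLHS]add0r lerD// ler1n.
set c2 := (1 + (K + 2) * (2 * n.+1%:R)) ^+ n * (K + 2) ^+ n.
have c20 : 0 <= c2.
  rewrite mulr_ge0// exprn_ge0//; last exact: le_trans K2.
  by rewrite addr_ge0// mulr_ge0// (le_trans _ K2).
have A0 : 0 <= avg_const n.*2 t by rewrite mulr_ge0// powR_ge0.
(* Some candidate keeps distance [e = L / (2 (n + 1))] from the zeros of [p2]. Its distance to the
   support is of order [L] as well, so [D / e] is bounded independently of [L] and only [D ^ n]
   retains a power of [L]. *)
have far : exists2 i, (i <= n)%N & forall x : R, `|x| <= K ->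
    ratio p2 q2 x%:C%C <= c2 * L ^+ n * ratio p2 q2 (pts i) * poles (croots q2) x%:C%C.
  have [->|p20] := eqVneq p2 0.
    by exists 0%N => // x _; rewrite /ratio !horner0 normc0 !mul0r mulr0 mul0r.
  pose e := L / (2 * n.+1%:R); pose D := K + 2 * L.
  have e0 : 0 < e by rewrite divr_gt0// mulr_gt0.
  have [||i ni hi] := exists_far_point n pts e (croots p2).
  - move=> i j ni nj ij; apply: le_trans (hsep _ _ ni nj ij).
    rewrite -mulr_natr /e; have := ltr0Sn R n; move: (n.+1%:R) => a a0.
    by rewrite le_eqVlt; apply/orP; left; apply/eqP; field; rewrite gt_eqF.
  - exact: size_croots.
  exists i => // x xK.
  have D1 : 1 <= D by rewrite /D; have := K0; lra.
  have hD : normc (x%:C%C - pts i) <= D.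
    apply: le_trans (ler_normcD _ _) _; rewrite normc_real normc_opp lerD//.
    exact: hpt.
  have DL : D <= (K + 2) * L by rewrite mulrDl lerD2r ler_peMr.
  have De : D / e <= (K + 2) * (2 * n.+1%:R).
    rewrite ler_pdivrMr//; apply: le_trans DL _; rewrite /e.
    have := ltr0Sn R n; move: (n.+1%:R) => a a0.
    by rewrite le_eqVlt; apply/orP; left; apply/eqP; field; rewrite gt_eqF.
  have hr := ratio_le p2 q2 n _ (pts i) e D sp2 sq2 e0 D1 hi hD (q2r x) (q2p i ni).
  apply: le_trans hr _.
  rewrite ler_wpM2r ?poles_ge0// ler_wpM2r ?ratio_ge0// /c2 -[leRHS]mulrA -[X in _ <= _ * X]exprMn.
  have D0 : 0 <= D by exact: le_trans D1.
  have De0 : 0 <= 1 + D / e by apply: addr_ge0 => //; apply: divr_ge0 => //; exact: ltW.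
  have K20 : 0 <= K + 2 by exact: le_trans K2.
  apply: ler_pM; [exact: exprn_ge0|exact: exprn_ge0| |]; apply: lerXn2r; rewrite ?nnegrE//.
  - by apply: addr_ge0 => //; apply: mulr_ge0.
  - by rewrite lerD2l.
  - by apply: mulr_ge0 => //; exact: ltW.
have [i ni hi] := far.
have step w : `|X w| <= K ->
  ((ratio p1 q1 (X w)%:C%C `^ t * ratio p2 q2 (X w)%:C%C `^ t)%:E <=
   (avg_const n.*2 t * (c2 `^ t * L `^ (n%:R * t) * S))%:E * J *
     (poles (croots q1 ++ croots q2) (X w)%:C%C `^ t)%:E)%E.
  move=> wK; have h1 := ratio_le_average p1 q1 n.*2 t (X w) sp1 sq1 t0 q1r wK.
  have h2 : ratio p2 q2 (X w)%:C%C `^ t <=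
      c2 `^ t * L `^ (n%:R * t) * S * poles (croots q2) (X w)%:C%C `^ t.
    have Ln : 0 <= L ^+ n by rewrite exprn_ge0// ltW.
    have r0 : 0 <= c2 * L ^+ n * ratio p2 q2 (pts i).
      by apply: mulr_ge0; [exact: mulr_ge0|exact: ratio_ge0].
    apply: (@le_trans _ _ ((c2 * L ^+ n * ratio p2 q2 (pts i) * poles (croots q2) (X w)%:C%C) `^ t)).
      apply: ge0_ler_powR; rewrite ?nnegrE ?ratio_ge0 ?(ltW t0)//.
        by apply: mulr_ge0; [exact: r0|exact: poles_ge0].
      exact: hi.
    rewrite (powRM _ r0 (poles_ge0 _ _)) (powRM _ (mulr_ge0 c20 Ln) (ratio_ge0 _ _ _)).
    rewrite (powRM _ c20 Ln) -powR_mulrn ?(ltW L0)// -powRrM.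
    rewrite ler_wpM2r ?powR_ge0// ler_wpM2l ?mulr_ge0 ?powR_ge0//.
    (* The good index depends on the zeros, hence on the other couplings; the sum over all
       candidates removes this choice. *)
    rewrite /S (bigD1 (Ordinal (ni : (i < n.+1)%N)))//= lerDl.
    by apply: sumr_ge0 => j _; exact: powR_ge0.
  have n1 : (0 <= (ratio p1 q1 (X w)%:C%C `^ t)%:E)%E by rewrite lee_fin powR_ge0.
  have n2 : (0 <= (ratio p2 q2 (X w)%:C%C `^ t)%:E)%E by rewrite lee_fin powR_ge0.
  rewrite -lee_fin in h2; rewrite EFinM; apply: le_trans (lee_pmul n1 n2 h1 h2) _.
  rewrite /poles big_cat/= -!/(poles _ _) (powRM _ (poles_ge0 (croots q1) _) (poles_ge0 (croots q2) _)) -/J.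
  set u1 := avg_const _ _; set u2 := c2 `^ t * _ * _; set v1 := poles _ _ `^ t.
  set v2 := poles _ _ `^ t.
  rewrite le_eqVlt; apply/orP; left; apply/eqP.
  by rewrite muleAC -EFinM [RHS]muleAC -EFinM; congr (_%:E * _)%E; ring.
set H := 1 + (3 * n)%:R * (2 + 4 * M).
have H0 : 0 <= H by rewrite addr_ge0// mulr_ge0// addr_ge0// mulr_ge0.
have mp := mpoles (croots q1 ++ croots q2) t.
apply: (@le_trans _ _ (\int[P]_w ((avg_const n.*2 t * (c2 `^ t * L `^ (n%:R * t) * S))%:E * J *
     (poles (croots q1 ++ croots q2) (X w)%:C%C `^ t)%:E))%E).
  (* [step] holds where [|X| <= K], that is almost surely. *)
  apply: ae_ge0_le_integral => //.
  - by move=> w _; rewrite lee_fin mulr_ge0// powR_ge0.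
  - by apply/measurable_EFinP; apply: measurable_funM; exact: mratio.
  - by move=> w _; rewrite !mule_ge0// lee_fin ?powR_ge0// !mulr_ge0// powR_ge0.
  - by apply: measurable_funeM; exact/measurable_EFinP.
  exists [set w | K < `|X w|]; split => //.
    rewrite (_ : [set w | _] = ~` [set w | `|X w - 0| <= K]).
      by apply: measurableC; exact: msub.
    by apply/seteqP; split => w /=; rewrite subr0 ltNge => /negP.
  move=> w /= hw; rewrite ltNge; apply/negP => wK; apply: hw => _; exact: step.
rewrite ge0_integralZl//; last 3 first.
- exact/measurable_EFinP.
- by move=> w _; rewrite lee_fin powR_ge0.
- by rewrite mule_ge0// lee_fin !mulr_ge0// powR_ge0.
apply: (@le_trans _ _ ((avg_const n.*2 t * (c2 `^ t * L `^ (n%:R * t) * S))%:E * J * H%:E)%E).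
  apply: lee_wpmul2l.
    by rewrite mule_ge0// lee_fin !mulr_ge0// powR_ge0.
  apply: integral_poles => //; last exact: ltW.
  rewrite size_cat; have q10 : q1 != 0 by apply: contraNneq (q1r 0) => ->; rewrite horner0.
  have q20 : q2 != 0 by apply: contraNneq (q2r 0) => ->; rewrite horner0.
  apply: leq_trans (leq_add (size_croots _ _ sq1 q10) (size_croots _ _ sq2 q20)) _.
  by rewrite -mul2n -mulSnr.
rewrite le_eqVlt; apply/orP; left; apply/eqP.
rewrite muleAC -EFinM; congr (_%:E * _)%E.
by rewrite /resample_const -/c2 -/H; ring.
Qed.

End OneVariable.

(** * Finite-volume Green functions *)

Section PolynomialDeterminant.
Context {F : fieldType}.

(** Each term of the Leibniz formula takes one entry per row, so the degree is at most the number of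
    rows that may contain the variable. *)
Lemma size_det_poly (N : nat) (A : 'M[{poly F}]_N) (b : 'I_N -> bool) :
  (forall i j, (size (A i j) <= (b i).+1)%N) ->
  (size (\det A) <= (\sum_(i < N) b i).+1)%N.
Proof.
move=> sA; rewrite /determinant; apply: (leq_trans (size_sum _ _ _)).
apply/bigmax_leqP => s _; rewrite size_Msign.
apply: (big_rec2 (fun (m : nat) (p : {poly F}) => (size p <= m.+1)%N)) => [|i m p _ IH].
  by rewrite size_poly1.
apply: leq_trans (size_polyMleq _ _) _.
have := leq_add (sA i ((s : {perm 'I_N}) i)) IH; rewrite addSn addnS.
by case: (size _ + size _)%N => //= k; rewrite ltnS.
Qed.

Lemma size_adj_poly (N : nat) (A : 'M[{poly F}]_N) (b : 'I_N -> bool) i0 j0 :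
  (forall i j, (size (A i j) <= (b i).+1)%N) ->
  (size (\adj A i0 j0) <= (\sum_(i < N) b i).+1)%N.
Proof.
move=> sA; rewrite mxE /cofactor size_Msign.
apply: leq_trans (size_det_poly _ _ (fun i => b (lift j0 i)) _) _.
  by move=> i j; rewrite !mxE.
rewrite ltnS; have [k kE] : exists k : 'I_N, k = j0 by exists j0.
have -> : (\sum_(i < N.-1) b (lift j0 i) = \sum_(i < N | j0 != i) b i)%N.
  rewrite (reindex_omap (lift j0) (unlift j0)) /=; last first.
    by move=> i /unlift_some[i' iE uE]; rewrite uE /= -iE.
  by apply: eq_bigl => i; rewrite liftK eqxx andbT neq_lift.
by rewrite [leqRHS](bigID (fun i => j0 != i))/= leq_addr.
Qed.

End PolynomialDeterminant.

Section FiniteGreen.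
Context {R : realType} {V : choiceType}.
Local Notation C := R[i].
Variable a : V -> V -> nat.
Hypothesis aC : forall x y, a x y = a y x.
Implicit Types (Lam : {fset V}) (c h : V -> C).

Definition hop Lam c h x : C := - \sum_(y <- Lam) (a x y)%:R * h y + c x * h x.

Definition site Lam (i : 'I_#|{: Lam}|) : V := val (enum_val i).
Definition hmx Lam c : 'M[C]_#|{: Lam}| :=
  \matrix_(i, j) (- (a (site Lam i) (site Lam j))%:R + (i == j)%:R * c (site Lam i)).
Definition gden Lam c : C := \det (hmx Lam c).
(** The indicators extend the adjugate entry by 0 to sites outside [Lam], in accordance with the
    convention for Green functions, and keep the numerator polynomial in the diagonal [c]. *)
Definition gnum Lam c x y : C :=
  \sum_i \sum_j (site Lam i == x)%:R * (site Lam j == y)%:R * \adj (hmx Lam c) i j.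
Definition green Lam c x y : C := gnum Lam c x y / gden Lam c.

Lemma site_in Lam i : site Lam i \in Lam.
Proof. exact: valP. Qed.

Lemma site_inj Lam : injective (site Lam).
Proof. by move=> i j /val_inj/enum_val_inj. Qed.

Lemma siteP Lam x : x \in Lam -> exists i, site Lam i = x.
Proof. by move=> xL; exists (enum_rank [` xL]%fset); rewrite /site enum_rankK. Qed.

Lemma big_site Lam (f : V -> C) : \sum_(y <- Lam) f y = \sum_i f (site Lam i).
Proof.
rewrite big_seq_fsetE /= (big_enum_val (A := predT) (fun y => f (val y))).
by [].
Qed.

Lemma gnum_site Lam c i j : gnum Lam c (site Lam i) (site Lam j) = \adj (hmx Lam c) i j.
Proof.
rewrite /gnum (bigD1 i)//= (bigD1 j)//= !eqxx !mul1r big1 ?addr0 => [|k kj].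
  rewrite big1 ?addr0// => k ki; rewrite big1// => l _.
  by rewrite (inj_eq (@site_inj _)) (negPf ki) !mul0r.
by rewrite (inj_eq (@site_inj _) k) (negPf kj) mulr0 mul0r.
Qed.

Lemma gnum_out Lam c x y : ~~ ((x \in Lam) && (y \in Lam)) -> gnum Lam c x y = 0.
Proof.
move=> xy; rewrite /gnum big1// => i _; rewrite big1// => j _.
case: eqP => [ix|]; last by rewrite !mul0r.
case: eqP => [jy|]; last by rewrite mulr0 mul0r.
by rewrite -ix -jy !site_in in xy.
Qed.

Lemma green_out Lam c x y : ~~ ((x \in Lam) && (y \in Lam)) -> green Lam c x y = 0.
Proof. by move=> xy; rewrite /green gnum_out// mul0r. Qed.

Lemma hmx_tr Lam c : (hmx Lam c)^T = hmx Lam c.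
Proof.
by apply/matrixP => i j; rewrite !mxE aC eq_sym; have [->|] := eqVneq i j; rewrite ?mul0r.
Qed.

Lemma green_sym Lam c x y : green Lam c x y = green Lam c y x.
Proof.
rewrite /green /gnum exchange_big /=; congr (_ / _); apply: eq_bigr => j _.
apply: eq_bigr => i _; rewrite -[in LHS]hmx_tr -trmx_adj mxE.
by rewrite [X in X * _]mulrC.
Qed.

Lemma hop_site Lam c h i :
  hop Lam c h (site Lam i) = \sum_j hmx Lam c i j * h (site Lam j).
Proof.
rewrite /hop big_site -sumrN.
under [RHS]eq_bigr do rewrite mxE mulrDl.
rewrite big_split /=; congr (_ + _); first by apply: eq_bigr => j _; rewrite mulNr.
rewrite (bigD1 i)//= eqxx mul1r big1 ?addr0// => j ji.
by rewrite eq_sym (negPf ji) !mul0r.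
Qed.

Lemma green_solves Lam c x y : gden Lam c != 0 -> x \in Lam -> y \in Lam ->
  hop Lam c (fun z => green Lam c z y) x = (x == y)%:R.
Proof.
move=> d0 /siteP[i <-] /siteP[j <-]; rewrite hop_site.
under eq_bigr do rewrite /green gnum_site mulrA.
rewrite -mulr_suml; have := mul_mx_adj (hmx Lam c) => /matrixP/(_ i j).
rewrite !mxE => ->; rewrite (inj_eq (@site_inj _)) mulrnAl divff//.
Qed.

Lemma green_repr Lam c h x : gden Lam c != 0 -> (forall y, y \notin Lam -> h y = 0) ->
  x \in Lam -> h x = \sum_(y <- Lam) green Lam c x y * hop Lam c h y.
Proof.
move=> d0 h0 /siteP[i <-]; rewrite big_site.
under eq_bigr => k _ do rewrite hop_site mulr_sumr.
rewrite exchange_big /=.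
have E j : \sum_k green Lam c (site Lam i) (site Lam k) *
    (hmx Lam c k j * h (site Lam j)) = (i == j)%:R * h (site Lam j).
  under eq_bigr => k _ do rewrite /green gnum_site mulrACA.
  rewrite -mulr_suml; have := mul_adj_mx (hmx Lam c) => /matrixP/(_ i j).
  rewrite !mxE => ->; rewrite -/(gden Lam c); case: (i == j); last by rewrite mulr0n !mul0r.
  by rewrite mulr1n mul1r mulVKf.
under eq_bigr do rewrite E.
rewrite (bigD1 i)//= eqxx mul1r big1 ?addr0// => j ji.
by rewrite eq_sym (negPf ji) mul0r.
Qed.

Lemma gden_neq0 Lam c :
  (forall h, (forall y, y \notin Lam -> h y = 0) ->
     (forall y, y \in Lam -> hop Lam c h y = 0) -> forall y, h y = 0) ->
  gden Lam c != 0.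
Proof.
move=> inj; apply/negP => /det0P[v v0 vM]; case/negP: v0; apply/eqP/rowP => i.
pose h y := \sum_j (site Lam j == y)%:R * v ord0 j.
have hs j : h (site Lam j) = v ord0 j.
  rewrite /h (bigD1 j)//= eqxx mul1r big1 ?addr0// => k kj.
  by rewrite (inj_eq (@site_inj _)) (negPf kj) mul0r.
rewrite mxE -hs; apply: inj => [y yL|y /siteP[j <-]].
  rewrite /h big1// => j _; case: eqP => [jy|]; last by rewrite mul0r.
  by rewrite -jy site_in in yL.
rewrite hop_site; move: vM => /rowP/(_ j); rewrite !mxE => E0.
apply: etrans E0; apply: eq_bigr => k _; by rewrite hs -[in LHS]hmx_tr mxE mulrC.
Qed.

Lemma hmx_ext Lam c c' : {in Lam, c =1 c'} -> hmx Lam c = hmx Lam c'.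
Proof. by move=> cc'; apply/matrixP => i j; rewrite !mxE cc'// site_in. Qed.

Lemma green_ext Lam c c' x y : {in Lam, c =1 c'} -> green Lam c x y = green Lam c' x y.
Proof. by move=> /hmx_ext E; rewrite /green /gnum /gden E. Qed.

(* First resolvent identity between [K] and [Lam]. *)
Lemma green_restrict K Lam c x y : (K `<=` Lam)%fset ->
  gden K c != 0 -> gden Lam c != 0 -> x \in K -> y \in Lam ->
  green Lam c x y = green K c x y +
    \sum_(w <- K) \sum_(w' <- (Lam `\` K)%fset)
       green K c x w * (a w w')%:R * green Lam c w' y.
Proof.
move=> KL dK dL xK yL.
(* The column of the larger volume, cut off to [K]. Under [hop K] it yields the source at [y] plus
   one term for each bond cut, and [green_repr] inverts this. *)
pose h z := if z \in K then green Lam c z y else 0.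
have h0 z : z \notin K -> h z = 0 by rewrite /h => /negPf ->.
have -> : green Lam c x y = h x by rewrite /h xK.
rewrite (green_repr _ _ _ _ dK h0 xK).
have hopE w : w \in K -> hop K c h w =
    (w == y)%:R + \sum_(w' <- (Lam `\` K)%fset) (a w w')%:R * green Lam c w' y.
  move=> wK; have wL := fsubsetP KL _ wK.
  rewrite -(green_solves _ _ _ _ dL wL yL) /hop {2}/h wK addrAC; congr (_ + _).
  have -> : \sum_(z <- Lam) (a w z)%:R * green Lam c z y =
     \sum_(z <- K) (a w z)%:R * green Lam c z y +
     \sum_(z <- (Lam `\` K)%fset) (a w z)%:R * green Lam c z y.
    rewrite -big_cat /=; apply: perm_big; apply: uniq_perm; first exact: fset_uniq.
      rewrite cat_uniq !fset_uniq andbT /=; apply/hasPn => z; rewrite inE => /andP[].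
      by [].
    move=> z; rewrite mem_cat inE; have [zK|] := boolP (z \in K) => //=.
    exact: (fsubsetP KL).
  rewrite opprD addrNK; congr (- _); apply: eq_big_seq => z zK.
  by rewrite /h zK.
rewrite big_seq; under eq_bigr => w wK do rewrite hopE// mulrDr.
rewrite -big_seq big_split /=; congr (_ + _).
  have [yK|yK] := boolP (y \in K).
    rewrite (bigD1_seq y)//= eqxx mulr1 big1 ?addr0// => w /negPf ->.
    by rewrite mulr0.
  rewrite green_out ?(negPf yK) ?andbF// big_seq big1// => w wK.
  case: eqP => [wy|]; last by rewrite mulr0.
  by rewrite -wy wK in yK.
by apply: eq_bigr => w _; rewrite mulr_sumr; apply: eq_bigr => w' _; rewrite mulrA.
Qed.

Lemma green_component K1 K c x y : (K1 `<=` K)%fset ->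
  gden K1 c != 0 -> gden K c != 0 -> x \in K1 -> y \in K ->
  (forall w w', w \in K1 -> w' \in K -> w' \notin K1 -> a w w' = 0%N) ->
  green K c x y = green K1 c x y.
Proof.
move=> KK d1 dK xK yK sep; rewrite (green_restrict _ _ _ _ _ KK d1 dK xK yK).
rewrite big_seq big1 ?addr0// => w wK; rewrite big_seq big1// => w'.
by rewrite inE => /andP[w1 w2]; rewrite sep// mulr0 mul0r.
Qed.

(** The variable [r] occurs only in the rows of sites with [w z != 0], hence the degree. Numerator
    and denominator are kept apart, so the identities also hold where the denominator vanishes. *)
Lemma green_rational Lam c (w : V -> C) (n : nat) (x y : V) :
  (\sum_(z <- Lam) (w z != 0%R) <= n)%N ->
  exists p q : {poly C}, [/\ (size p <= n.+1)%N, (size q <= n.+1)%N &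
    forall r : C, gnum Lam (fun z => c z + r * w z) x y = p.[r] /\
              gden Lam (fun z => c z + r * w z) = q.[r]].
Proof.
move=> wn.
pose b (i : 'I_#|{: Lam}|) := w (site Lam i) != 0.
have bn : (\sum_i b i <= n)%N.
  apply: leq_trans wn; rewrite big_seq_fsetE /=.
  by rewrite (big_enum_val (A := predT) (fun y => nat_of_bool (w (val y) != 0))).
pose A : 'M[{poly C}]_#|{: Lam}| := \matrix_(i, j)
  ((hmx Lam c i j)%:P + (i == j)%:R *: (w (site Lam i) *: 'X)).
have sA i j : (size (A i j) <= (b i).+1)%N.
  rewrite mxE; apply: leq_trans (size_polyD _ _) _; rewrite geq_max; apply/andP; split.
    by apply: leq_trans (size_polyC_leq1 _) _.
  apply: leq_trans (size_scale_leq _ _) _; rewrite /b.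
  have [->|_] := eqVneq (w (site Lam i)) 0; first by rewrite scale0r size_poly0.
  by apply: leq_trans (size_scale_leq _ _) _; rewrite size_polyX.
have AE r : hmx Lam (fun z => c z + r * w z) = map_mx (horner_eval r) A.
  apply/matrixP => i j; rewrite !mxE /horner_eval !hornerE.
  by rewrite mulrDr addrA [r * _]mulrC mulrA.
exists (\sum_i \sum_j ((site Lam i == x)%:R * (site Lam j == y)%:R) *: \adj A i j), (\det A).
split.
- apply: leq_trans (size_sum _ _ _) _; apply/bigmax_leqP => i _.
  apply: leq_trans (size_sum _ _ _) _; apply/bigmax_leqP => j _.
  apply: leq_trans (size_scale_leq _ _) _; apply: leq_trans (size_adj_poly _ _ _ _ _ sA) _.
  by rewrite ltnS.
- by apply: leq_trans (size_det_poly _ _ _ sA) _.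
move=> r; split; last by rewrite /gden AE det_map_mx.
rewrite /gnum AE -map_mx_adj horner_sum; apply: eq_bigr => i _.
by rewrite horner_sum; apply: eq_bigr => j _; rewrite mxE hornerZ.
Qed.

Section Measurability.
Context {dS : measure_display} {S : measurableType dS}.

Lemma cmeasurable_det (N : nat) (A : S -> 'M[C]_N) :
  (forall i j, cmeasurable (fun s => A s i j)) -> cmeasurable (fun s => \det (A s)).
Proof.
move=> mA; rewrite /determinant; apply: cmeasurable_sum => s.
by apply: cmeasurableM; [exact: cmeasurable_cst|exact: cmeasurable_prod].
Qed.

Lemma cmeasurable_hmx Lam (c : V -> S -> C) i j :
  (forall x, cmeasurable (c x)) -> cmeasurable (fun s => hmx Lam (c^~ s) i j).
Proof.
move=> mc; under eq_fun do rewrite mxE.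
apply: cmeasurableD; first exact: cmeasurable_cst.
by apply: cmeasurableM => //; exact: cmeasurable_cst.
Qed.

Lemma cmeasurable_gden Lam (c : V -> S -> C) :
  (forall x, cmeasurable (c x)) -> cmeasurable (fun s => gden Lam (c^~ s)).
Proof. by move=> mc; apply: cmeasurable_det => i j; exact: cmeasurable_hmx. Qed.

Lemma cmeasurable_gnum Lam (c : V -> S -> C) x y :
  (forall x, cmeasurable (c x)) -> cmeasurable (fun s => gnum Lam (c^~ s) x y).
Proof.
move=> mc; apply: cmeasurable_sum => i; apply: cmeasurable_sum => j.
apply: cmeasurableM; first exact: cmeasurable_cst.
under eq_fun do rewrite mxE /cofactor; apply: cmeasurableM; first exact: cmeasurable_cst.
apply: cmeasurable_det => k l; under eq_fun do rewrite !mxE.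
have := cmeasurable_hmx Lam c (lift j k) (lift i l) mc.
by under eq_fun do rewrite mxE.
Qed.

Lemma measurable_green Lam (c : V -> S -> C) x y (t : R) : t != 0 ->
  (forall x, cmeasurable (c x)) ->
  measurable_fun setT (fun s => normc (green Lam (c^~ s) x y) `^ t).
Proof.
move=> t0 mc; under eq_fun do rewrite /green normcM normcV.
by apply: cmeasurable_powR_ratio => //; [exact: cmeasurable_gnum|exact: cmeasurable_gden].
Qed.

End Measurability.

End FiniteGreen.

(** * Energy estimate with a sign pattern *)

Section Energy.
Context {R : realType} {V : choiceType}.
Local Notation C := R[i].
Variable a : V -> V -> nat.
Hypothesis aC : forall x y, a x y = a y x.

(* [imc u v] is the imaginary part of [u^* v]. *)
Definition imc (u v : C) : R := complex.Re u * complex.Im v - complex.Im u * complex.Re v.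

Lemma imcC u v : imc v u = - imc u v.
Proof. by rewrite /imc; ring. Qed.

Lemma imcD u v w : imc u (v + w) = imc u v + imc u w.
Proof. by case: u v w => ? ? [? ?] [? ?]; rewrite /imc /=; ring. Qed.

Lemma imc0 u : imc u 0 = 0.
Proof. by rewrite /imc /= !mulr0 subrr. Qed.

Lemma imcN u v : imc u (- v) = - imc u v.
Proof. by case: u v => ? ? [? ?]; rewrite /imc /=; ring. Qed.

Lemma imc_nat u v (n : nat) : imc u (n%:R * v) = n%:R * imc u v.
Proof.
have -> : n%:R = (n%:R : R)%:C%C :> C by rewrite rmorph_nat.
by case: u v => ? ? [? ?]; rewrite /imc /=; ring.
Qed.

Lemma imc_sum (I : Type) (s : seq I) u (F : I -> C) :
  imc u (\sum_(i <- s) F i) = \sum_(i <- s) imc u (F i).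
Proof. by elim/big_rec2: _ => [|i x y _ <-]; rewrite ?imc0 ?imcD. Qed.

Lemma imc_diag (c u : C) : imc u (c * u) = complex.Im c * normc u ^+ 2.
Proof. by rewrite sqr_normc_ReIm; case: c u => ? ? [? ?]; rewrite /imc /=; ring. Qed.

Lemma imc_le u v : `|imc u v| <= normc u * normc v.
Proof.
rewrite -(@ler_pXn2r _ 2)// ?nnegrE ?mulr_ge0 ?normc_ge0// exprMn !sqr_normc_ReIm.
rewrite real_normK ?num_real// /imc -subr_ge0.
set a1 := complex.Re u; set b1 := complex.Im u; set a2 := complex.Re v; set b2 := complex.Im v.
have -> : (a1 ^+ 2 + b1 ^+ 2) * (a2 ^+ 2 + b2 ^+ 2) - (a1 * b2 - b1 * a2) ^+ 2
  = (a1 * a2 + b1 * b2) ^+ 2 by ring.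
exact: sqr_ge0.
Qed.

Variables (N0 : nat) (Lam : {fset V}) (c : V -> C) (zone neg : pred V) (sg kap kap0 : R).
Hypothesis deg : forall x, x \in Lam -> (\sum_(y <- Lam) a x y <= N0)%N.
Hypothesis sg1 : `|sg| = 1.
Hypothesis neg_nbr : forall x y, x \in Lam -> y \in Lam -> a x y != 0%N ->
  neg x != neg y -> zone x.
Hypothesis imz : forall x, x \in Lam -> zone x -> kap <= sg * (-1) ^+ neg x * complex.Im (c x).
Hypothesis imnz : forall x, x \in Lam -> ~~ zone x -> kap0 <= sg * (-1) ^+ neg x * complex.Im (c x).

(* Multiplying the equation by the sign pattern [(-1)^neg] makes the diagonal
   definite; the hopping then only contributes across sign changes, which all lie
   in the zone. *)
Lemma energy (h : V -> C) :
  \sum_(x <- Lam) (if zone x then kap - N0%:R else kap0) * normc (h x) ^+ 2 <=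
  \sum_(x <- Lam) normc (h x) * normc (hop a Lam c h x).
Proof.
pose s x : R := sg * (-1) ^+ neg x.
have s1 x : `|s x| = 1 by rewrite /s normrM sg1 normrX normrN1 expr1n mulr1.
pose hopping := \sum_(x <- Lam) \sum_(y <- Lam) s x * ((a x y)%:R * imc (h x) (h y)).
have hopE : \sum_(x <- Lam) s x * imc (h x) (hop a Lam c h x) =
   - hopping + \sum_(x <- Lam) s x * complex.Im (c x) * normc (h x) ^+ 2.
  rewrite /hopping -sumrN -big_split /=; apply: eq_bigr => x _.
  rewrite /hop imcD imcN imc_sum imc_diag mulrDr mulrN mulr_sumr mulrA; congr (- _ + _).
  by apply: eq_bigr => y _; rewrite imc_nat.
have hopB : `|hopping| <= \sum_(x <- Lam) (if zone x then N0%:R else 0) * normc (h x) ^+ 2.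
  (* As [a] is symmetric and [imc] antisymmetric, twice the hopping term carries the coefficient
     [s x - s y], which vanishes on bonds without a sign change. *)
  have anti : hopping = - \sum_(x <- Lam) \sum_(y <- Lam) s y * ((a x y)%:R * imc (h x) (h y)).
    rewrite /hopping exchange_big /= -sumrN; apply: eq_bigr => x _; rewrite -sumrN.
    by apply: eq_bigr => y _; rewrite aC imcC !mulrN.
  pose q x y : R := (neg x != neg y)%:R * (a x y)%:R.
  have qC x y : q x y = q y x by rewrite /q aC eq_sym.
  have half : hopping *+ 2 =
     \sum_(x <- Lam) \sum_(y <- Lam) (s x - s y) * ((a x y)%:R * imc (h x) (h y)).
    rewrite mulr2n {2}anti /hopping -sumrB; apply: eq_bigr => x _.
    by rewrite -sumrB; apply: eq_bigr => y _; rewrite mulrBl.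
  have hq : `|hopping| *+ 2 <= \sum_(x <- Lam) \sum_(y <- Lam)
      q x y * (normc (h x) ^+ 2 + normc (h y) ^+ 2).
    rewrite -normrMn half; apply: le_trans (ler_norm_sum _ _ _) _; apply: ler_sum => x _.
    apply: le_trans (ler_norm_sum _ _ _) _; apply: ler_sum => y _.
    rewrite !normrM normr_nat /q -mulrA; have [nxy|nxy] := boolP (neg x == neg y).
      by rewrite /s (eqP nxy) subrr normr0 !mul0r.
    rewrite mul1r [leLHS]mulrCA ler_wpM2l//.
    apply: (@le_trans _ _ (2 * (normc (h x) * normc (h y)))).
      apply: ler_pM => //; last exact: imc_le.
      by apply: le_trans (ler_normB _ _) _; rewrite !s1.
    rewrite -subr_ge0 (_ : _ - _ = (normc (h x) - normc (h y)) ^+ 2); last by ring.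
    exact: sqr_ge0.
  have sym : \sum_(x <- Lam) \sum_(y <- Lam) q x y * (normc (h x) ^+ 2 + normc (h y) ^+ 2)
     = (\sum_(x <- Lam) \sum_(y <- Lam) q x y * normc (h x) ^+ 2) *+ 2.
    rewrite mulr2n -[X in _ = _ + X]exchange_big /= -big_split /=; apply: eq_bigr => x _.
    by rewrite -big_split /=; apply: eq_bigr => y _; rewrite mulrDr [in q y x]qC.
  rewrite sym ler_pMn2r// in hq; apply: le_trans hq _.
  rewrite big_seq [leRHS]big_seq; apply: ler_sum => x xL; rewrite -mulr_suml.
  rewrite ler_wpM2r ?sqr_ge0//; have [zx|zx] := boolP (zone x).
    apply: (@le_trans _ _ (\sum_(y <- Lam) (a x y)%:R)).
      by apply: ler_sum => y _; rewrite /q; case: (_ != _); rewrite ?mul1r ?mul0r.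
    by rewrite -natr_sum ler_nat deg.
  rewrite big_seq big1// => y yL; rewrite /q.
  have [a0|a0] := eqVneq (a x y) 0%N; first by rewrite a0 mulr0.
  have [_|n0] := eqVneq (neg x) (neg y); first by rewrite mul0r.
  by rewrite (neg_nbr _ _ xL yL a0 n0) in zx.
have E1 : \sum_(x <- Lam) (if zone x then kap else kap0) * normc (h x) ^+ 2 <=
    \sum_(x <- Lam) s x * complex.Im (c x) * normc (h x) ^+ 2.
  rewrite big_seq [leRHS]big_seq; apply: ler_sum => x xL; rewrite ler_wpM2r ?sqr_ge0//.
  by case: (boolP (zone x)) => zx; [exact: imz|exact: imnz].
have E2 : \sum_(x <- Lam) s x * imc (h x) (hop a Lam c h x) <=
    \sum_(x <- Lam) normc (h x) * normc (hop a Lam c h x).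
  apply: ler_sum => x _; apply: le_trans (ler_norm _) _.
  by rewrite normrM s1 mul1r imc_le.
apply: le_trans E2; rewrite hopE.
have E3 : - hopping >= - \sum_(x <- Lam) (if zone x then N0%:R else 0) * normc (h x) ^+ 2.
  by rewrite lerN2; apply: le_trans hopB; exact: ler_norm.
apply: le_trans (lerD E3 E1); rewrite -sumrN -big_split /=; apply: ler_sum => x _.
by case: ifP => _; rewrite ?mul0r ?oppr0 ?add0r// mulrBl addrC.
Qed.

Hypothesis kapN : N0%:R < kap.
Hypothesis kap00 : 0 < kap0.

Let k0 : 0 < kap - N0%:R. Proof. by rewrite subr_gt0. Qed.

Let weight_ge0 x (h : V -> C) :
  0 <= (if zone x then kap - N0%:R else kap0) * normc (h x) ^+ 2.
Proof. by rewrite mulr_ge0 ?sqr_ge0//; case: ifP => _; exact: ltW. Qed.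

Lemma energy_gden : gden a Lam c != 0.
Proof.
apply: gden_neq0 => // h h0 hh y.
have [yL|/h0//] := boolP (y \in Lam).
have := energy h; rewrite [leRHS]big_seq [leRHS]big1 => [|x xL]; last first.
  by rewrite hh// normc0 mulr0.
rewrite (bigD1_seq y)//= => le0.
have w0 : (if zone y then kap - N0%:R else kap0) * normc (h y) ^+ 2 <= 0.
  by apply: le_trans le0; rewrite lerDl sumr_ge0.
have wp : 0 < (if zone y then kap - N0%:R else kap0) by case: ifP.
have : normc (h y) ^+ 2 <= 0 by rewrite -(pmulr_rle0 _ wp).
by move=> n0; apply/eqP; rewrite -normc_eq0 -sqrf_eq0 eq_le n0 sqr_ge0.
Qed.

(** For a column of the Green function the right-hand side of [energy] is just [|h y|]. The site [y]
    itself gives [|h y| <= 1 / k], and then [x] gives [k |h x| ^ 2 <= 1 / k]. The bound is free of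
    [kap0], hence uniform in the imaginary part of [z]. *)
Lemma energy_green x y : x \in Lam -> y \in Lam -> zone x -> zone y ->
  normc (green a Lam c x y) <= (kap - N0%:R)^-1.
Proof.
move=> xL yL zx zy; set k := kap - N0%:R.
pose h z := green a Lam c z y.
have E z : z \in Lam -> zone z -> k * normc (h z) ^+ 2 <= normc (h y).
  move=> zL zz; have := energy h; rewrite (bigD1_seq z)//= zz -/k.
  have -> : \sum_(w <- Lam) normc (h w) * normc (hop a Lam c h w) = normc (h y).
    rewrite (bigD1_seq y)//= green_solves//; last exact: energy_gden.
    rewrite eqxx normc1 mulr1 big_seq_cond big1 ?addr0// => w /andP[wL wy].
    by rewrite green_solves ?(negPf wy) ?normc0 ?mulr0//; exact: energy_gden.
  by apply: le_trans; rewrite lerDl sumr_ge0.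
have hy : normc (h y) <= k^-1.
  rewrite leNgt; apply/negP => lt; have := E y yL zy; rewrite expr2 mulrA.
  have y0 : 0 < normc (h y) by apply: lt_trans lt; rewrite invr_gt0.
  by rewrite ger_pMl// leNgt -ltr_pdivrMl// mulr1 lt.
have := le_trans (E x xL zx) hy.
rewrite mulrC -ler_pdivlMr// -expr2 => hx.
by rewrite -(@ler_pXn2r _ 2)// ?nnegrE ?normc_ge0// invr_ge0 ltW.
Qed.

(** Solving the equation at [w] for its diagonal term, of modulus at least [k], moves the Green
    function to the neighbours of [w] and gains [1 / k]. By symmetry the same works at [v]: since
    [w] and [v] are neither equal nor adjacent, no source term appears in either step. *)
Lemma energy_green_decay w v : w \in Lam -> v \in Lam -> w != v -> a w v = 0%N ->
  (forall x, x \in Lam -> (a w x != 0%N) || (a v x != 0%N) || (x == w) || (x == v) -> zone x) ->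
  normc (green a Lam c w v) <= N0%:R ^+ 2 * ((kap - N0%:R)^-1) ^+ 3.
Proof.
move=> wL vL wv awv zn; set k := kap - N0%:R.
have step x y : x \in Lam -> y \in Lam -> x != y -> zone x ->
    normc (green a Lam c x y) <=
    k^-1 * \sum_(z <- Lam) (a x z)%:R * normc (green a Lam c z y).
  move=> xL yL xy zx; have := green_solves a Lam c x y energy_gden xL yL.
  rewrite (negPf xy) /hop => /eqP; rewrite addrC subr_eq0 => /eqP E.
  have ck : k <= normc (c x).
    apply: le_trans _ (ler_Im_normc (c x)); apply: (@le_trans _ _ kap); first by rewrite gerBl.
    apply: le_trans (imz x xL zx) _; apply: le_trans (ler_norm _) _.
    by rewrite !normrM sg1 normrX normrN1 expr1n !mul1r.
  rewrite ler_pdivlMl//.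
  apply: (@le_trans _ _ (normc (c x) * normc (green a Lam c x y))).
    by rewrite ler_wpM2r ?normc_ge0.
  rewrite -normcM E; apply: le_trans (ler_normc_sum _ _ _) _; apply: ler_sum => z _.
  by rewrite normcM -(rmorph_nat (real_complex R)) normc_real ger0_norm.
have zw : zone w by apply: zn; rewrite // eqxx orbT.
have zv : zone v by apply: zn; rewrite // eqxx !orbT.
have deg' x (B : R) (F : V -> R) : x \in Lam -> 0 <= B ->
    (forall z, z \in Lam -> a x z != 0%N -> F z <= B) ->
    \sum_(z <- Lam) (a x z)%:R * F z <= N0%:R * B.
  move=> xL B0 FB; apply: (@le_trans _ _ (\sum_(z <- Lam) (a x z)%:R * B)).
    rewrite big_seq [leRHS]big_seq; apply: ler_sum => z zL.
    have [->|a0] := eqVneq (a x z) 0%N; first by rewrite !mul0r.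
    by rewrite ler_wpM2l// FB.
  by rewrite -mulr_suml ler_wpM2r// -natr_sum ler_nat deg.
have ki0 : 0 <= k^-1 by rewrite invr_ge0 ltW.
have inner y : y \in Lam -> a w y != 0%N -> normc (green a Lam c y v) <= k^-1 * (N0%:R * k^-1).
  move=> yL awy; rewrite green_sym//.
  have vy : v != y by apply: contraNneq awy => <-; rewrite awv.
  apply: le_trans (step v y vL yL vy zv) _; rewrite ler_wpM2l// deg'// => z zL avz.
  by apply: energy_green => //; apply: zn; rewrite ?awy ?avz ?orbT.
apply: le_trans (step w v wL vL wv zw) _.
have -> : N0%:R ^+ 2 * k^-1 ^+ 3 = k^-1 * (N0%:R * (k^-1 * (N0%:R * k^-1))) by ring.
by rewrite ler_wpM2l// deg'// ?mulr_ge0// => z zL awz; exact: inner.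
Qed.

End Energy.

(** * The lattice and complex couplings *)

Section Lattice.
Context {d : nat}.
Implicit Types x y : Zd d.

Definition adj x y : nat :=
  (\sum_(i < d) ((y == (x + unitv i)%R) + (y == (x - unitv i)%R)))%N.

Lemma adjC x y : adj x y = adj y x.
Proof.
apply: eq_bigr => i _; rewrite addnC; congr (_ + _)%N.
  by rewrite eq_sym subr_eq.
by rewrite [in RHS]eq_sym subr_eq.
Qed.

Lemma adj_shift x y k : adj (x + k) (y + k) = adj x y.
Proof.
apply: eq_bigr => i _; congr (_ + _)%N.
  by rewrite addrAC (inj_eq (addIr k)).
by rewrite addrAC (inj_eq (addIr k)).
Qed.

Lemma adjP x y : adj x y != 0%N -> exists i, y = x + unitv i \/ y = x - unitv i.
Proof.
move=> h; apply: contrapT => H; case/negP: h; apply/eqP; rewrite /adj big1// => i _.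
case: eqP => [e|_]; first by case: H; exists i; left.
by case: eqP => [e|_]//; case: H; exists i; right.
Qed.

Lemma adj_unitv x i : adj x (x + unitv i) != 0%N /\ adj x (x - unitv i) != 0%N.
Proof.
by split; rewrite -lt0n /adj (bigD1 i)//= eqxx !addn_gt0 /= ?orbT.
Qed.

Lemma sum_pred1_le (s : seq (Zd d)) y : uniq s -> (\sum_(z <- s) (z == y) <= 1)%N.
Proof.
move=> us; have [ys|ys] := boolP (y \in s).
  rewrite (bigD1_seq y)//= eqxx big1 ?addn0// => z /negPf ->.
  by [].
rewrite big_seq big1// => z zs; case: eqP => // zy.
by rewrite -zy zs in ys.
Qed.

Lemma adj_degree (Lam : {fset Zd d}) x : (\sum_(y <- Lam) adj x y <= 2 * d)%N.
Proof.
rewrite exchange_big /= mulnC -[X in (_ <= X * _)%N](card_ord d) -sum_nat_const.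
apply: leq_sum => i _; rewrite big_split /= -[2%N]/(1 + 1)%N.
by apply: leq_add; apply: sum_pred1_le; exact: fset_uniq.
Qed.

Lemma sum_adj {R : realType} (Lam : {fset Zd d}) (g : Zd d -> R[i]) x :
  (forall y, y \notin Lam -> g y = 0) ->
  \sum_(y <- Lam) (adj x y)%:R * g y = \sum_(i < d) (g (x + unitv i) + g (x - unitv i)).
Proof.
move=> g0.
have E p : \sum_(y <- Lam) (y == p)%:R * g y = g p.
  have [pL|pL] := boolP (p \in Lam).
    rewrite (bigD1_seq p)//= eqxx mul1r big1 ?addr0// => z /negPf ->.
    by rewrite mul0r.
  rewrite g0// big_seq big1// => z zL; case: eqP => [zp|_]; last by rewrite mul0r.
  by rewrite -zp zL in pL.
under eq_bigr do rewrite /adj natr_sum mulr_suml.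
rewrite exchange_big /=; apply: eq_bigr => i _.
under eq_bigr do rewrite natrD mulrDl.
by rewrite big_split /= !E.
Qed.

Lemma inner_bdP (A : set (Zd d)) x : inner_bd A x <->
  A x /\ exists2 y, adj x y != 0%N & ~ A y.
Proof.
split=> [[Ax lt]|[Ax [y axy Ay]]].
  split=> //; apply: contrapT => H; move: lt; apply/negP; rewrite -leqNgt.
  rewrite mulnC -[X in (X * _ <= _)%N](card_ord d) -sum_nat_const; apply: leq_sum => i _.
  have [n1 n2] := adj_unitv x i.
  have h y : adj x y != 0%N -> y \in A.
    by move=> axy; apply: mem_set; apply: contrapT => nA; apply: H; exists y.
  by rewrite (h _ n1) (h _ n2).
split=> //; have [i yE] := adjP _ _ axy.
rewrite (bigD1 i)//= [X in (_ < X)%N](_ : _ = 2 + 2 * d.-1)%N; last first.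
  by case: d i {x y axy Ay yE Ax A} => [[]//|d' _]; rewrite mulnS.
have rest : (\sum_(j < d | j != i) (((x + unitv j)%R \in A) + ((x - unitv j)%R \in A)) <= 2 * d.-1)%N.
  apply: (@leq_trans (\sum_(j < d | j != i) 2)).
    by apply: leq_sum => j _; case: (_ \in A); case: (_ \in A).
  by rewrite sum_nat_const mulnC leq_mul2l /= -[in leqRHS](card_ord d) cardC1.
rewrite -addSn leq_add//.
have nA : y \in A = false by apply/negP => /set_mem.
by case: yE => <-; rewrite nA ?addn0; case: (_ \in A).
Qed.

End Lattice.

Section Hierarchy.
Context {R : realType}.

(* The last nonzero term dominates the sum of all the previous ones. *)
Lemma dominated_sum (v : nat -> R) (L w U kp : R) (n : nat) :
  0 < L -> 0 < w -> 0 <= U -> 1 + 4 * U / w <= kp ->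
  (forall i, (i < n)%N -> `|v i| <= 2 * (L * kp ^+ i) * U) ->
  (forall i, (i < n)%N -> v i != 0 -> L * kp ^+ i * w <= `|v i|) ->
  `|\sum_(i < n) v i| <= L * w / 2 * kp ^+ n /\
  ((exists2 i, (i < n)%N & v i != 0) -> L * w / 2 <= `|\sum_(i < n) v i|).
Proof.
move=> L0 w0 U0 hk; have kp1 : 1 <= kp.
  by apply: le_trans hk; rewrite lerDl; apply: divr_ge0; [exact: mulr_ge0|exact: ltW].
have Lw : 0 <= L * w / 2 by apply: divr_ge0 => //; apply: mulr_ge0; exact: ltW.
(* The induction carries [L w / 2 * kp ^ n], half the least modulus of the next term if that is
   nonzero; growth by [1 + 4 U / w] is what preserves this bound. *)
elim: n => [|n IH] hv hw.
  by rewrite big_ord0 normr0 expr0 mulr1; split => // -[].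
have [A B] := IH (fun i ni => hv i (ltnW ni)) (fun i ni => hw i (ltnW ni)).
have kn0 : 0 <= kp ^+ n by rewrite exprn_ge0// (le_trans _ kp1).
have kn1 : 1 <= kp ^+ n by rewrite exprn_ege1.
rewrite big_ord_recr /=; split.
  apply: le_trans (ler_normD _ _) _; apply: le_trans (lerD A (hv n (ltnSn n))) _.
  have -> : L * w / 2 * kp ^+ n + 2 * (L * kp ^+ n) * U =
     L * w / 2 * kp ^+ n * (1 + 4 * U / w) by field; rewrite gt_eqF.
  by rewrite exprS [kp * _]mulrC mulrA ler_wpM2l// mulr_ge0.
have [vn|vn] := eqVneq (v n) 0.
  move=> [i ni vi]; rewrite vn addr0; apply: B; exists i => //.
  by move: ni; rewrite ltnS leq_eqVlt => /orP[/eqP ie|//]; rewrite ie vn eqxx in vi.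
move=> _; have hn := hw n (ltnSn n) vn.
have : L * w / 2 * kp ^+ n <= `|v n| - `|\sum_(i < n) v i|.
  rewrite lerBrDr; apply: le_trans (lerD (lexx _) A) _; apply: le_trans hn.
  by rewrite le_eqVlt; apply/orP; left; apply/eqP; field.
move=> h; apply: le_trans (_ : L * w / 2 <= L * w / 2 * kp ^+ n) _; first by rewrite ler_peMr.
apply: le_trans h _; rewrite [_ + v n]addrC; exact: lerB_normD.
Qed.

End Hierarchy.

(** * Imaginary part of the displaced potential *)

Section Complexify.
Context {R : realType} {d : nat}.
Local Notation C := R[i].
Variables (u : Zd d -> R) (Th : {fset Zd d}).
Hypothesis hTh : forall k, u k != 0 <-> k \in Th.
Hypothesis A2 : forall k, inner_bd [set k | k \in Th] k -> 0 < u k.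

Lemma u_out k : k \notin Th -> u k = 0.
Proof. by move=> kT; apply/eqP; apply: contraNT kT => /hTh. Qed.

(* The diagonal of [H - z], for complex couplings. *)
Definition cpot (lam : R) (z : C) (zeta : Zd d -> C) (x : Zd d) : C :=
  lam%:C%C * \sum_(t <- Th) zeta (x - t) * (u t)%:C%C - z.

Lemma Im_real_mul (r : R) (w : C) : complex.Im (r%:C%C * w) = r * complex.Im w.
Proof. by case: w => a b /=; ring. Qed.

Lemma Im_mul_real (r : R) (w : C) : complex.Im (w * r%:C%C) = complex.Im w * r.
Proof. by case: w => a b /=; ring. Qed.

Lemma ImB (w v : C) : complex.Im (w - v) = complex.Im w - complex.Im v.
Proof. by case: w v => ? ? []. Qed.

Lemma Im_sum (I : Type) (s : seq I) (F : I -> C) :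
  complex.Im (\sum_(i <- s) F i) = \sum_(i <- s) complex.Im (F i).
Proof.
elim: s => [|i s IH]; first by rewrite !big_nil.
by rewrite !big_cons -IH; case: (F i) (\sum_(j <- s) F j) => ? ? [].
Qed.

Lemma Im_cpot lam z zeta x : complex.Im (cpot lam z zeta x) =
  lam * \sum_(t <- Th) complex.Im (zeta (x - t)) * u t - complex.Im z.
Proof.
rewrite /cpot ImB Im_real_mul Im_sum; congr (_ * _ - _).
by apply: eq_bigr => t _; rewrite Im_mul_real.
Qed.

Lemma Im_cpot_real lam z (v : Zd d -> R) x :
  complex.Im (cpot lam z (fun k => (v k)%:C%C) x) = - complex.Im z.
Proof. by rewrite Im_cpot big1 ?mulr0 ?sub0r// => t _; rewrite mul0r. Qed.

(** With real couplings the diagonal has the constant imaginary part [- Im z], so the energy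
    estimate applies with an empty zone and no sign changes. *)
Lemma real_gden (lam : R) (z : C) (v : Zd d -> R) (Lam : {fset Zd d}) :
  complex.Im z != 0 -> gden adj Lam (cpot lam z (fun k => (v k)%:C%C)) != 0.
Proof.
move=> z0; pose sg : R := if 0 < complex.Im z then -1 else 1.
apply: (energy_gden adj adjC (2 * d) Lam _ pred0 pred0 sg ((2 * d)%:R + 1) `|complex.Im z|) => //.
- by move=> x _; exact: adj_degree.
- by rewrite /sg; case: ifP => _; rewrite ?normrN normr1.
- move=> x _ _; rewrite expr0 mulr1 Im_cpot_real.
  rewrite /sg; case: ltP => h; first by rewrite mulN1r opprK ger0_norm// ltW.
  by rewrite mul1r ler0_norm.
- by rewrite ltrDl.
- by rewrite normr_gt0.
Qed.

(** The position in [ks] decides which couplings are displaced and, through [e], at which scale: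
    [i = 0] gives the real couplings, [i = size ks] displaces the whole list. *)
Definition asg (ks : seq (Zd d)) (i : nat) (e : nat -> C) (om : Zd d -> R) (p : Zd d) : C :=
  if (index p ks < i)%N then e (index p ks) else (om p)%:C%C.

Lemma Im_asg ks i e om p : uniq ks -> (i <= size ks)%N ->
  complex.Im (asg ks i e om p) = \sum_(j < i) (p == nth 0 ks j)%:R * complex.Im (e j).
Proof.
move=> us si; rewrite /asg; case: ltnP => pi.
  have pk : p \in ks by rewrite -index_mem (leq_trans pi).
  rewrite (bigD1 (Ordinal pi))//= nth_index// eqxx mul1r big1 ?addr0// => j ji.
  case: eqP => [pj|]; last by rewrite mul0r.
  by case/negP: ji; apply/eqP/val_inj; rewrite /= pj index_uniq// (leq_trans (ltn_ord j)).
rewrite big1// => j _; case: eqP => [pj|]; last by rewrite mul0r.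
have js : (j < size ks)%N by rewrite (leq_trans (ltn_ord j)).
by move: pi; rewrite pj index_uniq// leqNgt ltn_ord.
Qed.

Lemma Im_cpot_asg lam z ks i e om x : uniq ks -> (i <= size ks)%N ->
  complex.Im (cpot lam z (asg ks i e om) x) =
  lam * \sum_(j < i) complex.Im (e j) * u (x - nth 0 ks j) - complex.Im z.
Proof.
move=> us si; rewrite Im_cpot; congr (_ * _ - _).
under eq_bigr do rewrite Im_asg// mulr_suml.
rewrite exchange_big /=; apply: eq_bigr => j _.
have [tT|tT] := boolP (x - nth 0 ks j \in Th); last first.
  rewrite u_out// mulr0 big_seq big1// => t tt; case: eqP => [E|]; last by rewrite !mul0r.
  by rewrite -E subKr tt in tT.
rewrite (bigD1_seq (x - nth 0 ks j)) ?fset_uniq//= subKr eqxx mul1r big1 ?addr0// => t tj.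
case: eqP => [E|]; last by rewrite !mul0r.
by case/eqP: tj; rewrite -E subKr.
Qed.

Variables (w U : R).
Hypothesis w0 : 0 < w.
Hypothesis U0 : 0 <= U.
Hypothesis uw : forall t, t \in Th -> w <= `|u t| <= U.

Variables (lam L kp m l : R) (z : C) (ks : seq (Zd d)) (i : nat) (e : nat -> C) (om : Zd d -> R).
(** Displacements go to the side of [- Im z], the imaginary part that [- z] already puts on the
    diagonal, so the two add up wherever the displaced potential is nonnegative. *)
Let sg : R := if 0 < complex.Im z then -1 else 1.
Hypothesis lam0 : 0 < lam.
Hypothesis L0 : 0 < L.
Hypothesis l0 : 0 < l.
Hypothesis kpU : 1 + 4 * U / w <= kp.
Hypothesis lamL : m + (2 * d)%:R + l <= lam * (L * w / 2).
Hypothesis zm : normc z <= m.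
Hypothesis z0 : complex.Im z != 0.
Hypothesis us : uniq ks.
Hypothesis si : (i <= size ks)%N.
Hypothesis he : forall j, (j < i)%N -> L * kp ^+ j <= sg * complex.Im (e j) <= 2 * (L * kp ^+ j).

Let zone (x : Zd d) := [exists j : 'I_i, x - nth 0 ks j \in Th].
Let yv (x : Zd d) := \sum_(j < i) sg * complex.Im (e j) * u (x - nth 0 ks j).
Let neg (x : Zd d) := yv x < 0.
Let c := cpot lam z (asg ks i e om).

Let kp1 : 1 <= kp.
Proof. by apply: le_trans kpU; rewrite lerDl; apply: divr_ge0; [exact: mulr_ge0|exact: ltW]. Qed.

Let eta0 j : (j < i)%N -> 0 <= sg * complex.Im (e j).
Proof.
move=> /he/andP[h _]; apply: le_trans h; apply: mulr_ge0; first exact: ltW.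
by apply: exprn_ge0; exact: le_trans kp1.
Qed.

Let sg_norm : `|sg| = 1.
Proof. by rewrite /sg; case: ifP => _; rewrite ?normrN normr1. Qed.

Let sg_z : sg * - complex.Im z = `|complex.Im z|.
Proof.
rewrite /sg; case: ltP => h; first by rewrite mulN1r opprK gtr0_norm.
by rewrite mul1r ler0_norm.
Qed.

Let Im_c x : sg * complex.Im (c x) = lam * yv x + `|complex.Im z|.
Proof.
rewrite /c Im_cpot_asg// mulrBr -mulrN sg_z mulrCA; congr (_ * _ + _).
by rewrite mulr_sumr; apply: eq_bigr => j _; rewrite mulrA.
Qed.

Let yv_zone x : zone x -> L * w / 2 <= `|yv x|.
Proof.
move=> /existsP[j0 j0T].
pose v j := sg * complex.Im (e j) * u (x - nth 0 ks j).
have hv j : (j < i)%N -> `|v j| <= 2 * (L * kp ^+ j) * U.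
  move=> ji; have /andP[_ h2] := he _ ji; rewrite /v normrM (ger0_norm (eta0 _ ji)).
  apply: ler_pM => //; first exact: eta0.
  have [tT|/u_out->] := boolP (x - nth 0 ks j \in Th); last by rewrite normr0.
  by case/andP: (uw _ tT).
have hw j : (j < i)%N -> v j != 0 -> L * kp ^+ j * w <= `|v j|.
  move=> ji; rewrite /v mulf_eq0 negb_or => /andP[_ /hTh tT].
  have /andP[h1 _] := he _ ji; rewrite normrM (ger0_norm (eta0 _ ji)).
  apply: ler_pM => //; [|exact: ltW|by case/andP: (uw _ tT)].
  by apply: mulr_ge0; [exact: ltW|apply: exprn_ge0; exact: le_trans kp1].
have [_ B] := dominated_sum v L w U kp i L0 w0 U0 kpU hv hw.
apply: B; exists j0 => //.
rewrite mulf_neq0 //; last exact/hTh.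
have /andP[h1 _] := he _ (ltn_ord j0); apply/eqP => E; move: h1; rewrite E leNgt.
by rewrite mulr_gt0// exprn_gt0// (lt_le_trans _ kp1).
Qed.

Let yv_out x : ~~ zone x -> yv x = 0.
Proof.
move=> /existsPn nz; rewrite /yv big1// => j _.
by rewrite u_out ?mulr0.
Qed.

Let neg_zone x : neg x -> zone x.
Proof. by apply: contraTT => /yv_out; rewrite /neg => ->; rewrite ltxx. Qed.

(* (A2): a site of the zone next to the outside only feels positive values of u. *)
Let neg_inside x y : neg x -> adj x y != 0%N -> zone y.
Proof.
move=> nx axy; apply: contraTT nx => /existsPn ny; rewrite /neg -leNgt.
apply: sumr_ge0 => j _; apply: mulr_ge0; first exact: eta0.
have [tT|/u_out->//] := boolP (x - nth 0 ks j \in Th).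
apply/ltW/A2/inner_bdP; split => //; exists (y - nth 0 ks j); first by rewrite adj_shift.
exact/negP.
Qed.

Let neg_nbr (Lam : {fset Zd d}) x y : x \in Lam -> y \in Lam -> adj x y != 0%N ->
  neg x != neg y -> zone x.
Proof.
move=> _ _ axy; have [nx _|nx] := boolP (neg x); first exact: neg_zone.
by case: (boolP (neg y)) => // ny _; apply: (neg_inside y); rewrite // adjC.
Qed.

(** On the negative sites the imaginary part of [z] enters with the wrong sign; the summand [m] in
    [lamL] pays for it, [2 d] pays for the hopping, and [l] is left. *)
Let im_zone (Lam : {fset Zd d}) x : x \in Lam -> zone x ->
  (2 * d)%:R + l <= sg * (-1) ^+ neg x * complex.Im (c x).
Proof.
move=> _ zx; rewrite mulrAC Im_c.
have zm' : `|complex.Im z| <= m by apply: le_trans zm; exact: ler_Im_normc.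
have h := yv_zone x zx; have h2 : lam * (L * w / 2) <= lam * `|yv x| by rewrite ler_pM2l.
move: h2; rewrite /neg; case: (ltP (yv x) 0) => [ly|ly] /=.
  by rewrite (ltr0_norm ly) expr1 mulrN1; have := lamL; lra.
by rewrite (ger0_norm ly) expr0 mulr1; have := lamL; have := normr_ge0 (complex.Im z); lra.
Qed.

Let im_out (Lam : {fset Zd d}) x : x \in Lam -> ~~ zone x ->
  `|complex.Im z| <= sg * (-1) ^+ neg x * complex.Im (c x).
Proof.
move=> _ zx; rewrite mulrAC Im_c (yv_out _ zx) mulr0 add0r.
have -> : neg x = false by apply/negP => /neg_zone h; rewrite h in zx.
by rewrite expr0 mulr1.
Qed.

Let kapE : (2 * d)%:R + l - (2 * d)%:R = l. Proof. by rewrite addrC addKr. Qed.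
Let kapN : (2 * d)%:R < (2 * d)%:R + l. Proof. by rewrite ltrDl. Qed.
Let imz0 : 0 < `|complex.Im z|. Proof. by rewrite normr_gt0. Qed.

Lemma asg_gden (Lam : {fset Zd d}) : gden adj Lam (cpot lam z (asg ks i e om)) != 0.
Proof.
exact: (energy_gden adj adjC (2 * d) Lam c zone neg sg ((2 * d)%:R + l) `|complex.Im z|
  (fun x _ => adj_degree Lam x) sg_norm (neg_nbr Lam) (im_zone Lam) (im_out Lam) kapN imz0).
Qed.

Lemma asg_green_le (Lam : {fset Zd d}) x y : x \in Lam -> y \in Lam -> zone x -> zone y ->
  normc (green adj Lam (cpot lam z (asg ks i e om)) x y) <= l^-1.
Proof.
move=> xL yL zx zy.
have := energy_green adj adjC (2 * d) Lam c zone neg sg ((2 * d)%:R + l) `|complex.Im z|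
  (fun x _ => adj_degree Lam x) sg_norm (neg_nbr Lam) (im_zone Lam) (im_out Lam) kapN imz0
  x y xL yL zx zy.
by rewrite kapE.
Qed.

Lemma asg_green_decay (Lam : {fset Zd d}) x y : x \in Lam -> y \in Lam -> x != y -> adj x y = 0%N ->
  (forall p, p \in Lam -> (adj x p != 0%N) || (adj y p != 0%N) || (p == x) || (p == y) -> zone p) ->
  normc (green adj Lam (cpot lam z (asg ks i e om)) x y) <= (2 * d)%:R ^+ 2 * l^-1 ^+ 3.
Proof.
move=> xL yL xy axy zp.
have := energy_green_decay adj adjC (2 * d) Lam c zone neg sg ((2 * d)%:R + l) `|complex.Im z|
  (fun x _ => adj_degree Lam x) sg_norm (neg_nbr Lam) (im_zone Lam) (im_out Lam) kapN imz0
  x y xL yL xy axy zp.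
by rewrite kapE.
Qed.

End Complexify.

Definition upd {d : nat} {S : Type} (om : Zd d -> S) (k : Zd d) (r : S) (p : Zd d) : S :=
  if p == k then r else om p.

Lemma ler1_dist_nat {R : realType} (i j : nat) : i != j -> 1 <= `|i%:R - j%:R| :> R.
Proof.
wlog ij : i j / (j < i)%N => [hw ne|_].
  case: (ltngtP i j) => [lt|lt|E]; last by rewrite E eqxx in ne.
    by rewrite distrC; apply: hw; rewrite // eq_sym.
  exact: hw.
by rewrite -natrB ?(ltnW ij)// normr_nat ler1n subn_gt0.
Qed.

(** * Moment bounds *)

Section Weights.
Context {R : realType} {d : nat}.
Local Notation C := R[i].

(* The random weights carried along the averaging: powers of a rational function of
   degree at most [2 n] in each single coupling. *)
Definition rational_weight (n : nat) (t : R) (W : (Zd d -> R) -> R) : Prop :=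
  [/\ forall om, 0 <= W om,
      forall (dS : measure_display) (S : measurableType dS) (Z : Zd d -> S -> R),
        (forall k, measurable_fun setT (Z k)) -> measurable_fun setT (fun s => W (Z^~ s)) &
      forall om k, exists p q : {poly C},
        [/\ (size p <= n.*2.+1)%N, (size q <= n.*2.+1)%N,
            forall r : R, q.[r%:C%C] != 0 &
            forall r : R, W (upd om k r) = ratio p q r%:C%C `^ t]].

Lemma rational_weight1 n t : rational_weight n t (fun=> 1).
Proof.
split=> // om k.
exists 1, 1; rewrite size_poly1; split => // r; first by rewrite hornerC oner_eq0.
by rewrite /ratio hornerC normc1 divr1 powR1.
Qed.

Variables (u : Zd d -> R) (Th : {fset Zd d}).
Hypothesis hTh : forall k, u k != 0 <-> k \in Th.

Lemma cpot_upd lam z (zeta : Zd d -> C) k r x :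
  cpot u Th lam z (upd zeta k r) x =
  cpot u Th lam z (upd zeta k 0) x + r * (lam * u (x - k))%:C%C.
Proof.
rewrite /cpot addrAC; congr (_ - _).
have -> : (lam * u (x - k))%:C%C = lam%:C%C * \sum_(t <- Th) (x - t == k)%:R * (u t)%:C%C.
  rewrite [LHS](rmorphM (real_complex R)); congr (_ * _).
  have E t : (x - t == k) = (t == x - k).
    by apply/eqP/eqP => [<-|->]; rewrite subKr.
  have [tT|tT] := boolP (x - k \in Th).
    rewrite (bigD1_seq (x - k)) ?fset_uniq//= E eqxx mul1r big1 ?addr0// => t /negPf tk.
    by rewrite E tk mul0r.
  rewrite (u_out _ _ hTh _ tT) big_seq big1// => t tt.
  rewrite E; case: eqP => [tk|]; last by rewrite mul0r.
  by rewrite -tk tt in tT.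
rewrite mulrCA -mulrDr; congr (_ * _).
rewrite mulr_sumr -big_split /=; apply: eq_bigr => t _.
by rewrite /upd; case: eqP => _; rewrite ?mul0r ?mulr0 ?addr0 ?mul1r ?add0r.
Qed.

(** The coupling at [k] enters the diagonal affinely, and only at sites of [k + Th]; the degree is
    thus bounded independently of the volume. *)
Lemma green_upd_rational (Lam : {fset Zd d}) lam z (zeta : Zd d -> C) k x y :
  exists p q : {poly C}, [/\ (size p <= (#|` Th|).+1)%N, (size q <= (#|` Th|).+1)%N &
    forall r : C, gnum adj Lam (cpot u Th lam z (upd zeta k r)) x y = p.[r] /\
              gden adj Lam (cpot u Th lam z (upd zeta k r)) = q.[r]].
Proof.
have [|p [q [sp sq E]]] := green_rational adj Lam (cpot u Th lam z (upd zeta k 0))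
   (fun x => (lam * u (x - k))%:C%C) #|` Th| x y.
  apply: (@leq_trans (\sum_(v <- Lam) ((v - k)%R \in Th))%N).
    apply: leq_sum => v _; have [vT|vT] := boolP (v - k \in Th); first exact: leq_b1.
    by rewrite (u_out _ _ hTh _ vT) mulr0 eqxx.
  apply: (@leq_trans (\sum_(v <- Lam) \sum_(t <- Th) (v == (t + k)%R))%N).
    apply: leq_sum => v _; have [vT|//] := boolP (v - k \in Th).
    by rewrite (bigD1_seq (v - k)) ?fset_uniq//= subrK eqxx.
  rewrite exchange_big /= -(size_map id) map_id -sum1_size.
  by apply: leq_sum => t _; apply: sum_pred1_le; exact: fset_uniq.
exists p, q; split => // r; have [<- <-] := E r.
by split; rewrite /gnum /gden (@hmx_ext _ _ _ _ _ (cpot u Th lam z (upd zeta k r)))// => v _;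
  rewrite -cpot_upd.
Qed.

Definition rgreen (Lam : {fset Zd d}) lam z (om : Zd d -> R) x y : C :=
  green adj Lam (cpot u Th lam z (fun k => (om k)%:C%C)) x y.

Lemma measurable_green_asg (Lam : {fset Zd d}) lam z ks i e x y (t : R) : t != 0 ->
  forall (dS : measure_display) (S : measurableType dS) (Z : Zd d -> S -> R),
  (forall k, measurable_fun setT (Z k)) ->
  measurable_fun setT (fun s =>
    normc (green adj Lam (cpot u Th lam z (asg ks i e (Z^~ s))) x y) `^ t).
Proof.
move=> t0 dS S Z mZ.
apply: (measurable_green adj Lam (fun p s => cpot u Th lam z (asg ks i e (Z^~ s)) p)) => // p.
apply: cmeasurableD; last exact: cmeasurable_cst.
apply: cmeasurableM; first exact: cmeasurable_cst.
apply: cmeasurable_sum => v; apply: cmeasurableM; last exact: cmeasurable_cst.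
by rewrite /asg; case: (index (p - v)%R ks < i)%N; [exact: cmeasurable_cst|exact: cmeasurable_real].
Qed.

Lemma asg0 ks e (om : Zd d -> R) : asg ks 0 e om = (fun k => (om k)%:C%C).
Proof. by apply/funext => p; rewrite /asg ltn0. Qed.

Lemma measurable_rgreen (Lam : {fset Zd d}) lam z x y (t : R) : t != 0 ->
  forall (dS : measure_display) (S : measurableType dS) (Z : Zd d -> S -> R),
  (forall k, measurable_fun setT (Z k)) ->
  measurable_fun setT (fun s => normc (rgreen Lam lam z (Z^~ s) x y) `^ t).
Proof.
move=> t0 dS S Z mZ; have := measurable_green_asg Lam lam z [::] 0 (fun=> 0) x y t t0 dS S Z mZ.
by rewrite /rgreen; under eq_fun do rewrite asg0.
Qed.

(** The weight formed by the two outer factors of the expansion: two rational functions of degree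
    [n] multiply to degree [2 n], with denominators that do not vanish at real couplings because [z]
    is not real. *)
Lemma rational_weight_green (lam tau : R) (z : C) (A B : {fset Zd d}) x y x' y' :
  0 < tau -> complex.Im z != 0 ->
  rational_weight #|` Th| tau (fun v => normc (rgreen A lam z v x y) `^ tau *
                                  normc (rgreen B lam z v x' y') `^ tau).
Proof.
move=> tau0 z0; have t0 : tau != 0 by rewrite gt_eqF.
split=> [v|dS S Z mZ|v k]; first by rewrite mulr_ge0 ?powR_ge0.
  by apply: measurable_funM; exact: measurable_rgreen.
have [p [q [sp sq E]]] := green_upd_rational A lam z (fun j => (v j)%:C%C) k x y.
have [p' [q' [sp' sq' E']]] := green_upd_rational B lam z (fun j => (v j)%:C%C) k x' y'.
have sz (f g : {poly C}) : (size f <= (#|` Th|).+1)%N -> (size g <= (#|` Th|).+1)%N -> (size (f * g)%R <= (#|` Th|).*2.+1)%N.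
  move=> sf sg'; apply: leq_trans (size_polyMleq _ _) _.
  have := leq_add sf sg'; rewrite addSn addnS addnn.
  by case: (size f + size g)%N => //= a; rewrite ltnS.
have updE r : (fun j => (upd v k r j)%:C%C) = upd (fun j => (v j)%:C%C) k r%:C%C.
  by apply/funext => j; rewrite /upd; case: eqP.
exists (p * p'), (q * q'); split; [exact: sz|exact: sz|move=> r|move=> r].
  rewrite hornerM mulf_neq0//.
    by have [_ <-] := E r%:C%C; rewrite -updE; exact: real_gden.
  by have [_ <-] := E' r%:C%C; rewrite -updE; exact: real_gden.
rewrite -powRM ?normc_ge0// /rgreen updE /ratio /green !hornerM !normcM !normcV.
have [-> ->] := E r%:C%C; have [-> ->] := E' r%:C%C; congr (_ `^ _).
by rewrite invfM mulrACA.
Qed.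

End Weights.

(** * Replacing real couplings by complex ones in mean *)

Section Averaging.
Context {R : realType} {d : nat}.
Local Notation C := R[i].
Variables (u : Zd d -> R) (Th : {fset Zd d}).
Hypothesis hTh : forall k, u k != 0 <-> k \in Th.
Hypothesis A2 : forall k, inner_bd [set k | k \in Th] k -> 0 < u k.
Variables (w U : R).
Hypothesis w0 : 0 < w.
Hypothesis U0 : 0 <= U.
Hypothesis uw : forall t, t \in Th -> w <= `|u t| <= U.

Context {dT : measure_display} {T : measurableType dT} (P : probability T R).
Variables (om : Zd d -> T -> R) (M K : R).
Hypothesis mom : forall k, measurable_fun setT (om k).
Hypothesis indom : mutually_independent P om.
Hypothesis M0 : 0 <= M.
Hypothesis K0 : 0 <= K.
Hypothesis conc : forall k (c e : R), 0 <= e ->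
  (P [set t | (`|om k t - c| <= e)%R] <= (2 * M * e)%:E)%E.
Hypothesis bdom : forall k, P [set t | (K < `|om k t|)%R] = 0%E.

Variables (lam L kp m l tau : R) (z : C).
Let sg : R := if 0 < complex.Im z then -1 else 1.
Local Notation n := #|` Th|.
Hypothesis lam0 : 0 < lam.
Hypothesis L1 : 1 <= L.
Hypothesis l0 : 0 < l.
Hypothesis kpU : 1 + 4 * U / w <= kp.
Hypothesis lamL : m + (2 * d)%:R + l <= lam * (L * w / 2).
Hypothesis zm : normc z <= m.
Hypothesis z0 : complex.Im z != 0.
Hypothesis tau0 : 0 < tau.
Hypothesis taun : tau * (3 * n)%:R <= 2^-1.

Let L0 : 0 < L. Proof. exact: lt_le_trans L1. Qed.

Let kp1 : 1 <= kp.
Proof. by apply: le_trans kpU; rewrite lerDl; apply: divr_ge0; [exact: mulr_ge0|exact: ltW]. Qed.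

Definition shifted (ks : seq (Zd d)) (i : nat) (e : nat -> C) : Prop :=
  forall j, (j < i)%N -> L * kp ^+ j <= sg * complex.Im (e j) <= 2 * (L * kp ^+ j).

Let asg_den ks i e v (Lam : {fset Zd d}) : uniq ks -> (i <= size ks)%N -> shifted ks i e ->
  gden adj Lam (cpot u Th lam z (asg ks i e v)) != 0.
Proof.
by move=> us si he; exact: (asg_gden u Th hTh A2 w U w0 U0 uw lam L kp m l z ks i e v lam0 L0 l0 kpU
  lamL zm z0 us si he).
Qed.

Let step_const (ks : seq (Zd d)) : R :=
  resample_const M K n tau * (L * kp ^+ size ks) `^ (n%:R * tau) * n.+1%:R.

(** With all couplings but the one at the [i]-th site of [ks] frozen, weight and Green function are
    rational in that coupling, and the one-variable comparison trades its real value for [n + 1]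
    complex ones at the cost of a constant. *)
Lemma averaging_step (W : (Zd d -> R) -> R) ks i e (Lam : {fset Zd d}) x y (B : \bar R) :
  rational_weight n tau W -> uniq ks -> (i < size ks)%N -> shifted ks i e ->
  (forall e', shifted ks i.+1 e' ->
     (\int[P]_t (W (om^~ t) *
        normc (green adj Lam (cpot u Th lam z (asg ks i.+1 e' (om^~ t))) x y) `^ tau)%:E <= B)%E) ->
  (\int[P]_t (W (om^~ t) *
     normc (green adj Lam (cpot u Th lam z (asg ks i e (om^~ t))) x y) `^ tau)%:E
   <= (step_const ks)%:E * B)%E.
Proof.
move=> [W0 mW rW] us si he hB.
have t0 : tau != 0 by rewrite gt_eqF.
pose k := nth 0 ks i; have [Li LiE] : exists Li, Li = L * kp ^+ i by exists (L * kp ^+ i).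
have kpi1 : 1 <= kp ^+ i by exact: exprn_ege1.
have Li1 : 1 <= Li by rewrite LiE -[leLHS](mulr1 1) ler_pM.
have Li0 : 0 < Li by exact: lt_le_trans Li1.
(* [n + 1] purely imaginary points of modulus between [Li] and [2 Li], on the side [sg] and spaced
   by [Li / (n + 1)]: enough candidates to avoid the [n] zeros of the numerator, each one an
   admissible displacement. *)
pose pts j : C := Complex 0 (sg * (Li * (1 + j%:R / n.+1%:R))).
have sgn : `|sg| = 1 by rewrite /sg; case: ifP => _; rewrite ?normrN normr1.
have ptsn j : normc (pts j) = Li * (1 + j%:R / n.+1%:R).
  rewrite /= expr0n add0r sqrtr_sqr normrM sgn mul1r ger0_norm//.
  by apply: mulr_ge0; [exact: ltW|rewrite addr_ge0// divr_ge0].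
pose ext j : nat -> C := fun a => if a == i then pts j else e a.
have hpt1 j : (j <= n)%N -> 1 + j%:R / n.+1%:R <= 2 :> R.
  move=> jn; rewrite [leRHS](_ : 2 = 1 + 1)// lerD2l.
  by rewrite ler_pdivrMr// mul1r ler_nat leqW.
have ext_ok j : (j <= n)%N -> shifted ks i.+1 (ext j).
  move=> jn a; rewrite ltnS leq_eqVlt /ext => /orP[/eqP->|ai]; last first.
    by rewrite (ltn_eqF ai); exact: he.
  rewrite eqxx /= mulrA -expr2 -[sg ^+ 2]real_normK ?num_real// sgn expr1n mul1r -LiE.
  rewrite ler_peMr ?(ltW Li0) ?lerDl ?divr_ge0//= mulrC ler_wpM2r ?(ltW Li0)//.
  exact: hpt1.
pose G i' e' v := normc (green adj Lam (cpot u Th lam z (asg ks i' e' v)) x y) `^ tau.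
have mG i' e' (dS : measure_display) (S : measurableType dS) (Z : Zd d -> S -> R) :
    (forall k, measurable_fun setT (Z k)) -> measurable_fun setT (fun s => G i' e' (Z^~ s)).
  by move=> mZ; exact: measurable_green_asg.
have G0 i' e' v : 0 <= G i' e' v by exact: powR_ge0.
have nthP p : (p == k) = (index p ks == i).
  apply/eqP/eqP => [->|E]; first by rewrite index_uniq.
  by rewrite /k -E nth_index// -index_mem E.
have asg_upd e' i' v r : (i' <= i)%N -> asg ks i' e' (upd v k r) = upd (asg ks i' e' v) k r%:C%C.
    move=> ii; apply/funext => p; rewrite /asg /upd; case: (boolP (p == k)) => [|_]; last first.
      by case: ifP.
    by rewrite nthP => /eqP ->; rewrite ltnNge ii.
  have asg_ext j v : asg ks i.+1 (ext j) v = upd (asg ks i e v) k (pts j).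
    apply/funext => p; rewrite /asg /upd nthP ltnS leq_eqVlt /ext.
    by case: eqP => //= _; case: ifP.
  (* Once displaced, the Green function ignores the real value at [k]. It can be moved in and out of
     the integral over that coupling, which leaves the mean of the weight alone. *)
  have asg_ext_upd j v r : asg ks i.+1 (ext j) (upd v k r) = asg ks i.+1 (ext j) v.
    rewrite !asg_ext asg_upd//; apply/funext => p; rewrite /upd; by case: eqP.
  have GEq i' e' v : G i' e' v = (normc (gnum adj Lam (cpot u Th lam z (asg ks i' e' v)) x y) /
      normc (gden adj Lam (cpot u Th lam z (asg ks i' e' v)))) `^ tau.
    by rewrite /G /green normcM normcV.
  pose A : set (Zd d) := [set k].
  have mixE t1 t2 : (fun p => if p \in A then om p t1 else om p t2) = upd (om^~ t2) k (om k t1).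
    apply/funext => p; rewrite /upd; case: eqP => [->|pk]; first by rewrite mem_set.
    by case: ifPn => // /set_mem.
  have c0 : 0 <= resample_const M K n tau * Li `^ (n%:R * tau).
    apply: mulr_ge0; last exact: powR_ge0.
    rewrite /resample_const /avg_const; apply: mulr_ge0; last first.
      by rewrite addr_ge0// mulr_ge0// addr_ge0// mulr_ge0.
    by rewrite mulr_ge0 ?powR_ge0// mulr_ge0 ?powR_ge0.
  pose Psi v := \sum_(j < n.+1) G i.+1 (ext j) v.
  have Psi0 v : 0 <= Psi v by apply: sumr_ge0.
  have inner t2 : (\int[P]_t1 (W (upd (om^~ t2) k (om k t1)) * G i e (upd (om^~ t2) k (om k t1)))%:E
     <= (resample_const M K n tau * Li `^ (n%:R * tau))%:E *
        \int[P]_t1 (W (upd (om^~ t2) k (om k t1)) * Psi (upd (om^~ t2) k (om k t1)))%:E)%E.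
    set v := om^~ t2.
    have [p1 [q1 [sp1 sq1 q1r WE]]] := rW v k.
    have [p2 [q2 [sp2 sq2 E2]]] := green_upd_rational u Th hTh Lam lam z (asg ks i e v) k x y.
    have GE r : G i e (upd v k r) = ratio p2 q2 r%:C%C `^ tau.
      by rewrite GEq asg_upd//; have [-> ->] := E2 r%:C%C.
    have GE' j r : G i.+1 (ext j) (upd v k r) = ratio p2 q2 (pts j) `^ tau.
      by rewrite GEq asg_ext_upd asg_ext; have [-> ->] := E2 (pts j).
    under eq_integral do rewrite WE GE.
    have := resample_one_variable P (om k) M K (mom k) M0 K0 (conc k) (bdom k) n tau Li pts
      p1 q1 p2 q2 tau0 taun Li1.
    move=> /(_ _ _ sp1 sq1 sp2 sq2 q1r)h.
    apply: le_trans (h _ _ _ _) _.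
    - by move=> j jn; rewrite ptsn mulrC ler_wpM2r ?(ltW Li0)// hpt1.
    - move=> j j' jn j'n jj'.
      have -> : pts j - pts j' = Complex 0 (sg * (Li * ((j%:R - j'%:R) / n.+1%:R))).
        by apply/eqP; rewrite eq_complex /= subrr eqxx /=; apply/eqP; ring.
      rewrite /= expr0n add0r sqrtr_sqr !normrM sgn mul1r (gtr0_norm Li0) normfV normr_nat.
      rewrite mulrA ler_wpM2r// ler_peMr ?(ltW Li0)//.
      exact: ler1_dist_nat.
    - by move=> r; have [_ <-] := E2 r%:C%C; rewrite -asg_upd//; apply: asg_den => //; exact: ltnW.
    - move=> j jn; have [_ <-] := E2 (pts j); rewrite -asg_ext; apply: asg_den => //.
      exact: ext_ok.
    have -> : (\int[P]_t1 (W (upd v k (om k t1)) * Psi (upd v k (om k t1)))%:E =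
       (\sum_(j < n.+1) ratio p2 q2 (pts j) `^ tau)%:E *
         \int[P]_t1 (ratio p1 q1 (om k t1)%:C%C `^ tau)%:E)%E.
      rewrite -ge0_integralZl//; last 3 first.
      - apply/measurable_EFinP; apply: cmeasurable_powR_ratio; rewrite ?gt_eqF//;
          by apply: cmeasurable_horner; exact: cmeasurable_real.
      - by move=> r _; rewrite lee_fin powR_ge0.
      - by rewrite lee_fin sumr_ge0// => j _; exact: powR_ge0.
      apply: eq_integral => t1 _; rewrite WE -EFinM mulrC; congr (_ * _)%:E.
      by apply: eq_bigr => j _; exact: GE'.
    by rewrite muleA -EFinM.
have mPsi (dS : measure_display) (S : measurableType dS) (Z : Zd d -> S -> R) :
    (forall k, measurable_fun setT (Z k)) -> measurable_fun setT (fun s => Psi (Z^~ s)).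
  by move=> mZ; apply: measurable_sum => j; exact: mG.
set c := resample_const M K n tau * Li `^ (n%:R * tau) in c0 inner.
rewrite (integral_resample P om mom indom A (fun v => (W v * G i e v)%:E)); last 2 first.
- by move=> v; rewrite lee_fin mulr_ge0.
- move=> dS S Z mZ; apply/measurable_EFinP; apply: measurable_funM; [exact: mW|exact: mG].
apply: (@le_trans _ _ (\int[P]_t2 \int[P]_t1
    (c * (W (fun p => if p \in A then om p t1 else om p t2) *
          Psi (fun p => if p \in A then om p t1 else om p t2)))%:E)%E).
  apply: le_lower_integral => t2.
    by apply: integral_ge0 => t1 _; rewrite lee_fin mulr_ge0.
  under eq_integral do rewrite mixE.
  under [leRHS]eq_integral do rewrite mixE.
  apply: le_trans (inner t2) _; rewrite -ge0_integralZl//.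
  - apply/measurable_EFinP.
    have mZ p : measurable_fun setT (fun t1 => upd (om^~ t2) k (om k t1) p).
      by rewrite /upd; case: (p == k).
    apply: measurable_funM; first exact: (mW _ _ (fun p t1 => upd (om^~ t2) k (om k t1) p)).
    exact: (mPsi _ _ (fun p t1 => upd (om^~ t2) k (om k t1) p)).
  - by move=> t1 _; rewrite lee_fin mulr_ge0.
(* Resampling is undone: after the estimate in the single coupling, the two integrals merge again
   into one expectation. *)
rewrite -(integral_resample P om mom indom A (fun v => (c * (W v * Psi v))%:E)); last 2 first.
- by move=> v; rewrite lee_fin; apply: mulr_ge0 => //; exact: mulr_ge0.
- move=> dS S Z mZ; apply/measurable_EFinP; apply: measurable_funM => //.
  by apply: measurable_funM; [exact: mW|exact: mPsi].
rewrite (_ : (fun t => _) = (fun t => \sum_(j < n.+1) (c * (W (om^~ t) * G i.+1 (ext j) (om^~ t)))%:E)%E); last first.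
  by apply/funext => t; rewrite sumEFin -!mulr_sumr.
have mWG j : measurable_fun setT (fun t => W (om^~ t) * G i.+1 (ext j) (om^~ t)).
  by apply: measurable_funM; [exact: mW|exact: mG].
rewrite ge0_integral_sum//; last 2 first.
- by move=> j; apply/measurable_EFinP; exact: measurable_funM.
- by move=> j t _; rewrite lee_fin; apply: mulr_ge0 => //; exact: mulr_ge0.
have B0 : (0 <= B)%E.
  apply: le_trans (hB (ext 0%N) (ext_ok 0%N isT)).
  by apply: integral_ge0 => t _; rewrite lee_fin mulr_ge0// powR_ge0.
apply: (@le_trans _ _ (\sum_(j < n.+1) (c%:E * B))%E).
  apply: lee_sum => j _; under eq_integral do rewrite EFinM.
  rewrite ge0_integralZl//; last 2 first.
  - exact/measurable_EFinP.
  - by move=> t _; rewrite lee_fin mulr_ge0.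
  apply: lee_wpmul2l => //; apply: hB; apply: ext_ok; exact: (ltn_ord j).
rewrite -ge0_sume_distrl//.
have hc : (\sum_(j < n.+1) c%:E <= (step_const ks)%:E)%E.
  rewrite sumEFin lee_fin sumr_const card_ord -[leLHS]mulr_natr.
  rewrite ler_wpM2r// /c ler_wpM2l//.
    rewrite /resample_const /avg_const; apply: mulr_ge0; last first.
      by rewrite addr_ge0// mulr_ge0// addr_ge0// mulr_ge0.
    by rewrite mulr_ge0 ?powR_ge0// mulr_ge0 ?powR_ge0.
  apply: ge0_ler_powR.
  - by rewrite mulr_ge0// ltW.
  - by rewrite nnegrE ltW.
  - by rewrite nnegrE mulr_ge0 ?(ltW L0)// exprn_ge0// (le_trans _ kp1).
  - by rewrite LiE ler_wpM2l ?(ltW L0)// ler_weXn2l// ltnW.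
exact: lee_wpmul2r.
Qed.

(** The maximum with 1 makes powers increase with the exponent, so that short lists of displaced
    sites are covered by the bound for longer ones. *)
Definition averaging_const (q : nat) : R :=
  Num.max 1 (resample_const M K n tau * (L * kp ^+ q) `^ (n%:R * tau) * n.+1%:R).

(** When every site of [ks] is displaced, the Green function obeys a deterministic bound and only
    the weight remains under the expectation; the induction runs over the number of sites still to
    be displaced. *)
Lemma averaging (W : (Zd d -> R) -> R) ks (Lam : {fset Zd d}) x y (bd : R) :
  rational_weight n tau W -> uniq ks -> 0 <= bd ->
  (forall e v, shifted ks (size ks) e ->
     normc (green adj Lam (cpot u Th lam z (asg ks (size ks) e v)) x y) <= bd) ->
  (\int[P]_t (W (om^~ t) * normc (rgreen u Th Lam lam z (om^~ t) x y) `^ tau)%:E <=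
   (averaging_const (size ks) ^+ size ks * bd `^ tau)%:E * \int[P]_t (W (om^~ t))%:E)%E.
Proof.
move=> rW us bd0 hbd; have [W0 mW _] := rW.
set D := averaging_const (size ks).
have D0 : 0 <= D by rewrite le_max ler01.
have sD : step_const ks <= D by rewrite le_max lexx orbT.
have I0 : (0 <= \int[P]_t (W (om^~ t))%:E)%E by apply: integral_ge0 => t _; rewrite lee_fin.
have main r i e : (i + r = size ks)%N -> shifted ks i e ->
    (\int[P]_t (W (om^~ t) *
       normc (green adj Lam (cpot u Th lam z (asg ks i e (om^~ t))) x y) `^ tau)%:E <=
     (D ^+ r * bd `^ tau)%:E * \int[P]_t (W (om^~ t))%:E)%E.
  elim: r i e => [|r IH] i e ir he.
    rewrite addn0 in ir; rewrite expr0 mul1r -ge0_integralZl//; last 3 first.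
    - by apply/measurable_EFinP; exact: mW.
    - by move=> t _; rewrite lee_fin.
    - by rewrite lee_fin powR_ge0.
    apply: le_lower_integral => t; first by rewrite lee_fin mulr_ge0// powR_ge0.
    rewrite -EFinM lee_fin mulrC ler_wpM2r//; apply: ge0_ler_powR.
    - exact: ltW.
    - by rewrite nnegrE normc_ge0.
    - by rewrite nnegrE.
    - by rewrite ir; apply: hbd; rewrite -ir.
  have si : (i < size ks)%N by rewrite -ir addnS ltnS leq_addr.
  apply: le_trans (averaging_step W ks i e Lam x y _ rW us si he _) _.
    by move=> e' he'; apply: IH he'; rewrite addSnnS.
  rewrite muleA -EFinM; apply: lee_wpmul2r => //.
  rewrite lee_fin exprS -[leRHS]mulrA; apply: ler_wpM2r => //.
  by apply: mulr_ge0; [exact: exprn_ge0|exact: powR_ge0].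
have := main (size ks) 0%N (fun=> 0) (add0n _).
by rewrite /rgreen; under eq_integral do rewrite asg0; apply => j.
Qed.

End Averaging.

(** * Moment bounds uniform in volume and spectral parameter *)

Section APriori.
Context {R : realType} {d : nat}.
Local Notation C := R[i].
Variables (u : Zd d -> R) (Th : {fset Zd d}).
Hypothesis hTh : forall k, u k != 0 <-> k \in Th.
Hypothesis h0 : (0 : Zd d) \in Th.
Hypothesis A2 : forall k, inner_bd [set k | k \in Th] k -> 0 < u k.
Variables (w U : R).
Hypothesis w0 : 0 < w.
Hypothesis U0 : 0 <= U.
Hypothesis uw : forall t, t \in Th -> w <= `|u t| <= U.

Context {dT : measure_display} {T : measurableType dT} (P : probability T R).
Variables (om : Zd d -> T -> R) (M K : R).
Hypothesis mom : forall k, measurable_fun setT (om k).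
Hypothesis indom : mutually_independent P om.
Hypothesis M0 : 0 <= M.
Hypothesis K0 : 0 <= K.
Hypothesis conc : forall k (c e : R), 0 <= e ->
  (P [set t | (`|om k t - c| <= e)%R] <= (2 * M * e)%:E)%E.
Hypothesis bdom : forall k, P [set t | (K < `|om k t|)%R] = 0%E.

Local Notation n := #|` Th|.
Variables (lam m s : R) (z : C).
Let tau := s / (2 * n%:R).
Hypothesis lam0 : 0 < lam.
Hypothesis m0 : 0 < m.
Hypothesis zm : normc z <= m.
Hypothesis z0 : complex.Im z != 0.
Hypothesis s0 : 0 < s.
Hypothesis s1 : s < 1 / 3.

Let n0 : 0 < n%:R :> R.
Proof. by rewrite ltr0n cardfs_gt0; apply/fset0Pn; exists 0. Qed.

Let tau0 : 0 < tau.
Proof. by rewrite /tau divr_gt0// mulr_gt0. Qed.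

Let tau2n : tau * (2 * n%:R) = s.
Proof. by rewrite /tau divfK// gt_eqF// mulr_gt0. Qed.

Let taun : tau * (3 * n)%:R <= 2^-1.
Proof.
rewrite natrM (_ : tau * _ = (tau * (2 * n%:R)) * (3 / 2)); last by field.
by rewrite tau2n; have := s1; lra.
Qed.

(* The [i]-th displaced coupling is of size [disp * growth ^ i] (for couplings of size at
   least 1), so that the last displacement felt at a site dominates the earlier ones. *)
Definition growth : R := 1 + 4 * U / w.
Definition disp : R := 1 + 2 / w * (m + (2 * d)%:R + 1).
(** [averaging_const] freed from [lam]: each displaced coupling costs a further factor
    [g ^ (n tau)], where [n tau = s / 2]. *)
Definition step_bound (q : nat) : R :=
  Num.max 1 (resample_const M K n tau * (disp * growth ^+ q) `^ (n%:R * tau) * n.+1%:R).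

(** At weak coupling the displacements are enlarged by [1 / lam], so that [lam * L] stays of the
    order of [l = max 1 lam]. *)
Let g : R := Num.max 1 lam^-1.
Let l : R := Num.max 1 lam.
Let L : R := disp * g.

Let g1 : 1 <= g. Proof. by rewrite le_max lexx. Qed.
Let l1 : 1 <= l. Proof. by rewrite le_max lexx. Qed.
Let l0 : 0 < l. Proof. exact: lt_le_trans l1. Qed.
Let gr1 : 1 <= growth.
Proof. by rewrite lerDl; apply: divr_ge0; [exact: mulr_ge0|exact: ltW]. Qed.
Let disp1 : 1 <= disp.
Proof.
rewrite lerDl; apply: mulr_ge0; first by apply: divr_ge0 => //; exact: ltW.
by rewrite !addr_ge0// ltW.
Qed.
Let L1 : 1 <= L. Proof. by rewrite -[leLHS](mulr1 1) ler_pM. Qed.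

Let lamg : lam * g = l.
Proof.
rewrite /g /l; have [h|h] := leP 1 lam.
  by rewrite (max_idPl _) ?mulr1// invf_le1.
by rewrite (max_idPr _) ?mulfV ?gt_eqF// invf_ge1// ltW.
Qed.

Let lamL : m + (2 * d)%:R + l <= lam * (L * w / 2).
Proof.
have -> : lam * (L * w / 2) = (lam * g) * (disp * w / 2) by rewrite /L; field.
rewrite lamg (_ : disp * w / 2 = w / 2 + (m + (2 * d)%:R + 1)); last first.
  by rewrite /disp; field; rewrite gt_eqF.
have a0 : 0 <= m + (2 * d)%:R by rewrite addr_ge0// ltW.
apply: (@le_trans _ _ (l * (m + (2 * d)%:R + 1))).
  by rewrite [leRHS]mulrDr mulr1 lerD2r ler_peMl.
by rewrite ler_pM2l// lerDr divr_ge0// ltW.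
Qed.

Lemma averaging_const_le q Q : (q <= Q)%N ->
  averaging_const Th M K L growth tau q <= step_bound Q * g `^ (n%:R * tau).
Proof.
move=> qQ; have gp : 1 <= g `^ (n%:R * tau).
  by rewrite -[leLHS](powRr0 g); apply: ler_powR => //; apply: mulr_ge0 => //; exact: ltW.
have rc0 : 0 <= resample_const M K n tau.
  rewrite /resample_const /avg_const; apply: mulr_ge0; last first.
    by rewrite addr_ge0// mulr_ge0// addr_ge0// mulr_ge0.
  by rewrite mulr_ge0 ?powR_ge0// mulr_ge0 ?powR_ge0.
have d0 : 0 <= disp by exact: le_trans disp1.
have gr0 : 0 <= growth by exact: le_trans gr1.
have g0 : 0 <= g by exact: le_trans g1.
rewrite /averaging_const /step_bound ge_max; apply/andP; split.
  by rewrite -[leLHS](mulr1 1) ler_pM// le_max lexx.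
apply: (@le_trans _ _ (resample_const M K n tau * (disp * growth ^+ Q) `^ (n%:R * tau) * n.+1%:R
    * g `^ (n%:R * tau))); last by rewrite ler_wpM2r ?powR_ge0// le_max lexx orbT.
rewrite [leRHS]mulrAC -[_ * g `^ _]mulrA -powRM ?mulr_ge0 ?exprn_ge0//.
rewrite ler_wpM2r// ler_wpM2l//; apply: ge0_ler_powR.
- by apply: mulr_ge0 => //; exact: ltW.
- by rewrite nnegrE !mulr_ge0// exprn_ge0.
- by rewrite nnegrE !mulr_ge0// exprn_ge0.
- by rewrite /L mulrAC ler_wpM2r// ler_wpM2l// ler_weXn2l.
Qed.

Let factor q Q r : (q <= Q)%N -> (q <= r)%N ->
  averaging_const Th M K L growth tau q ^+ q <= step_bound Q ^+ r * g `^ (r%:R * (n%:R * tau)).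
Proof.
move=> qQ qr; have h := averaging_const_le _ _ qQ.
have s1' : 1 <= step_bound Q by rewrite le_max lexx.
have gp : 1 <= g `^ (n%:R * tau).
  by rewrite -[leLHS](powRr0 g); apply: ler_powR => //; apply: mulr_ge0 => //; exact: ltW.
have a0 : 0 <= averaging_const Th M K L growth tau q by rewrite le_max ler01.
apply: (@le_trans _ _ ((step_bound Q * g `^ (n%:R * tau)) ^+ q)).
  by apply: lerXn2r; rewrite ?nnegrE// (le_trans a0).
apply: (@le_trans _ _ ((step_bound Q * g `^ (n%:R * tau)) ^+ r)).
  by rewrite ler_weXn2l// -[leLHS](mulr1 1) ler_pM.
have -> : g `^ (r%:R * (n%:R * tau)) = (g `^ (n%:R * tau)) ^+ r.
  by rewrite -powR_mulrn ?powR_ge0// -[RHS]powRrM mulrC.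
by rewrite exprMn.
Qed.

Let rg Lam v x y := normc (rgreen u Th Lam lam z v x y) `^ tau.

Let av (W : (Zd d -> R) -> R) ks (Lam : {fset Zd d}) x y (bd : R) :
  rational_weight n tau W -> uniq ks -> 0 <= bd ->
  (forall e v, shifted L growth z ks (size ks) e ->
     normc (green adj Lam (cpot u Th lam z (asg ks (size ks) e v)) x y) <= bd) ->
  (\int[P]_t (W (om^~ t) * rg Lam (om^~ t) x y)%:E <=
   (averaging_const Th M K L growth tau (size ks) ^+ size ks * bd `^ tau)%:E *
     \int[P]_t (W (om^~ t))%:E)%E.
Proof.
exact: (averaging u Th hTh A2 w U w0 U0 uw P om M K mom indom M0 K0 conc bdom lam L growth
  m l tau z lam0 L1 l0 (lexx _) lamL zm z0 tau0 taun).
Qed.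

Let in_zone ks x : x \in ks -> [exists j : 'I_(size ks), x - nth 0 ks j \in Th].
Proof.
move=> xk; rewrite -index_mem in xk; apply/existsP; exists (Ordinal xk).
by rewrite /= nth_index ?subrr// -index_mem.
Qed.

(** Displacing the couplings at [x] and [y] alone puts both sites in the zone, as [0] lies in [Th].
    The two displacements cost [g ^ (2 n tau) = g ^ s], and the energy estimate yields [1 / l]. *)
Lemma weighted_pair_bound W (Lam : {fset Zd d}) x y Q : (2 <= Q)%N ->
  rational_weight n tau W -> x \in Lam -> y \in Lam ->
  (\int[P]_t (W (om^~ t) * rg Lam (om^~ t) x y)%:E <=
   (step_bound Q ^+ 2 * g `^ s * l `^ (- tau))%:E * \int[P]_t (W (om^~ t))%:E)%E.
Proof.
move=> Q2 rW xL yL; have [W0 mW _] := rW.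
(* [undup] serves the diagonal case [x = y], where a single coupling is displaced. *)
pose ks := undup [:: x; y].
have us : uniq ks by exact: undup_uniq.
have sk : (size ks <= 2)%N by exact: size_undup.
have li0 : 0 <= l^-1 by rewrite invr_ge0 ltW.
apply: le_trans (av W ks Lam x y l^-1 rW us li0 _) _.
  move=> e v he; apply: (asg_green_le u Th hTh A2 w U w0 U0 uw lam L growth m l z ks (size ks) e v
    lam0 (lt_le_trans ltr01 L1) l0 (lexx _) lamL zm z0 us (leqnn _) he) => //;
    by apply: in_zone; rewrite mem_undup !inE eqxx ?orbT.
apply: lee_wpmul2r; first by apply: integral_ge0 => t _; rewrite lee_fin.
rewrite lee_fin; apply: ler_pM; [|exact: powR_ge0| |].
- by rewrite exprn_ge0// le_max ler01.
- apply: le_trans (factor _ Q _ _ sk) _; first exact: leq_trans Q2.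
  by rewrite mulrA [2%:R * _ * _]mulrC tau2n.
- by rewrite -powR_inv1 ?(ltW l0)// -powRrM mulN1r.
Qed.

(** For the decay all neighbours of [x] and [y] must lie in the zone too, hence [2 + 4 d] displaced
    couplings. At [lam >= 1] they cost no power of [lam], since [g = 1], while the cubic bound gives
    [lam ^ (- 3 tau)]. *)
Lemma weighted_far_bound W (Lam : {fset Zd d}) x y :
  1 <= lam -> rational_weight n tau W -> x \in Lam -> y \in Lam -> x != y -> adj x y = 0%N ->
  (\int[P]_t (W (om^~ t) * rg Lam (om^~ t) x y)%:E <=
   (step_bound (2 + 4 * d) ^+ (2 + 4 * d) * ((2 * d)%:R ^+ 2) `^ tau * lam `^ (- (3 * tau)))%:E *
     \int[P]_t (W (om^~ t))%:E)%E.
Proof.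
move=> lam1 rW xL yL xy axy; set Q := (2 + 4 * d)%N; have [W0 mW _] := rW.
pose nb (p : Zd d) := [seq p + unitv i | i : 'I_d] ++ [seq p - unitv i | i : 'I_d].
have nbP p q : adj p q != 0%N -> q \in nb p.
  move=> /adjP[i [->|->]]; rewrite mem_cat; apply/orP.
    by left; apply/mapP; exists i => //; rewrite mem_enum.
  by right; apply/mapP; exists i => //; rewrite mem_enum.
have snb p : size (nb p) = (2 * d)%N.
  by rewrite size_cat !size_image card_ord addnn mul2n.
pose ks := undup ([:: x; y] ++ nb x ++ nb y).
have us : uniq ks by exact: undup_uniq.
have sk : (size ks <= Q)%N.
  apply: leq_trans (size_undup _) _; rewrite size_cat (size_cat (nb x)) !snb /= /Q.
  by rewrite -mulnDl.
have bd0 : 0 <= (2 * d)%:R ^+ 2 * l^-1 ^+ 3 by rewrite mulr_ge0// exprn_ge0// invr_ge0 ltW.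
apply: le_trans (av W ks Lam x y _ rW us bd0 _) _.
  move=> e v he; apply: (asg_green_decay u Th hTh A2 w U w0 U0 uw lam L growth m l z ks (size ks) e v
    lam0 (lt_le_trans ltr01 L1) l0 (lexx _) lamL zm z0 us (leqnn _) he) => // p _ hp.
  have E2 : (p \in [:: x; y]) = (p == x) || (p == y) by rewrite !inE.
  apply: in_zone; rewrite mem_undup (mem_cat p [:: x; y]) (mem_cat p (nb x)) E2.
  by case/orP: hp => [/orP[/orP[/nbP->|/nbP->]|->]|->]; rewrite ?orbT.
apply: lee_wpmul2r; first by apply: integral_ge0 => t _; rewrite lee_fin.
have ll : l = lam by rewrite /l; apply/max_idPr.
have gg : g = 1 by rewrite /g; apply/max_idPl; rewrite invf_le1.
rewrite lee_fin -mulrA; apply: ler_pM; [|exact: powR_ge0| |].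
- by rewrite exprn_ge0// le_max ler01.
- by apply: le_trans (factor _ Q _ sk sk) _; rewrite gg powR1 mulr1.
- rewrite powRM ?exprn_ge0 ?invr_ge0 ?(ltW l0)// ler_wpM2l ?powR_ge0// ll.
  rewrite -powR_inv1 ?(ltW lam0)// -powR_mulrn ?powR_ge0// -!powRrM.
  by rewrite le_eqVlt; apply/orP; left; apply/eqP; congr (_ `^ _); ring.
Qed.

(** The two members of the maximum [Xi] are the two regimes: [lam ^ (- tau)] from the energy bound
    at strong coupling, and [lam ^ (- s) <= lam ^ (- 2 s)] from the displacement cost at weak
    coupling. *)
Lemma apriori (Lam : {fset Zd d}) x y : x \in Lam -> y \in Lam ->
  (\int[P]_t (rg Lam (om^~ t) x y)%:E <= (step_bound 2 ^+ 2 * Xi s lam n)%:E)%E.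
Proof.
move=> xL yL.
have := weighted_pair_bound (fun=> 1) Lam x y 2 isT (rational_weight1 _ _) xL yL.
under eq_integral do rewrite mul1r.
rewrite integral_cst// [X in (_ * (_ * X))%E](_ : _ = 1%E); last exact: probability_setT.
rewrite !mule1 => h; apply: le_trans h _; rewrite lee_fin -mulrA.
have sb : 0 <= step_bound 2 ^+ 2 by rewrite exprn_ge0// le_max ler01.
rewrite ler_wpM2l// /Xi -/tau; have [lam1|lam1] := leP 1 lam.
  rewrite {1}/g (max_idPl _) ?invf_le1// powR1 mul1r /l (max_idPr lam1).
  by rewrite le_max lexx.
rewrite /g (max_idPr _) ?invf_ge1// ?(ltW lam1)// /l (max_idPl (ltW lam1)) powR1 mulr1.
rewrite -powR_inv1 ?(ltW lam0)// -powRrM mulN1r le_max; apply/orP; right.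
apply: ger_powR; first by rewrite lam0 ltW.
by have := s0; lra.
Qed.

Definition far_const : R :=
  step_bound (2 + 4 * d) ^+ (2 + 4 * d) * Num.max 1 (((2 * d)%:R ^+ 2) `^ tau).

(** Since [s / n = 2 tau], strong coupling splits [lam ^ (- 3 tau)] into [lam ^ (- tau) <= Xi] and
    the quotient in the claim. At weak coupling [lam ^ (- 2 tau) >= 1], so the pair bound is already
    enough. *)
Lemma weighted_bound W (Lam : {fset Zd d}) x y :
  rational_weight n tau W -> x \in Lam -> y \in Lam -> x != y -> adj x y = 0%N ->
  (\int[P]_t (W (om^~ t) * rg Lam (om^~ t) x y)%:E <=
   (far_const * (Xi s lam n / lam `^ (s / n%:R)))%:E *
     \int[P]_t (W (om^~ t))%:E)%E.
Proof.
move=> rW xL yL xy axy; have [W0 mW _] := rW.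
set Q := (2 + 4 * d)%N.
have I0 : (0 <= \int[P]_t (W (om^~ t))%:E)%E by apply: integral_ge0 => t _; rewrite lee_fin.
have sb : 1 <= step_bound Q by rewrite le_max lexx.
have sb0 : 0 <= step_bound Q by exact: le_trans sb.
have st : s / n%:R = 2 * tau by rewrite /tau; field; rewrite gt_eqF.
have X0 : 0 <= Xi s lam n by rewrite le_max powR_ge0.
rewrite st -powRN; have [lam1|lam1] := leP 1 lam.
  apply: le_trans (weighted_far_bound W Lam x y lam1 rW xL yL xy axy) _.
  apply: lee_wpmul2r => //; rewrite lee_fin /far_const -/Q.
  apply: ler_pM; [|exact: powR_ge0| |].
  - by rewrite mulr_ge0 ?powR_ge0// exprn_ge0.
  - by rewrite ler_wpM2l ?exprn_ge0// le_max lexx orbT.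
  - have -> : lam `^ (- (3 * tau)) = lam `^ (- tau) * lam `^ (- (2 * tau)).
      rewrite -powRD; first by congr (_ `^ _); ring.
      by apply/implyP => _; rewrite gt_eqF.
    by apply: ler_wpM2r; [exact: powR_ge0|rewrite /Xi -/tau le_max lexx].
apply: le_trans (weighted_pair_bound W Lam x y Q _ rW xL yL) _ => //.
apply: lee_wpmul2r => //; rewrite lee_fin /far_const -/Q -[leLHS]mulrA.
apply: ler_pM; [exact: exprn_ge0|by rewrite mulr_ge0 ?powR_ge0| |].
- rewrite -[leLHS]mulr1; apply: ler_pM; rewrite ?exprn_ge0//.
    by rewrite ler_weXn2l.
  by rewrite le_max lexx.
- rewrite /g (max_idPr _) ?invf_ge1// ?(ltW lam1)// /l (max_idPl (ltW lam1)) powR1 mulr1.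
  rewrite -powR_inv1 ?(ltW lam0)// -powRrM mulN1r -[leLHS]mulr1.
  have lam01 : 0 < lam <= 1 by rewrite lam0 ltW.
  apply: ler_pM; rewrite ?powR_ge0//.
    by rewrite le_max; apply/orP; right; apply: ger_powR => //; have := s0; lra.
  by rewrite -[leLHS](powRr0 lam); apply: ger_powR => //; rewrite oppr_le0 mulr_ge0// ltW.
Qed.

(** Resampling on [A] lets [F1] see only the first copy of the couplings and [F2] only the
    second. *)
Lemma integral_indep_regions (A : set (Zd d)) (F1 F2 : (Zd d -> R) -> R) :
  (forall v, 0 <= F1 v) -> (forall v, 0 <= F2 v) ->
  (forall (dS : measure_display) (S : measurableType dS) (Z : Zd d -> S -> R),
        (forall k, measurable_fun setT (Z k)) -> measurable_fun setT (fun s => F1 (Z^~ s))) ->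
  (forall (dS : measure_display) (S : measurableType dS) (Z : Zd d -> S -> R),
        (forall k, measurable_fun setT (Z k)) -> measurable_fun setT (fun s => F2 (Z^~ s))) ->
  (forall v v', (forall k, A k -> v k = v' k) -> F1 v = F1 v') ->
  (forall v v', (forall k, ~ A k -> v k = v' k) -> F2 v = F2 v') ->
  (\int[P]_t (F1 (om^~ t) * F2 (om^~ t))%:E =
   \int[P]_t (F1 (om^~ t))%:E * \int[P]_t (F2 (om^~ t))%:E)%E.
Proof.
move=> F10 F20 m1 m2 l1' l2'.
rewrite (integral_resample P om mom indom A (fun v => (F1 v * F2 v)%:E)); last 2 first.
- by move=> v; rewrite lee_fin mulr_ge0.
- by move=> dS S Z mZ; apply/measurable_EFinP; apply: measurable_funM; [exact: m1|exact: m2].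
have I0 : (0 <= \int[P]_t (F1 (om^~ t))%:E)%E by apply: integral_ge0 => t _; rewrite lee_fin.
rewrite -ge0_integralZl//; last 2 first.
- by apply/measurable_EFinP; exact: m2.
- by move=> t _; rewrite lee_fin.
apply: eq_integral => t2 _; rewrite -ge0_integralZr//; last 3 first.
- by apply/measurable_EFinP; exact: m1.
- by move=> t _; rewrite lee_fin.
- by rewrite lee_fin.
apply: eq_integral => t1 _; rewrite -EFinM; congr (_ * _)%:E.
  by apply: l1' => k Ak; rewrite mem_set.
by apply: l2' => k Ak; case: ifPn => // /set_mem.
Qed.

End APriori.

(** * Geometry of the collar *)

Section Geometry.
Context {d : nat}.
Implicit Types (x y p q k t : Zd d).

Lemma normoo_leP x (r : nat) : reflect (forall i, (absz (x ord0 i) <= r)%N) (normoo x <= r)%N.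
Proof. by rewrite /normoo; apply: (iffP (bigmax_leqP _ _ _)) => h i *; exact: h. Qed.

Lemma normooD x y : (normoo (x + y)%R <= normoo x + normoo y)%N.
Proof.
apply/normoo_leP => i; rewrite mxE.
have /normoo_leP/(_ i) hx := leqnn (normoo x).
have /normoo_leP/(_ i) hy := leqnn (normoo y).
apply: leq_trans (leq_add hx hy); move: (x ord0 i) (y ord0 i) => a b.
by clear; lia.
Qed.

Lemma normooN x : normoo (- x)%R = normoo x.
Proof. by apply: eq_bigr => i _; rewrite mxE abszN. Qed.

Lemma normoo0 : normoo (0 : Zd d) = 0%N.
Proof. by apply/eqP; rewrite -leqn0; apply/normoo_leP => i; rewrite mxE. Qed.

Lemma normoo_unitv (i : 'I_d) : (normoo (unitv i) <= 1)%N.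
Proof. by apply/normoo_leP => j; rewrite mxE; case: (i == j). Qed.

Lemma adj_normoo x y : adj x y != 0%N -> (normoo (x - y)%R <= 1)%N.
Proof.
move=> /adjP[i [->|->]].
  by rewrite opprD addNKr normooN normoo_unitv.
by rewrite opprB addrCA subrr addr0 normoo_unitv.
Qed.

Lemma normoo_near x y (r : nat) : (normoo (x - y)%R <= r)%N -> (normoo x <= normoo y + r)%N.
Proof.
move=> h; rewrite -{1}(subrK y x) addnC; apply: leq_trans (normooD _ _) _.
by rewrite leq_add2r.
Qed.

Lemma normoo_diam (Th : {fset Zd d}) t : (0 : Zd d) \in Th -> t \in Th -> (normoo t <= diam Th)%N.
Proof.
move=> h0 ht; rewrite /diam -{1}(subr0 t).
have h1 : (normoo (t - 0)%R <= \max_(c <- Th) normoo (t - c)%R)%N.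
  by rewrite (big_rem 0)//= leq_maxl.
by apply: leq_trans h1 _; rewrite [leqRHS](big_rem t)//= leq_maxl.
Qed.

(** A step outwards along a coordinate of maximal modulus leaves the box. *)
Lemma sphere_inner (r : nat) x k : (0 < r)%N -> normoo (k - x)%R = r -> inner_bd (box r x) k.
Proof.
move=> r0 kr; apply/inner_bdP; split; first by rewrite /box /= kr.
have [i hi] : exists i, absz ((k - x)%R ord0 i) = r.
  apply: contrapT => H; have : (normoo (k - x)%R <= r.-1)%N.
    apply/normoo_leP => i; have /normoo_leP/(_ i) : (normoo (k - x)%R <= r)%N by rewrite kr.
    rewrite leq_eqVlt => /orP[/eqP E|]; first by case: H; exists i.
    by move=> h; rewrite -ltnS prednK.
  by rewrite kr -ltnS prednK// ltnn.
have [n1 n2] := adj_unitv k i.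
have [s0|s0] := leP 0 ((k - x) ord0 i).
  exists (k + unitv i) => // /normoo_leP/(_ i); rewrite !mxE eqxx.
  by move: hi s0; rewrite !mxE; move: (k ord0 i) (x ord0 i) => a b; clear; lia.
exists (k - unitv i) => // /normoo_leP/(_ i); rewrite !mxE eqxx.
by move: hi s0; rewrite !mxE; move: (k ord0 i) (x ord0 i) => a b; clear; lia.
Qed.

Lemma inner_sphere (r : nat) x k : inner_bd (box r x) k -> normoo (k - x)%R = r.
Proof.
move=> /inner_bdP[kr [y ky yr]]; apply/eqP; rewrite eqn_leq; apply/andP; split => //.
rewrite leqNgt; apply/negP => lt; apply: yr; rewrite /box /=.
rewrite adjC in ky.
have := normoo_near (y - x) (k - x) 1; rewrite opprB addrA subrK => /(_ (adj_normoo _ _ ky)) h.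
by apply: leq_trans h _; rewrite addn1.
Qed.

Variables (Gam : set (Zd d)) (Th : {fset Zd d}) (r : nat) (x : Zd d) (Lam : {fset Zd d}).
Hypothesis h0 : (0 : Zd d) \in Th.
Hypothesis hr : (diam Th + 2 <= r)%N.
Hypothesis LG : forall p, p \in Lam -> Gam p.
Hypothesis xL : x \in Lam.

Let W := Wset Gam Th r x.

(* [k - x] stays inside, resp. outside, the sphere for every coupling site [k] that
   influences [p]. *)
Definition inside (p : Zd d) : bool := all (fun t => (normoo (p - t - x)%R < r)%N) Th.
Definition outside (p : Zd d) : bool := all (fun t => (r < normoo (p - t - x)%R)%N) Th.

Lemma insideP p : reflect (forall t, t \in Th -> (normoo (p - t - x)%R < r)%N) (inside p).
Proof. exact: allP. Qed.

Lemma outsideP p : reflect (forall t, t \in Th -> (r < normoo (p - t - x)%R)%N) (outside p).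
Proof. exact: allP. Qed.

Let r0 : (0 < r)%N. Proof. by apply: leq_trans hr; rewrite addn2. Qed.

Let not_sphere q t : Gam q -> ~ What Gam Th r x q -> t \in Th -> normoo (q - t - x)%R != r.
Proof.
move=> Gq nq tT; apply/eqP => E; apply: nq; split=> //; exists (q - t).
  exact: sphere_inner.
by rewrite subKr.
Qed.

Let near_shift p q t : adj p q != 0%N ->
  (normoo (q - t - x)%R <= (normoo (p - t - x)%R).+1)%N.
Proof.
move=> pq; rewrite -[X in (_ <= X)%N]addn1; apply: normoo_near.
rewrite (_ : _ - _ = q - p); first by apply: adj_normoo; rewrite adjC.
by rewrite !opprB; rewrite addrA subrK addrA addrAC -!addrA; congr (_ + _); rewrite addrCA addNr addr0.
Qed.

(** A hop changes the distance of each coupling site to [x] by at most 1, and off [What] no coupling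
    site lies on the sphere; hence none of them can cross it. *)
Lemma inside_step p q : inside p -> adj p q != 0%N -> Gam q -> ~ What Gam Th r x q -> inside q.
Proof.
move=> /insideP ip pq Gq nq; apply/insideP => t tT.
have := near_shift p q t pq; have := ip t tT; have := not_sphere q t Gq nq tT.
by clear; lia.
Qed.

Lemma outside_step p q : outside p -> adj p q != 0%N -> Gam q -> ~ What Gam Th r x q -> outside q.
Proof.
move=> /outsideP ip pq Gq nq; apply/outsideP => t tT.
rewrite adjC in pq.
have := near_shift q p t pq; have := ip t tT; have := not_sphere q t Gq nq tT.
by clear; lia.
Qed.

Lemma What_normoo p : What Gam Th r x p ->
  (r <= normoo (p - x)%R + diam Th)%N /\ (normoo (p - x)%R <= r + diam Th)%N.
Proof.
move=> [_ [b /inner_sphere E bT]]; rewrite -E; split; apply: normoo_near.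
  rewrite opprB addrA subrK -normooN opprB; exact: normoo_diam.
by rewrite opprB addrA subrK; exact: normoo_diam.
Qed.

Lemma Wset_normoo p : W p ->
  (r <= (normoo (p - x)%R + diam Th).+1)%N /\ (normoo (p - x)%R <= (r + diam Th).+1)%N.
Proof.
move=> [[/What_normoo[h1 h2]|/inner_bdP[_ [q pq /contrapT/What_normoo[h1 h2]]]] _].
  by split; [exact: leqW|exact: leqW].
have hq : (normoo (q - x)%R <= normoo (p - x)%R + 1)%N.
  by apply: normoo_near; rewrite opprB addrA subrK; apply: adj_normoo; rewrite adjC.
have hp : (normoo (p - x)%R <= normoo (q - x)%R + 1)%N.
  by apply: normoo_near; rewrite opprB addrA subrK; apply: adj_normoo.
by move: h1 h2 hq hp; clear; lia.
Qed.

(** The bound [diam Th + 2 <= r] keeps the centre off the collar, whose sites lie at distance at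
    least [r - diam Th - 1]. *)
Lemma center_inside : inside x /\ ~ W x.
Proof.
split.
  apply/insideP => t tT; rewrite addrAC subrr add0r normooN.
  by have := normoo_diam Th t h0 tT; move: hr; clear; lia.
by move=> /Wset_normoo[h _]; move: h hr; rewrite subrr normoo0; clear; lia.
Qed.

Lemma far_outside y : (r + diam Th + 2 <= normoo (x - y)%R)%N -> outside y /\ ~ W y.
Proof.
rewrite -normooN opprB => far; split.
  apply/outsideP => t tT; have := normoo_near (y - x) (y - t - x) (diam Th).
  rewrite (_ : y - x - _ = t); last by rewrite [y - t - x]addrAC subKr.
  move=> /(_ (normoo_diam Th t h0 tT)) h; have := leq_trans far h.
  by rewrite addnAC leq_add2r addn2; exact: ltnW.
by move=> /Wset_normoo[_ h]; have := leq_trans far h; rewrite addn2 ltnn.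
Qed.

Lemma not_W_not_What p : Gam p -> ~ W p ->
  ~ What Gam Th r x p /\ forall q, adj p q != 0%N -> ~ What Gam Th r x q.
Proof.
move=> Gp nW; have nh : ~ What Gam Th r x p by move=> h; apply: nW; split => //; left.
split=> // q pq hq; apply: nW; split => //; right; apply/inner_bdP; split => //.
by exists q.
Qed.

Definition Kset : {fset Zd d} := [fset p in Lam | ~~ `[< W p >]]%fset.
(** When [Th] has gaps, a site of [Kset] can have coupling sites on both sides of the sphere, so
    [Iset] and [Oset] need not exhaust [Kset]. Each of them is a union of components of [Kset],
    which is enough to identify the Green functions. *)
Definition Iset : {fset Zd d} := [fset p in Kset | inside p]%fset.
Definition Oset : {fset Zd d} := [fset p in Kset | outside p]%fset.

Lemma KsetP p : p \in Kset <-> p \in Lam /\ ~ W p.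
Proof.
rewrite !inE /=; split => [/andP[pL /negP nW]|[pL nW]].
  by split => // Wp; apply: nW; exact/asboolP.
by apply/andP; split => //; apply/negP => /asboolP.
Qed.

Lemma Kset_set : [set` Kset] = [set` Lam] `\` W.
Proof. by apply/seteqP; split => p /=; rewrite KsetP. Qed.

Lemma in_Iset p : (p \in Iset) = (p \in Kset) && inside p. Proof. by rewrite !inE. Qed.
Lemma in_Oset p : (p \in Oset) = (p \in Kset) && outside p. Proof. by rewrite !inE. Qed.

Lemma Iset_sub : (Iset `<=` Kset)%fset. Proof. by apply/fsubsetP => p; rewrite in_Iset => /andP[]. Qed.
Lemma Oset_sub : (Oset `<=` Kset)%fset. Proof. by apply/fsubsetP => p; rewrite in_Oset => /andP[]. Qed.

Lemma Iset_sep p q : p \in Iset -> q \in Kset -> q \notin Iset -> adj p q = 0%N.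
Proof.
rewrite !in_Iset => /andP[/KsetP[pL pW] ip] /[dup] qK /KsetP[qL qW]; rewrite qK /= => nq.
apply/eqP; apply: contraT => pq; case/negP: nq; apply: inside_step ip pq (LG _ qL) _.
by have [] := not_W_not_What q (LG _ qL) qW.
Qed.

Lemma Oset_sep p q : p \in Oset -> q \in Kset -> q \notin Oset -> adj p q = 0%N.
Proof.
rewrite !in_Oset => /andP[/KsetP[pL pW] ip] /[dup] qK /KsetP[qL qW]; rewrite qK /= => nq.
apply/eqP; apply: contraT => pq; case/negP: nq; apply: outside_step ip pq (LG _ qL) _.
by have [] := not_W_not_What q (LG _ qL) qW.
Qed.

(** A bond leaving [Iset] cannot end in [Kset], so it ends in [W]. As [W] has one layer more than
    [What], its end point [q] still avoids [What] and has not crossed the sphere; this is what keeps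
    the end points of the middle factor apart. *)
Lemma Iset_exit p q : p \in Iset -> q \in (Lam `\` Iset)%fset -> adj p q != 0%N ->
  outer_bd W p /\ inside q.
Proof.
move=> /[dup] pI; rewrite in_Iset => /andP[/KsetP[pL pW] ip]; rewrite in_fsetD => /andP[qI qL] pq.
have [_ nq] := not_W_not_What p (LG _ pL) pW.
split; last exact: inside_step ip pq (LG _ qL) (nq q pq).
apply/inner_bdP; split => //; exists q => //; apply.
apply: contrapT => qW; have qK : q \in Kset by apply/KsetP.
by move: pq; rewrite (Iset_sep _ _ pI qK qI).
Qed.

Lemma Oset_exit p q : p \in Oset -> q \in (Lam `\` Oset)%fset -> adj p q != 0%N ->
  outer_bd W p /\ outside q.
Proof.
move=> /[dup] pI; rewrite in_Oset => /andP[/KsetP[pL pW] ip]; rewrite in_fsetD => /andP[qI qL] pq.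
have [_ nq] := not_W_not_What p (LG _ pL) pW.
split; last exact: outside_step ip pq (LG _ qL) (nq q pq).
apply/inner_bdP; split => //; exists q => //; apply.
apply: contrapT => qW; have qK : q \in Kset by apply/KsetP.
by move: pq; rewrite (Oset_sep _ _ pI qK qI).
Qed.

(** As [0] lies in [Th], the two sites are themselves strictly on opposite sides of the sphere,
    hence at distance at least 2. *)
Lemma inside_outside_far p q : inside p -> outside q -> p != q /\ adj p q = 0%N.
Proof.
move=> /insideP/(_ _ h0); rewrite subr0 => ip /outsideP/(_ _ h0); rewrite subr0 => oq; split.
  by apply/eqP => E; move: ip oq; rewrite E; clear; lia.
apply/eqP; apply: contraT => pq; rewrite adjC in pq.
have : (normoo (q - x)%R <= normoo (p - x)%R + 1)%N.
  by apply: normoo_near; rewrite opprB addrA subrK; exact: adj_normoo.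
by move: ip oq; clear; lia.
Qed.

(** Origin of the step length in the decay rate: the collar reaches out to [r + diam Th + 1], and
    its outer boundary one site further. *)
Lemma outer_bd_W_normoo p : outer_bd W p -> (normoo (x - p)%R <= r + diam Th + 2)%N.
Proof.
move=> /inner_bdP[_ [q pq /contrapT/Wset_normoo[_ h]]]; rewrite -normooN opprB.
have : (normoo (p - x)%R <= normoo (q - x)%R + 1)%N.
  by apply: normoo_near; rewrite opprB addrA subrK; exact: adj_normoo.
by move=> h2; apply: leq_trans h2 _; rewrite addn1 addn2 ltnS.
Qed.

End Geometry.

(** * Counting the sites of the collar *)

Section Counting.
Context {d : nat}.
Implicit Types (x p q k t : Zd d).

Definition nbrs p : seq (Zd d) :=
  [seq p + unitv i | i : 'I_d] ++ [seq p - unitv i | i : 'I_d].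

Lemma size_nbrs p : size (nbrs p) = (2 * d)%N.
Proof. by rewrite size_cat !size_image card_ord addnn mul2n. Qed.

Lemma mem_nbrs p q : adj p q != 0%N -> q \in nbrs p.
Proof.
move=> /adjP[i [->|->]]; rewrite mem_cat; apply/orP.
  by left; apply/mapP; exists i => //; rewrite mem_enum.
by right; apply/mapP; exists i => //; rewrite mem_enum.
Qed.

Lemma size_flatten_nbrs (s : seq (Zd d)) :
  size (flatten [seq nbrs q | q <- s]) = (2 * d * size s)%N.
Proof.
elim: s => [|q s IH]; first by rewrite muln0.
by rewrite /= size_cat size_nbrs IH mulnS.
Qed.

(** A code for the faces of a cube: a coordinate of maximal modulus, its sign, and the remaining
    coordinates shifted by [r]. Repetitions on edges are harmless for an upper bound. *)
Definition sphere_point (r : nat) (c : 'I_d * bool * {ffun 'I_d.-1 -> 'I_(2 * r).+1}) : Zd d :=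
  \row_j (if unlift c.1.1 j is Some j' then (c.2 j' : nat)%:Z - r%:Z else (-1) ^+ c.1.2 * r%:Z).

Definition sphere (r : nat) : seq (Zd d) := [seq sphere_point r c | c : _].

Lemma size_sphere r : size (sphere r) = (d * 2 * (2 * r).+1 ^ d.-1)%N.
Proof. by rewrite size_image !card_prod card_ord card_bool card_ffun !card_ord. Qed.

Lemma mem_sphere r k : (0 < r)%N -> normoo k = r -> k \in sphere r.
Proof.
move=> r0 kr; have hk j : (absz (k ord0 j) <= r)%N by apply/normoo_leP; rewrite kr.
have [i hi] : exists i, absz (k ord0 i) = r.
  apply: contrapT => H; have : (normoo k <= r.-1)%N.
    apply/normoo_leP => i; have := hk i; rewrite leq_eqVlt => /orP[/eqP E|].
      by case: H; exists i.
    by move=> h; rewrite -ltnS prednK.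
  by rewrite kr -ltnS prednK// ltnn.
pose f : {ffun 'I_d.-1 -> 'I_(2 * r).+1} := [ffun j => inord (absz (k ord0 (lift i j) + r%:Z))].
apply/mapP; exists (i, k ord0 i < 0, f); first by rewrite mem_enum.
apply/rowP => j; rewrite mxE /=; case: unliftP => [j' ->|->].
  rewrite ffunE inordK.
    have := hk (lift i j'); move: (k ord0 _) => a; clear; lia.
  have := hk (lift i j'); move: (k ord0 _) => a; clear; lia.
by move: hi; move: (k ord0 i) => a; clear; case: (ltP a 0) => /= h; lia.
Qed.

Variables (Gam : set (Zd d)) (Th : {fset Zd d}) (r : nat) (x : Zd d).
Hypothesis r0 : (0 < r)%N.

(** From the right: sphere times [Th] for [What], then [1 + 2 d] for the added layer, then [2 d] for
    the outer boundary. *)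
Definition collar_count : nat := (2 * d * ((1 + 2 * d) * (d * 2 * 3 ^ d.-1 * #|` Th|)))%N.

Lemma card_outer_bd_W (F : {fset Zd d}) :
  (forall p, p \in F -> outer_bd (Wset Gam Th r x) p) ->
  (#|` F| <= collar_count * r ^ (3 * (d - 1)))%N.
Proof.
move=> hF.
pose A0 := [seq x + k + t | k <- sphere r, t <- Th].
pose A1 := A0 ++ flatten [seq nbrs q | q <- A0].
pose A2 := flatten [seq nbrs q | q <- A1].
have W0 q : What Gam Th r x q -> q \in A0.
  move=> [_ [b /inner_sphere br bT]]; apply/allpairsP; exists (b - x, q - b); split => //=.
    exact: mem_sphere.
  by rewrite [x + _]addrC subrK [b + _]addrC subrK.
have W1 q : Wset Gam Th r x q -> q \in A1.
  move=> [[/W0 h|/inner_bdP[_ [p qp /contrapT/W0 h]]] _]; rewrite mem_cat; apply/orP.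
    by left.
  right; apply/flattenP; exists (nbrs p); first exact: map_f.
  by apply: mem_nbrs; rewrite adjC.
have FA : {subset F <= A2}.
  move=> p /hF/inner_bdP[_ [q pq /contrapT/W1 h]].
  apply/flattenP; exists (nbrs q); first exact: map_f.
  by apply: mem_nbrs; rewrite adjC.
apply: leq_trans (uniq_leq_size (fset_uniq F) FA) _.
rewrite size_flatten_nbrs size_cat size_flatten_nbrs size_allpairs size_sphere.
have -> : size Th = #|` Th| by [].
(* The sphere has order [r ^ (d - 1)] points; this is enlarged to the power of the radius in the
   smallness condition. *)
have h3 : ((2 * r).+1 ^ d.-1 <= 3 ^ d.-1 * r ^ (3 * (d - 1)))%N.
  apply: (@leq_trans ((3 * r) ^ d.-1)).
    have h : ((2 * r).+1 <= 3 * r)%N by move: r0; clear; lia.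
    by case: (d.-1) => // e; rewrite leq_exp2r.
  rewrite expnMn leq_mul2l; apply/orP; right; rewrite -subn1.
  by apply: leq_pexp2l => //; rewrite leq_pmull.
set e := (d.-1)%N in h3 *; set S := (_ * #|` Th|)%N.
have hS : (S <= d * 2 * 3 ^ e * #|` Th| * r ^ (3 * (d - 1)))%N.
  rewrite [leqRHS]mulnAC leq_mul2r; apply/orP; right.
  by rewrite -[leqRHS]mulnA leq_mul2l h3 orbT.
have -> : (S + 2 * d * S = (1 + 2 * d) * S)%N by rewrite mulnDl mul1n.
by rewrite /collar_count -[leqRHS]mulnA leq_mul2l -[X in (_ <= X)%N]mulnA leq_mul2l hS !orbT.
Qed.

End Counting.

Section PowerSum.
Context {R : realType}.

(** Dividing by [a + b] reduces the claim to [c <= c ^ t] on the unit interval. *)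
Lemma powRD_le (a b t : R) : 0 <= a -> 0 <= b -> 0 < t <= 1 ->
  (a + b) `^ t <= a `^ t + b `^ t.
Proof.
move=> a0 b0 /andP[t0 t1].
have [ab|ab] := eqVneq (a + b) 0.
  by rewrite ab powR0 ?gt_eqF// addr_ge0// powR_ge0.
have abp : 0 < a + b by rewrite lt_def ab addr_ge0.
have key c : 0 <= c -> c <= a + b -> c / (a + b) * (a + b) `^ t <= c `^ t.
  rewrite le_eqVlt => /orP[/eqP<-|c0] cab; first by rewrite !mul0r powR_ge0.
  have {2}-> : c = c / (a + b) * (a + b) by rewrite divfK.
  rewrite powRM ?divr_ge0 ?(ltW c0) ?(ltW abp)// ler_wpM2r ?powR_ge0//.
  by apply: ger1_powR => //; rewrite divr_gt0//= ler_pdivrMr// mul1r.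
apply: le_trans (lerD (key a a0 _) (key b b0 _)); rewrite ?lerDl ?lerDr//.
by rewrite -mulrDl -mulrDl divff// mul1r.
Qed.

Lemma powR_sum_le (I : Type) (s : seq I) (a : I -> R) (t : R) :
  (forall i, 0 <= a i) -> 0 < t <= 1 ->
  (\sum_(i <- s) a i) `^ t <= \sum_(i <- s) (a i) `^ t.
Proof.
move=> a0 t01; have t0 : t != 0 by case/andP: t01 => h _; rewrite gt_eqF.
elim: s => [|i s IH]; first by rewrite !big_nil powR0.
rewrite !big_cons; apply: le_trans (powRD_le _ _ _ (a0 i) _ t01) _.
  by apply: sumr_ge0.
by rewrite lerD2l.
Qed.

Lemma powR_nat_le (n : nat) (t : R) : 0 < t <= 1 -> n%:R `^ t <= n%:R :> R.
Proof.
move=> /andP[t0 t1]; case: n => [|n]; first by rewrite powR0 ?gt_eqF.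
by rewrite ler1_powR// ler1n.
Qed.

End PowerSum.

(** * Exponential decay in finite volume *)

Section FiniteDecay.
Context {R : realType} {d : nat}.
Local Notation C := R[i].
Variables (u : Zd d -> R) (Th : {fset Zd d}).
Hypothesis hTh : forall k, u k != 0 <-> k \in Th.
Hypothesis h0 : (0 : Zd d) \in Th.
Hypothesis A2 : forall k, inner_bd [set k | k \in Th] k -> 0 < u k.
Variables (w U : R).
Hypothesis w0 : 0 < w.
Hypothesis U0 : 0 <= U.
Hypothesis uw : forall t, t \in Th -> w <= `|u t| <= U.

Context {dT : measure_display} {T : measurableType dT} (P : probability T R).
Variables (om : Zd d -> T -> R) (M K : R).
Hypothesis mom : forall k, measurable_fun setT (om k).
Hypothesis indom : mutually_independent P om.
Hypothesis M0 : 0 <= M.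
Hypothesis K0 : 0 <= K.
Hypothesis conc : forall k (c e : R), 0 <= e ->
  (P [set t | (`|om k t - c| <= e)%R] <= (2 * M * e)%:E)%E.
Hypothesis bdom : forall k, P [set t | (K < `|om k t|)%R] = 0%E.

Local Notation n := #|` Th|.
Variables (lam m s : R) (z : C).
Local Notation tau := (s / (2 * n%:R)).
Hypothesis lam0 : 0 < lam.
Hypothesis m0 : 0 < m.
Hypothesis zm : normc z <= m.
Hypothesis z0 : complex.Im z != 0.
Hypothesis s0 : 0 < s.
Hypothesis s1 : s < 1 / 3.

Let n0 : 0 < n%:R :> R.
Proof. by rewrite ltr0n cardfs_gt0; apply/fset0Pn; exists 0. Qed.

Let tau0 : 0 < tau.
Proof. by rewrite divr_gt0// mulr_gt0. Qed.

Let tau1 : 0 < tau <= 1.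
Proof.
rewrite tau0 /= ler_pdivrMr ?mulr_gt0// mul1r.
have n1 : 1 <= n%:R :> R by rewrite ler1n -(ltr0n R).
by have := s1; move: n1; move: (n%:R : R) => a; lra.
Qed.

Let rg (Lam : {fset Zd d}) v x y := normc (rgreen u Th Lam lam z v x y) `^ tau.

Let rg0 Lam v x y : 0 <= rg Lam v x y. Proof. exact: powR_ge0. Qed.

Definition mean_green (Lam : {fset Zd d}) x y : R :=
  fine (\int[P]_t (normc (rgreen u Th Lam lam z (om^~ t) x y) `^ tau)%:E)%E.

Local Notation ap := (step_bound Th w U M K m s 2 ^+ 2 * Xi s lam n).

Lemma apriori_mean (Lam : {fset Zd d}) x y : x \in Lam -> y \in Lam ->
  (\int[P]_t (rg Lam (om^~ t) x y)%:E <= ap%:E)%E.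
Proof.
exact: (apriori u Th hTh h0 A2 w U w0 U0 uw P om M K mom indom M0 K0 conc bdom lam m s z
  lam0 m0 zm z0 s0 s1).
Qed.

Lemma mean_greenE (Lam : {fset Zd d}) x y :
  (\int[P]_t (rg Lam (om^~ t) x y)%:E = (mean_green Lam x y)%:E)%E.
Proof.
rewrite /mean_green fineK// ge0_fin_numE; last by apply: integral_ge0 => t _; rewrite lee_fin powR_ge0.
have [/andP[xL yL]|xy] := boolP ((x \in Lam) && (y \in Lam)).
  by apply: le_lt_trans (apriori_mean _ _ _ xL yL) _; rewrite ltry.
under eq_integral do rewrite /rg /rgreen green_out// normc0 powR0 ?gt_eqF//.
by rewrite integral0.
Qed.

Lemma mean_green_ge0 (Lam : {fset Zd d}) x y : 0 <= mean_green Lam x y.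
Proof. by rewrite -lee_fin -mean_greenE integral_ge0// => t _; rewrite lee_fin powR_ge0. Qed.

Lemma mean_green_sym (Lam : {fset Zd d}) x y : mean_green Lam x y = mean_green Lam y x.
Proof.
pose F (H : T -> C) := fine (\int[P]_t (normc (H t) `^ tau)%:E)%E.
suff E : (fun t => rgreen u Th Lam lam z (om^~ t) x y) = (fun t => rgreen u Th Lam lam z (om^~ t) y x).
  exact: (congr1 F E).
by apply/funext => t; exact: green_sym adjC _ _ _ _.
Qed.

Variables (Gam : set (Zd d)) (r : nat) (b : R).
Hypothesis hr : (diam Th + 2 <= r)%N.
Hypothesis b01 : 0 < b < 1.

(** The constant of the decoupling bound, a factor [2 d] for the bonds at each end of the middle
    factor, and the number of exit sites on the outer side. *)
Definition criterion_const : R :=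
  far_const Th w U M K m s * ((2 * d) ^ 2 * collar_count Th)%:R.

Local Notation pref := (Xi s lam n / lam `^ (s / n%:R)).

Definition collar_mean (Lam : {fset Zd d}) x v p : R :=
  if `[< outer_bd (Wset Gam Th r x) p >] then mean_green (Kset Gam Th r x Lam) v p else 0.

Section OneStep.
Variables (Lam : {fset Zd d}) (x y : Zd d).
Hypothesis LG : forall p, p \in Lam -> Gam p.
Hypothesis xL : x \in Lam.
Hypothesis yL : y \in Lam.
Hypothesis far : (r + diam Th + 2 <= normoo (x - y)%R)%N.

Local Notation W := (Wset Gam Th r x).
Local Notation KK := (Kset Gam Th r x Lam).
Local Notation II := (Iset Gam Th r x Lam).
Local Notation OO := (Oset Gam Th r x Lam).

Let den v (A : {fset Zd d}) : gden adj A (cpot u Th lam z (fun k => (v k)%:C%C)) != 0.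
Proof. exact: real_gden. Qed.

Let G A v p q : C := rgreen u Th A lam z v p q.

Let xI : x \in II.
Proof.
have [ix nW] := center_inside Gam Th r x h0 hr.
by rewrite in_Iset ix andbT; apply/KsetP.
Qed.

Let yO : y \in OO.
Proof.
have [oy nW] := far_outside Gam Th r x h0 y far.
by rewrite in_Oset oy andbT; apply/KsetP.
Qed.

Let I_in p : p \in II -> p \in Lam /\ inside Th r x p.
Proof. by rewrite in_Iset => /andP[/KsetP[]]. Qed.

Let O_in p : p \in OO -> p \in Lam /\ outside Th r x p.
Proof. by rewrite in_Oset => /andP[/KsetP[]]. Qed.

Let I_notO p : inside Th r x p -> p \notin OO.
Proof.
move=> ip; apply/negP => /O_in[_ op].
by have [] := inside_outside_far Th r x h0 p p ip op; rewrite eqxx.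
Qed.

Let O_notI p : outside Th r x p -> p \notin II.
Proof.
move=> op; apply/negP => /I_in[_ ip].
by have [] := inside_outside_far Th r x h0 p p ip op; rewrite eqxx.
Qed.

Let IL : (II `<=` Lam)%fset. Proof. by apply/fsubsetP => p /I_in[]. Qed.
Let OL : (OO `<=` Lam)%fset. Proof. by apply/fsubsetP => p /O_in[]. Qed.

Let hr0 : (0 < r)%N. Proof. by apply: leq_trans hr; rewrite addn2. Qed.

(** Two resolvent expansions, over [Iset] from [x] and, by symmetry, over [Oset] from [y]. Both lose
    their first term: [y] is not in [Iset], and the exit point [p'] is still inside, so not in
    [Oset]. *)
Lemma green_expansion v : G Lam v x y =
  \sum_(p <- II) \sum_(p' <- (Lam `\` II)%fset)
    \sum_(q <- OO) \sum_(q' <- (Lam `\` OO)%fset)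
     (adj p p')%:R * (adj q q')%:R * (G II v x p * G OO v y q * G Lam v q' p').
Proof.
rewrite /G /rgreen (green_restrict adj II Lam _ x y IL (den _ _) (den _ _) xI yL).
rewrite [green adj II _ x y]green_out ?add0r; last first.
  by rewrite negb_and (O_notI y) ?orbT//; case: (O_in _ yO).
rewrite big_seq [RHS]big_seq; apply: eq_bigr => p pI.
rewrite big_seq [RHS]big_seq; apply: eq_bigr => p' pL'.
have [a0|a0] := eqVneq (adj p p') 0%N.
  by rewrite a0 mulr0 mul0r big1// => q _; rewrite big1// => q' _; rewrite !mul0r.
have [_ ip'] := Iset_exit Gam Th r x Lam hr LG p p' pI pL' a0.
have pL'' : p' \in Lam by move: pL'; rewrite in_fsetD => /andP[].
rewrite (green_sym adj adjC Lam _ p' y) (green_restrict adj OO Lam _ y p' OL (den _ _) (den _ _) yO pL'').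
rewrite [green adj OO _ y p']green_out ?add0r; last by rewrite negb_and (I_notO p' ip') orbT.
rewrite mulr_sumr; apply: eq_bigr => q _; rewrite mulr_sumr; apply: eq_bigr => q' _.
by ring.
Qed.

Lemma rg_expansion v : rg Lam v x y <=
  \sum_(p <- II) \sum_(p' <- (Lam `\` II)%fset)
    \sum_(q <- OO) \sum_(q' <- (Lam `\` OO)%fset)
     (adj p p')%:R * (adj q q')%:R * (rg II v x p * rg OO v y q * rg Lam v q' p').
Proof.
have t0 : 0 <= tau by exact: ltW.
have mono (A : {fset Zd d}) (F : Zd d -> C) :
    normc (\sum_(p <- A) F p) `^ tau <= \sum_(p <- A) normc (F p) `^ tau.
  apply: (@le_trans _ _ ((\sum_(p <- A) normc (F p)) `^ tau)).
    apply: ge0_ler_powR; rewrite ?nnegrE ?normc_ge0//; last exact: ler_normc_sum.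
    by apply: sumr_ge0 => p _; exact: normc_ge0.
  by apply: powR_sum_le => // p; exact: normc_ge0.
rewrite /rg -/(G Lam v x y) green_expansion.
apply: le_trans (mono _ _) _; apply: ler_sum => p _.
apply: le_trans (mono _ _) _; apply: ler_sum => p' _.
apply: le_trans (mono _ _) _; apply: ler_sum => q _.
apply: le_trans (mono _ _) _; apply: ler_sum => q' _.
have nat_norm (k : nat) : normc (k%:R : C) = k%:R.
  by rewrite -(rmorph_nat (real_complex R)) normc_real ger0_norm.
rewrite !normcM !nat_norm !powRM ?mulr_ge0 ?normc_ge0//.
rewrite ler_wpM2r ?mulr_ge0 ?powR_ge0//.
by apply: ler_pM; rewrite ?powR_ge0//; exact: powR_nat_le.
Qed.

Let local_green (A : {fset Zd d}) (B : set (Zd d)) v v' p q :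
  (forall p', p' \in A -> forall t, t \in Th -> B (p' - t)) ->
  (forall k, B k -> v k = v' k) -> rg A v p q = rg A v' p q.
Proof.
move=> hA hv; rewrite /rg; suff -> : rgreen u Th A lam z v p q = rgreen u Th A lam z v' p q by [].
apply: green_ext => p' pA.
rewrite /cpot; congr (_ * _ - _); apply: eq_big_seq => t tT.
by rewrite hv//; exact: hA.
Qed.

Let mrg (A : {fset Zd d}) p q :
  forall (dS : measure_display) (S : measurableType dS) (Z : Zd d -> S -> R),
    (forall k, measurable_fun setT (Z k)) -> measurable_fun setT (fun s => rg A (Z^~ s) p q).
Proof. by move=> dS S Z mZ; apply: measurable_rgreen => //; rewrite gt_eqF. Qed.

Lemma inside_outside_indep p q :
  (\int[P]_t (rg II (om^~ t) x p * rg OO (om^~ t) y q)%:E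
   = (mean_green II x p * mean_green OO y q)%:E)%E.
Proof.
apply: etrans (integral_indep_regions P om mom indom [set k | (normoo (k - x)%R < r)%N]
  (fun v => rg II v x p) (fun v => rg OO v y q) _ _ _ _ _ _) _.
- by move=> v; exact: rg0.
- by move=> v; exact: rg0.
- exact: mrg.
- exact: mrg.
- move=> v v'; apply: local_green => p' /I_in[_ /insideP h] t tT; exact: h.
- move=> v v'; apply: local_green => p' /O_in[_ /outsideP h] t tT /=.
  by apply/negP; rewrite -leqNgt ltnW// h.
- by rewrite !mean_greenE EFinM.
Qed.

Let mean_ext (A B : {fset Zd d}) p q :
  (forall v, rgreen u Th A lam z v p q = rgreen u Th B lam z v p q) ->
  mean_green A p q = mean_green B p q.
Proof.
move=> E; pose F (H : T -> C) := fine (\int[P]_t (normc (H t) `^ tau)%:E)%E.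
by apply: (congr1 F (x := fun t => rgreen u Th A lam z (om^~ t) p q)); apply/funext => t.
Qed.

(** The expansion produces Green functions of [Iset] for the sake of independence, while the
    smallness condition speaks of [Kset]; no bond of [Kset] leaves [Iset]. *)
Let mean_I p : p \in II -> mean_green II x p = mean_green KK x p.
Proof.
move=> pI; apply: mean_ext => v; rewrite /rgreen.
apply/esym/green_component => //; first exact: Iset_sub.
- exact: (fsubsetP (Iset_sub _ _ _ _ _)).
- move=> p1 p2; exact: Iset_sep.
Qed.

Let mean_O p : p \in OO -> mean_green OO y p = mean_green KK y p.
Proof.
move=> pI; apply: mean_ext => v; rewrite /rgreen.
apply/esym/green_component => //; first exact: Oset_sub.
- exact: (fsubsetP (Oset_sub _ _ _ _ _)).
- move=> p1 p2; exact: Oset_sep.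
Qed.

Local Notation e1 := (collar_mean Lam x x).
Local Notation e2 := (collar_mean Lam x y).
Let e10 p : 0 <= e1 p. Proof. by rewrite /collar_mean; case: ifP => _ //; exact: mean_green_ge0. Qed.
Let e20 p : 0 <= e2 p. Proof. by rewrite /collar_mean; case: ifP => _ //; exact: mean_green_ge0. Qed.

Local Notation Cm := (far_const Th w U M K m s * pref).

Let Cm0 : 0 <= Cm.
Proof.
apply: mulr_ge0; last by rewrite divr_ge0 ?powR_ge0// le_max powR_ge0.
rewrite /far_const; apply: mulr_ge0; last by rewrite le_max ler01.
by rewrite exprn_ge0// le_max ler01.
Qed.

(** The outer factors form the weight of the decoupling bound for the middle one; only after that
    does independence split the mean of the weight. *)
Let term_bound p p' q q' : p \in II -> p' \in (Lam `\` II)%fset ->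
  q \in OO -> q' \in (Lam `\` OO)%fset ->
  (\int[P]_t ((adj p p')%:R * (adj q q')%:R *
     (rg II (om^~ t) x p * rg OO (om^~ t) y q * rg Lam (om^~ t) q' p'))%:E <=
   (Cm * ((adj p p')%:R * e1 p) * ((adj q q')%:R * e2 q))%:E)%E.
Proof.
move=> pI pI' qO qO'.
have [a0|a0] := eqVneq (adj p p') 0%N.
  under eq_integral do rewrite a0 !mul0r.
  by rewrite integral0 a0 !mul0r mulr0 mul0r.
have [b0|b0] := eqVneq (adj q q') 0%N.
  under eq_integral do rewrite b0 mulr0 mul0r.
  by rewrite integral0 b0 !mul0r mulr0.
have [obp ip'] := Iset_exit Gam Th r x Lam hr LG p p' pI pI' a0.
have [obq oq'] := Oset_exit Gam Th r x Lam hr LG q q' qO qO' b0.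
have [ne na] := inside_outside_far Th r x h0 p' q' ip' oq'.
have pL : p' \in Lam by move: pI'; rewrite in_fsetD => /andP[].
have qL : q' \in Lam by move: qO'; rewrite in_fsetD => /andP[].
rewrite eq_sym in ne; rewrite adjC in na.
have rw := rational_weight_green u Th hTh lam tau z II OO x p y q tau0 z0.
have := weighted_bound u Th hTh h0 A2 w U w0 U0 uw P om M K mom indom M0 K0 conc bdom lam m s z
  lam0 m0 zm z0 s0 s1 _ Lam q' p' rw qL pL ne na.
rewrite inside_outside_indep (mean_I p pI) (mean_O q qO) => h.
under eq_integral do rewrite EFinM.
rewrite ge0_integralZl//; last 2 first.
- apply/measurable_EFinP; apply: measurable_funM; last exact: mrg.
  by apply: measurable_funM; exact: mrg.
- by move=> t _; rewrite lee_fin mulr_ge0// mulr_ge0.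
apply: (@le_trans _ _ (((adj p p')%:R * (adj q q')%:R)%:E *
   (Cm%:E * (mean_green KK x p * mean_green KK y q)%:E))%E).
  by apply: lee_wpmul2l; rewrite ?lee_fin ?mulr_ge0.
have alg (a1 a2 f f1 f2 : R) : a1 * a2 * (f * (f1 * f2)) = f * (a1 * f1) * (a2 * f2) by ring.
by rewrite -!EFinM lee_fin /collar_mean (asboolT obp) (asboolT obq) alg.
Qed.

(** The smallness condition sums the factors starting at [x], while [beta] bounds those ending at
    [y]. The latter live in [Kset] rather than [Lam], so iterating requires bounds for all
    volumes. *)
Lemma mean_green_step (beta : R) :
  0 <= beta ->
  criterion_const * r%:R ^+ (3 * (d - 1)) * pref * \sum_(p <- II) e1 p <= b ->
  (forall q, q \in KK -> (normoo (x - q)%R <= r + diam Th + 2)%N -> mean_green KK q y <= beta) ->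
  mean_green Lam x y <= b * beta.
Proof.
move=> beta0 crit hbeta.
pose P1 := [seq (p, p') | p <- II, p' <- (Lam `\` II)%fset].
pose P2 := [seq (q, q') | q <- OO, q' <- (Lam `\` OO)%fset].
pose S := [seq (c1, c2) | c1 <- P1, c2 <- P2].
pose F (c : (Zd d * Zd d) * (Zd d * Zd d)) v :=
  (adj c.1.1 c.1.2)%:R * (adj c.2.1 c.2.2)%:R *
    (rg II v x c.1.1 * rg OO v y c.2.1 * rg Lam v c.2.2 c.1.2).
have F0 c v : 0 <= F c v by rewrite !mulr_ge0.
have mF c : measurable_fun setT (fun t => F c (om^~ t)).
  apply: measurable_funM => //; apply: measurable_funM; last exact: mrg.
  by apply: measurable_funM; exact: mrg.
have sumS (H : (Zd d * Zd d) * (Zd d * Zd d) -> R) : \sum_(c <- S) H c =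
    \sum_(p <- II) \sum_(p' <- (Lam `\` II)%fset) \sum_(q <- OO) \sum_(q' <- (Lam `\` OO)%fset)
      H ((p, p'), (q, q')).
  rewrite big_allpairs big_allpairs; apply: eq_bigr => p _; apply: eq_bigr => p' _.
  by rewrite big_allpairs.
have step1 : mean_green Lam x y <=
    \sum_(c <- S) (Cm * ((adj c.1.1 c.1.2)%:R * e1 c.1.1) * ((adj c.2.1 c.2.2)%:R * e2 c.2.1)).
  rewrite -lee_fin -mean_greenE.
  have h1 : (\int[P]_t (rg Lam (om^~ t) x y)%:E <= \int[P]_t \sum_(c <- S) (F c (om^~ t))%:E)%E.
    apply: le_lower_integral => t; first by rewrite lee_fin.
    by rewrite sumEFin lee_fin sumS; exact: rg_expansion.
  apply: le_trans h1 _.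
  rewrite ge0_integral_sum//; last 2 first.
  - by move=> c; exact/measurable_EFinP.
  - by move=> c t _; rewrite lee_fin.
  rewrite -sumEFin big_seq [leRHS]big_seq; apply: lee_sum => -[[p p'] [q q']].
  move=> /allpairsP[[c1 c2] /= [/allpairsP[[p1 p2] /= [h1 h2 ->]] /allpairsP[[q1 q2] /= [h3 h4 ->]] E]].
  by case: E => -> -> -> ->; exact: term_bound.
apply: le_trans step1 _; rewrite sumS /=.
have deg_sum (A B : {fset Zd d}) (e : Zd d -> R) : (forall p, 0 <= e p) ->
    \sum_(p <- A) \sum_(p' <- B) (adj p p')%:R * e p <= (2 * d)%:R * \sum_(p <- A) e p.
  move=> e0; rewrite mulr_sumr; apply: ler_sum => p _.
  by rewrite -mulr_suml ler_wpM2r// -natr_sum ler_nat adj_degree.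
have -> : \sum_(p <- II) \sum_(p' <- (Lam `\` II)%fset) \sum_(q <- OO) \sum_(q' <- (Lam `\` OO)%fset)
     Cm * ((adj p p')%:R * e1 p) * ((adj q q')%:R * e2 q) =
   Cm * (\sum_(p <- II) \sum_(p' <- (Lam `\` II)%fset) (adj p p')%:R * e1 p) *
     (\sum_(q <- OO) \sum_(q' <- (Lam `\` OO)%fset) (adj q q')%:R * e2 q).
  transitivity (\sum_(p <- II) \sum_(p' <- (Lam `\` II)%fset) Cm * ((adj p p')%:R * e1 p) *
      (\sum_(q <- OO) \sum_(q' <- (Lam `\` OO)%fset) (adj q q')%:R * e2 q)).
    apply: eq_bigr => p _; apply: eq_bigr => p' _.
    by rewrite mulr_sumr; apply: eq_bigr => q _; rewrite mulr_sumr.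
  move: (\sum_(q <- OO) _) => B; rewrite -mulrA mulr_suml mulr_sumr; apply: eq_bigr => p _.
  by rewrite mulr_suml mulr_sumr; apply: eq_bigr => p' _; rewrite -mulrA.
(* On the outer side no smallness is available: the exit sites are counted, and [r ^ (3 (d - 1))] is
   absorbed by the prefactor of the condition. *)
have count : \sum_(q <- OO) e2 q <= (collar_count Th * r ^ (3 * (d - 1)))%:R * beta.
  pose OB := [fset q in OO | `[< outer_bd W q >]]%fset.
  have hOB q : q \in OB -> outer_bd W q by rewrite !inE => /andP[_ /asboolP].
  have := card_outer_bd_W Gam Th r x hr0 OB hOB; rewrite -(ler_nat R) => cnt.
  apply: (@le_trans _ _ (\sum_(q <- OB) beta)); last first.
    rewrite big_const_seq count_predT iter_addr addr0 -[leLHS]mulr_natl.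
    by rewrite ler_wpM2r.
  have -> : \sum_(q <- OO) e2 q = \sum_(q <- OB) e2 q.
    rewrite /OB -[RHS]big_fset_condE [RHS]big_mkcond /=; apply: eq_bigr => q _.
    by rewrite /collar_mean; case: ifP.
  rewrite big_seq [leRHS]big_seq; apply: ler_sum => q qB.
  have qO : q \in OO by move: qB; rewrite !inE => /andP[].
  have oq := hOB q qB.
  rewrite /collar_mean asboolT// mean_green_sym; apply: hbeta.
    exact: (fsubsetP (Oset_sub _ _ _ _ _)).
  exact: outer_bd_W_normoo oq.
have nn (A B : {fset Zd d}) (e : Zd d -> R) : (forall p, 0 <= e p) ->
    0 <= \sum_(p <- A) \sum_(p' <- B) (adj p p')%:R * e p.
  by move=> e0; apply: sumr_ge0 => p _; apply: sumr_ge0 => p' _; rewrite mulr_ge0.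
apply: (@le_trans _ _ (Cm * ((2 * d)%:R * \sum_(p <- II) e1 p) *
   ((2 * d)%:R * ((collar_count Th * r ^ (3 * (d - 1)))%:R * beta)))).
  apply: ler_pM.
  - by apply: mulr_ge0 => //; exact: nn.
  - exact: nn.
  - by apply: ler_wpM2l => //; exact: deg_sum.
  - by apply: le_trans (deg_sum _ _ _ e20) _; apply: ler_wpM2l.
have alg (f g n1 n2 n3 e be : R) :
    f * g * (n1 * e) * (n1 * (n2 * n3 * be)) = f * (n1 * n1 * n2) * n3 * g * e * be by ring.
apply: le_trans (ler_wpM2r beta0 crit).
rewrite /criterion_const (natrM _ (collar_count Th)) natrX alg.
by rewrite -mulnn (natrM _ (2 * d * (2 * d)) (collar_count Th)) (natrM _ (2 * d) (2 * d)).
Qed.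

End OneStep.
Hypothesis crit : forall (Lam : {fset Zd d}) x, (forall p, p \in Lam -> Gam p) -> x \in Lam ->
  criterion_const * r%:R ^+ (3 * (d - 1)) * pref *
    \sum_(p <- Iset Gam Th r x Lam) collar_mean Lam x x p <= b.

Let ap0 : 0 <= ap.
Proof. by apply: mulr_ge0; [exact: sqr_ge0 | rewrite le_max powR_ge0]. Qed.

(** Each step uses up at most [r + diam Th + 2] of the distance and shrinks the volume to [Kset], so
    the induction ranges over all finite volumes in [Gam]. *)
Lemma mean_green_geometric j (Lam : {fset Zd d}) x y :
  (forall p, p \in Lam -> Gam p) -> x \in Lam -> y \in Lam ->
  (j * (r + diam Th + 2) <= normoo (x - y)%R)%N -> mean_green Lam x y <= ap * b ^+ j.
Proof.
elim: j Lam x y => [|j IH] Lam x y LG xL yL hj.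
  by rewrite (expr0 b) mulr1 -lee_fin -mean_greenE; exact: apriori_mean.
have bj0 : 0 <= ap * b ^+ j by rewrite mulr_ge0// exprn_ge0// ltW//; case/andP: b01.
rewrite (exprS b j) mulrCA; apply: (mean_green_step Lam x y LG xL yL) => //.
- by apply: leq_trans hj; rewrite mulSn leq_addr.
- exact: crit.
- move=> q qK xq; apply: IH => //.
  + by move=> p /KsetP[/LG].
  + have far : (r + diam Th + 2 <= normoo (x - y)%R)%N.
      by apply: leq_trans hj; rewrite mulSn leq_addr.
    by have [_ nW] := far_outside Gam Th r x h0 y far; apply/KsetP.
  + have := normooD (x - q) (q - y); rewrite addrA subrK => tri.
    rewrite -(leq_add2l (r + diam Th + 2)) -mulSn.
    by apply: leq_trans hj _; apply: leq_trans tri _; rewrite leq_add2r.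
Qed.

(** The number of steps is the integer part of the distance over the step length; rounding loses at
    most one factor [b], whence [ap / b]. *)
Lemma mean_green_decay (Lam : {fset Zd d}) x y :
  (forall p, p \in Lam -> Gam p) -> x \in Lam -> y \in Lam ->
  mean_green Lam x y <= ap / b *
    expR (- (`|ln b| / (r%:R + (diam Th)%:R + 2) * (normoo (x - y)%R)%:R)).
Proof.
move=> LG xL yL; have /andP[b0 b1] := b01.
set D := (r + diam Th + 2)%N; set N := normoo (x - y)%R.
have D0 : (0 < D)%N by rewrite /D addn2.
have := @mean_green_geometric (N %/ D) Lam x y LG xL yL (leq_divM _ _).
move=> /le_trans; apply; rewrite -[leRHS]mulrA; apply: ler_wpM2l => //.
have lnb : ln b < 0 by rewrite ln_lt0// b0.
rewrite -powR_mulrn ?(ltW b0)// /powR gt_eqF// -[b^-1](lnK _) ?posrE ?invr_gt0// lnV ?posrE//.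
rewrite -expRD ler_expR ler0_norm ?(ltW lnb)//.
have -> : r%:R + (diam Th)%:R + 2 = D%:R :> R by rewrite /D !natrD.
have h : N%:R / D%:R <= (N %/ D)%:R + 1 :> R.
  by rewrite ler_pdivrMr ?ltr0n// natr1 -natrM ler_nat ltnW// ltn_ceil.
rewrite !mulNr opprK -(mulrA (ln b)) [D%:R^-1 * _]mulrC; move: h; move: (N%:R / D%:R) (N %/ D)%:R (ln b) lnb => X Y l l0 h.
nra.
Qed.

End FiniteDecay.

(** * Infinite volume *)

Section GreenOperator.
Context {R : realType} {d : nat}.
Local Notation C := R[i].
Variables (u : Zd d -> R) (Th : {fset Zd d}) (lam : R) (om : Zd d -> R) (z : C).
Hypothesis z0 : complex.Im z != 0.

Definition site_pot : Zd d -> C := cpot u Th lam z (fun k => (om k)%:C%C).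
Local Notation c := site_pot.

Lemma rgreenE Lam x y : rgreen u Th Lam lam z om x y = green adj Lam c x y.
Proof. by []. Qed.

Lemma gden_site_pot Lam : gden adj Lam c != 0.
Proof. exact: real_gden. Qed.

Lemma cpot_real x : c x = (lam * Vpot u Th om x)%:C%C - z.
Proof.
rewrite /site_pot /cpot rmorphM rmorph_sum; congr (_ * _ - _).
by apply: eq_bigr => t _; rewrite rmorphM.
Qed.

Lemma hop_col (Lam : {fset Zd d}) Gam y g p :
  resolvent_col u Th lam om Gam z y g -> Gam p ->
  (forall q, adj p q != 0%N -> q \notin Lam -> g q = 0) ->
  hop adj Lam c g p = (p == y)%:R.
Proof.
move=> [_ _ geq] Gp nb; pose g' q := if q \in Lam then g q else 0.
rewrite /hop; have -> : \sum_(q <- Lam) (adj p q)%:R * g q =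
    \sum_(i < d) (g (p + unitv i) + g (p - unitv i)).
  transitivity (\sum_(q <- Lam) (adj p q)%:R * g' q).
    by rewrite big_seq [RHS]big_seq; apply: eq_bigr => q qL; rewrite /g' qL.
  rewrite sum_adj => [|q /negPf qL]; last by rewrite /g' qL.
  have E q : adj p q != 0%N -> g' q = g q.
    by move=> a0; rewrite /g'; case: ifPn => // qL; rewrite nb.
  by apply: eq_bigr => i _; have [h1 h2] := adj_unitv p i; rewrite !E.
rewrite cpot_real mulrBl addrA geq//; by case: eqP.
Qed.

(** In a finite volume the left inverse gives uniqueness of the column and the right inverse its
    existence, so the chosen solution is the matrix one. *)
Lemma green_finite (Lam : {fset Zd d}) x y :
  Green u Th lam om [set` Lam] z x y = rgreen u Th Lam lam z om x y.
Proof.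
have den := gden_site_pot Lam.
have colE g p : resolvent_col u Th lam om [set` Lam] z y g -> p \in Lam -> y \in Lam ->
    g p = rgreen u Th Lam lam z om p y.
  move=> col pL yL; have [g0 _ _] := col.
  rewrite (green_repr adj Lam c g p den _ pL); last first.
    by move=> q /negP qL; rewrite g0.
  rewrite (bigD1_seq y) ?fset_uniq//= (hop_col Lam [set` Lam] y g y col)// ?eqxx ?mulr1; last first.
    by move=> q _ /negP qL; rewrite g0.
  rewrite big_seq_cond big1 ?addr0// => q /andP[qL qy].
  rewrite (hop_col Lam [set` Lam] y g q col)// ?(negPf qy) ?mulr0//.
  by move=> q' _ /negP qL'; rewrite g0.
rewrite /Green; case: pselect => [e|ne].
  move: (cid _) => [g /= col]; have [yL _] := e.
  have [xL|xL] := boolP (x \in Lam); first exact: colE.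
  by have [g0 _ _] := col; rewrite g0 ?rgreenE ?green_out ?negb_and ?xL//; exact/negP.
have [yL|yL] := boolP (y \in Lam); last by rewrite rgreenE green_out// negb_and yL orbT.
case: ne; split => //; exists (fun p => rgreen u Th Lam lam z om p y).
have out p : p \notin Lam -> rgreen u Th Lam lam z om p y = 0.
  by move=> pL; rewrite rgreenE green_out// negb_and pL.
split=> [p /negP|| p /= pL]; first exact: out.
  rewrite (_ : esum _ _ = (\esum_(p in [set` Lam])
      (normc (rgreen u Th Lam lam z om p y) ^+ 2)%:E)%E); last first.
    rewrite [RHS]esum_mkcond; apply: eq_esum => p _; case: ifPn => // /negP pL.
    rewrite out ?normc0 ?expr0n//; apply/negP => pL'; apply: pL; exact: mem_set.
  rewrite esum_fset//; last by move=> p _; rewrite lee_fin sqr_ge0.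
  by rewrite -fsbig_seq ?fset_uniq// sumEFin ltry.
have := green_solves adj Lam c p y den pL yL; rewrite /hop sum_adj => [h|q qL].
  rewrite -[RHS]/(if p == y then 1 else 0); transitivity ((p == y)%:R : C); last by case: eqP.
  by rewrite -h cpot_real mulrBl addrA.
by have := out q qL.
Qed.

Lemma real_energy (Lam : {fset Zd d}) (h : Zd d -> C) :
  `|complex.Im z| * \sum_(p <- Lam) normc (h p) ^+ 2 <=
  \sum_(p <- Lam) normc (h p) * normc (hop adj Lam c h p).
Proof.
pose sg : R := if 0 < complex.Im z then -1 else 1.
have := energy adj adjC (2 * d) Lam c pred0 pred0 sg ((2 * d)%:R + 1) `|complex.Im z|.
rewrite mulr_sumr; apply => //.
- by move=> x _; exact: adj_degree.
- by rewrite /sg; case: ifP => _; rewrite ?normrN normr1.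
- move=> x _ _; rewrite expr0 mulr1 /site_pot Im_cpot_real.
  rewrite /sg; case: ltP => h0; first by rewrite mulN1r opprK ger0_norm// ltW.
  by rewrite mul1r ler0_norm.
Qed.

(** The difference of the two columns solves the equation in [Lam] with a source carried by the
    bonds that leave [Lam]; [Lam'] contains the far ends of these bonds where [g] may be nonzero.
    The energy estimate with weight [|Im z|] then bounds the difference. *)
Lemma truncation_error (Lam Lam' : {fset Zd d}) Gam x y g :
  resolvent_col u Th lam om Gam z y g ->
  (Lam `<=` Lam')%fset -> (forall p, p \in Lam -> Gam p) ->
  (forall p q, p \in Lam -> adj p q != 0%N -> q \notin Lam' -> g q = 0) ->
  x \in Lam -> y \in Lam ->
  (complex.Im z) ^+ 2 * normc (g x - rgreen u Th Lam lam z om x y) ^+ 2 <=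
  (2 * d).+1%:R ^+ 2 * \sum_(q <- (Lam' `\` Lam)%fset) normc (g q) ^+ 2.
Proof.
move=> col sub LG nb xL yL; set D := (Lam' `\` Lam)%fset.
have den := gden_site_pot Lam.
pose e p := g p - green adj Lam c p y.
have split_sum (f : Zd d -> C) : \sum_(q <- Lam') f q = \sum_(q <- Lam) f q + \sum_(q <- D) f q.
  by rewrite (big_fsetID _ (mem Lam)) /=; congr (_ + _); apply: eq_fbigl => q;
    rewrite !inE /= andbC //; have [/(fsubsetP sub) ->|] := boolP (q \in Lam).
have alg (A B S X Y : C) : - (A + S) + X = - B + Y -> - (A - B) + (X - Y) = S.
  move=> h; have -> : - (A - B) + (X - Y) = - (A + S) + X - (- B + Y) + S by ring.
  by rewrite h subrr add0r.
have hope p : p \in Lam -> hop adj Lam c e p = \sum_(q <- D) (adj p q)%:R * g q.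
  move=> pL; have := hop_col Lam' Gam y g p col (LG p pL) (fun q => nb p q pL).
  have := green_solves adj Lam c p y den pL yL.
  rewrite /hop split_sum => <-.
  under [X in _ -> - X + _ = _]eq_bigr do rewrite mulrBr.
  rewrite sumrB mulrBr => h; apply: alg; exact: h.
(* [2 d + 1] in place of the degree [2 d] keeps [N] positive in every dimension. *)
set N : R := (2 * d).+1%:R; set eta := `|complex.Im z|.
set E := \sum_(p <- Lam) normc (e p) ^+ 2; set S := \sum_(q <- D) normc (g q) ^+ 2.
have N0 : 0 < N by rewrite ltr0n.
have eta0 : 0 <= eta by exact: normr_ge0.
have E1 : normc (e x) ^+ 2 <= E.
  by rewrite /E (bigD1_seq x) ?fset_uniq//= lerDl sumr_ge0// => q _; rewrite sqr_ge0.
have nat_norm (k : nat) : normc (k%:R : C) = k%:R.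
  by rewrite -(rmorph_nat (real_complex R)) normc_real ger0_norm.
have degN (A : {fset Zd d}) p : \sum_(q <- A) (adj p q)%:R <= N.
  by rewrite -natr_sum ler_nat; apply: leqW; exact: adj_degree.
(* [N] and [eta] are balanced so that the terms in [e] amount to at most half of the left-hand side
   and can be absorbed. *)
have amgm (k l a b : R) : 2 * k * l * a * b <= l ^+ 2 * a ^+ 2 + k ^+ 2 * b ^+ 2.
  by rewrite -subr_ge0 (_ : _ - _ = (l * a - k * b) ^+ 2) ?sqr_ge0//; ring.
have T1 : 2 * N * eta * (eta * E) <= \sum_(p <- Lam) \sum_(q <- D)
    (adj p q)%:R * (eta ^+ 2 * normc (e p) ^+ 2 + N ^+ 2 * normc (g q) ^+ 2).
  have h0 : 0 <= 2 * N * eta by rewrite mulr_ge0// mulr_ge0// ltW.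
  apply: le_trans (ler_wpM2l h0 (real_energy Lam e)) _.
  rewrite mulr_sumr big_seq [leRHS]big_seq; apply: ler_sum => p pL.
  rewrite hope// mulrA.
  have h1 : 0 <= 2 * N * eta * normc (e p) by rewrite mulr_ge0// normc_ge0.
  apply: le_trans (ler_wpM2l h1 (ler_normc_sum _ _ _)) _.
  rewrite mulr_sumr; apply: ler_sum => q _; rewrite normcM nat_norm mulrCA.
  by apply: ler_wpM2l => //; exact: amgm.
have T2 : \sum_(p <- Lam) \sum_(q <- D)
    (adj p q)%:R * (eta ^+ 2 * normc (e p) ^+ 2 + N ^+ 2 * normc (g q) ^+ 2) <=
    N * (eta ^+ 2 * E) + N * (N ^+ 2 * S).
  under eq_bigr do under eq_bigr do rewrite mulrDr.
  under eq_bigr do rewrite big_split /=.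
  rewrite big_split /=; apply: lerD.
    rewrite /E !mulr_sumr; apply: ler_sum => p _; rewrite -mulr_suml.
    by rewrite ler_wpM2r// mulr_ge0// sqr_ge0.
  rewrite exchange_big /= /S !mulr_sumr; apply: ler_sum => q _; rewrite -mulr_suml.
  apply: ler_wpM2r; first by apply: mulr_ge0; exact: sqr_ge0.
  by under eq_bigr do rewrite adjC; exact: degN.
have T3 : N * (eta ^+ 2 * E) <= N * (N ^+ 2 * S).
  have dbl (k l E' : R) : 2 * k * l * (l * E') = k * (l ^+ 2 * E') + k * (l ^+ 2 * E') by ring.
  by have := le_trans T1 T2; rewrite dbl lerD2l.
rewrite -(ler_pM2l N0); apply: le_trans T3.
rewrite -(real_normK (num_real (complex.Im z))) -/eta; apply: ler_wpM2l; first exact: ltW.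
by apply: ler_wpM2l => //; exact: sqr_ge0.
Qed.

End GreenOperator.

Section Exhaustion.
Context {R : realType}.

Lemma esum_tail {T : choiceType} (f : T -> R) (e : R) : (forall t, 0 <= f t) -> 0 < e ->
  (\esum_(t in [set: T]) (f t)%:E < +oo)%E ->
  exists A : {fset T}, forall F : {fset T}, (forall t, t \in F -> t \notin A) ->
    \sum_(t <- F) f t <= e.
Proof.
move=> f0 e0 fin; set S := (\esum_(t in [set: T]) (f t)%:E)%E in fin.
have S0 : (0 <= S)%E by apply: esum_ge0 => t _; rewrite lee_fin.
have Sf : S \is a fin_num by rewrite ge0_fin_numE.
have fsumE (A : {fset T}) : (\sum_(t \in [set` A]) (f t)%:E = (\sum_(t <- A) f t)%:E)%E.
  by rewrite -fsbig_seq ?fset_uniq// sumEFin.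
have [_ [B [finB _] <-] hB] := ub_ereal_sup_adherent e0 Sf.
exists (fset_set B) => F dis.
have : ((\sum_(t <- (fset_set B `|` F)%fset) f t)%:E <= S)%E.
  by apply: esum_ge; exists [set` (fset_set B `|` F)%fset]; rewrite ?fsumE.
have : (S - e%:E < \sum_(t \in B) (f t)%:E)%E by exact: hB.
rewrite (fsbig_finite _ _ finB)/= sumEFin -(fineK Sf) -EFinB lte_fin lee_fin.
have -> : \sum_(t <- (fset_set B `|` F)%fset) f t = \sum_(t <- fset_set B) f t + \sum_(t <- F) f t.
  rewrite (big_fsetID _ (mem (fset_set B))) /=; congr (_ + _); apply: eq_fbigl => t.
    by rewrite !inE /=; case: (t \in fset_set B); rewrite ?andbF.
  rewrite !inE /=; have [tF|tF] := boolP (t \in F); first by rewrite (dis t tF) orbT.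
  by rewrite orbF andbN.
by move: (\sum_(t <- F) _) (\sum_(t <- fset_set B) _) (fine _) => a b' s'; lra.
Qed.

Definition initial_part {T : countType} (A : set T) (n : nat) : {fset T} :=
  [fset p in pmap choice.unpickle (iota 0 n) | `[< A p >]]%fset.

Lemma mem_initial_part {T : countType} (A : set T) n p :
  p \in initial_part A n -> A p.
Proof. by rewrite !inE /= => /andP[_ /asboolP]. Qed.

Lemma initial_part_mem {T : countType} (A : set T) n p :
  A p -> (choice.pickle p < n)%N -> p \in initial_part A n.
Proof.
move=> Ap pn; rewrite !inE /=; apply/andP; split; last exact/asboolP.
rewrite mem_pmap; apply/mapP; exists (choice.pickle p); last by rewrite choice.pickleK.
by rewrite mem_iota.
Qed.

End Exhaustion.

Section Truncation.
Context {R : realType} {d : nat}.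
Local Notation C := R[i].
Variables (u : Zd d -> R) (Th : {fset Zd d}) (lam : R) (om : Zd d -> R) (z : C) (Gam : set (Zd d)).
Hypothesis z0 : complex.Im z != 0.
Variables (tau : R) (x y : Zd d).
Hypothesis tau01 : 0 < tau <= 1.
Hypothesis Gx : Gam x.

Local Notation trunc n := (normc (rgreen u Th (initial_part Gam n) lam z om x y) `^ tau).

(** The truncation error is controlled by the square sum of [g] off the volume, a tail of a
    convergent sum, and subadditivity of the power [tau] carries the convergence over to the
    moments. *)
Lemma truncated_green_cvg g : resolvent_col u Th lam om Gam z y g -> Gam y ->
  trunc n @[n --> \oo] --> normc (g x) `^ tau.
Proof.
move=> col Gy; have /andP[t0 t1] := tau01; have [g0 gfin _] := col.
apply/cvgrPdist_le => e e0; pose dl := e `^ tau^-1.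
have dl0 : 0 < dl by exact: powR_gt0.
pose N : R := (2 * d).+1%:R; have N0 : 0 < N by rewrite ltr0n.
have iz0 : 0 < complex.Im z ^+ 2 by rewrite exprn_even_gt0.
have eps0 : 0 < complex.Im z ^+ 2 * dl ^+ 2 / N ^+ 2.
  by rewrite divr_gt0 ?exprn_gt0// mulr_gt0// exprn_gt0.
have [A hA] := esum_tail (fun p => normc (g p) ^+ 2) _ (fun p => sqr_ge0 _) eps0 gfin.
(* Beyond this index the volume contains [x], [y] and all sites of [A] in [Gam], so the surrounding
   layer avoids [A] and its square sum is small. *)
pose M := (\sum_(p <- A) choice.pickle p + choice.pickle x + choice.pickle y).+1.
exists M => // n /= Mn.
have inn p : p \in A -> (choice.pickle p < n)%N.
  move=> pA; apply: leq_trans Mn; rewrite ltnS (bigD1_seq p) ?fset_uniq//= -!addnA.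
  exact: leq_addr.
set Lam := initial_part Gam n.
have xL : x \in Lam.
  by apply: initial_part_mem => //; apply: leq_trans Mn; rewrite ltnS addnAC leq_addl.
have yL : y \in Lam.
  by apply: initial_part_mem => //; apply: leq_trans Mn; rewrite ltnS leq_addl.
pose near_pts : {fset Zd d} := [fset q in flatten [seq nbrs p | p <- Lam] | `[< Gam q >]]%fset.
pose Lam' := (Lam `|` near_pts)%fset.
have err := truncation_error u Th lam om z z0 Lam Lam' Gam x y g col.
have {}err : complex.Im z ^+ 2 * normc (g x - rgreen u Th Lam lam z om x y) ^+ 2 <=
    N ^+ 2 * \sum_(q <- (Lam' `\` Lam)%fset) normc (g q) ^+ 2.
  apply: err => //.
  - exact: fsubsetUl.
  - by move=> p; exact: mem_initial_part.
  - move=> p q pL apq qL'; apply: g0 => Gq; case/negP: qL'.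
    rewrite in_fsetU; apply/orP; right; rewrite !inE /=; apply/andP; split; last exact/asboolP.
    by apply/flattenP; exists (nbrs p); [exact: map_f | exact: mem_nbrs].
have {}err : normc (g x - rgreen u Th Lam lam z om x y) <= dl.
  rewrite -(@ler_pXn2r _ 2)// ?nnegrE ?normc_ge0 ?(ltW dl0)//.
  rewrite -(ler_pM2l iz0); apply: le_trans err _.
  rewrite mulrC -ler_pdivlMr ?exprn_gt0//; apply: hA => q; rewrite in_fsetD => /andP[qL qL'].
  apply/negP => /inn qn; case/negP: qL; apply: initial_part_mem => //.
  move: qL'; rewrite in_fsetU => /orP[/mem_initial_part//|].
  by rewrite !inE /= => /andP[_ /asboolP].
have sub (a b : C) : normc a `^ tau <= normc b `^ tau + normc (a - b) `^ tau.
  apply: le_trans (powRD_le _ _ _ _ _ _) => //; rewrite ?normc_ge0//.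
  apply: ge0_ler_powR; rewrite ?nnegrE ?addr_ge0 ?normc_ge0 ?(ltW t0)//.
  by rewrite -[in leLHS](subrK b a) addrC ler_normcD.
have le_e : normc (g x - rgreen u Th Lam lam z om x y) `^ tau <= e.
  have -> : e = dl `^ tau by rewrite -powRrM mulVf ?gt_eqF// powRr1// ltW.
  by apply: ge0_ler_powR; rewrite ?nnegrE ?normc_ge0 ?(ltW t0) ?(ltW dl0).
rewrite ler_distlC; apply/andP; split.
  by rewrite lerBlDr; apply: le_trans (sub _ (rgreen u Th Lam lam z om x y)) _; rewrite lerD2l.
apply: le_trans (sub _ (g x)) _; rewrite lerD2l.
by rewrite -normc_opp opprB.
Qed.

Lemma limn_einf_ge0 (v : (\bar R)^nat) : (forall n, 0 <= v n)%E -> (0 <= limn_einf v)%E.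
Proof.
move=> v0; rewrite limn_einf_lim; apply: lime_ge; first exact: is_cvg_einfs.
by near=> n; apply: le_ereal_inf_tmp => _ [k _ <-].
Unshelve. all: by end_near. Qed.

Lemma limn_einf_le (v : (\bar R)^nat) B : (forall n, v n <= B)%E -> (limn_einf v <= B)%E.
Proof.
move=> vB; rewrite limn_einf_lim; apply: lime_le; first exact: is_cvg_einfs.
near=> n; apply: le_trans (vB n); apply: ereal_inf_lbound; by exists n => /=.
Unshelve. all: by end_near. Qed.

(** An inequality is all that Fatou's lemma asks for. Where no square-summable column exists,
    [Green] takes its default value 0, so solvability in infinite volume never has to be shown. *)
Lemma green_le_limn_einf :
  ((normc (Green u Th lam om Gam z x y) `^ tau)%:E <= limn_einf (fun n => (trunc n)%:E))%E.
Proof.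
have [t0 _] := andP tau01; rewrite /Green; case: pselect => [e|_].
  move: (cid _) => [g /= col]; have [Gy _] := e.
  have h : (trunc n)%:E @[n --> \oo] --> (normc (g x) `^ tau)%:E.
    by apply: cvg_EFin; [exact: nearW | exact: truncated_green_cvg col Gy].
  by have [-> _] := cvg_limn_einf_sup h.
by rewrite normc0 powR0 ?gt_eqF// limn_einf_ge0// => n; rewrite lee_fin powR_ge0.
Qed.

End Truncation.

(** * From the density to probabilities of intervals *)

Section Density.
Context {R : realType}.
Local Notation leb := (@lebesgue_measure R).
Variable rho : R -> R.
Hypothesis rho_meas : measurable_fun setT rho.
Hypothesis rho_ge0 : forall t, 0 <= rho t.

Lemma density_ball (M c e : R) : (forall t, rho t <= M) -> 0 <= e ->
  (\int[leb]_(a in [set a | (`|a - c| <= e)%R]) (rho a)%:E <= (2 * M * e)%:E)%E.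
Proof.
move=> rM e0; have -> : [set a : R | `|a - c| <= e] = `[c - e, c + e]%classic.
  by apply/seteqP; split => a /=; rewrite in_itv /= -ler_distl.
apply: (@le_trans _ _ (\int[leb]_(a in `[(c - e)%R, (c + e)%R]%classic) M%:E)%E).
  apply: ge0_le_integral => //=.
  - by move=> a _; rewrite lee_fin.
  - by apply/measurable_EFinP; exact: measurable_funTS.
  - by move=> a _; rewrite lee_fin.
rewrite integral_cst//= lebesgue_measure_itv/= lte_fin.
case: ifPn => [_|]; first by rewrite -EFinB -EFinM lee_fin le_eqVlt; apply/orP; left; apply/eqP; ring.
rewrite mule0 lee_fin mulr_ge0// mulr_ge0//; exact: le_trans (rM 0).
Qed.

Lemma density_tail (K : R) : (forall t, K < `|t| -> rho t = 0) ->
  (\int[leb]_(a in [set a | (K < `|a|)%R]) (rho a)%:E = 0)%E.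
Proof. by move=> rK; apply: integral0_eq => a /= /rK ->. Qed.

End Density.

Lemma seq_pos_lower_bound {R : realType} {T : eqType} (s : seq T) (f : T -> R) :
  (forall t, t \in s -> 0 < f t) -> exists2 w, 0 < w & forall t, t \in s -> w <= f t.
Proof.
elim: s => [|t s IH] hf; first by exists 1.
have [w w0 hw] := IH (fun t' ts => hf t' (@mem_behead _ (t :: s) t' ts)).
have ft := hf t (mem_head t s).
exists (Num.min w (f t)) => [|t']; first by rewrite lt_min w0.
rewrite inE => /orP[/eqP ->|/hw ht]; first by rewrite ge_min lexx orbT.
by rewrite ge_min ht.
Qed.

Theorem theorem2p7 (R : realType) (d : nat) (hd : (1 <= d)%N)
  (rho : R -> R) (u : Zd d -> R) (Th : {fset Zd d}) (m s : R)
  (* (A1): bounded, compactly supported density *)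
  (rho_meas : measurable_fun setT rho)
  (rho_ge0 : forall t, 0 <= rho t)
  (rho_bd : exists M : R, forall t, rho t <= M)
  (rho_supp : exists K : R, forall t, K < `|t| -> rho t = 0)
  (rho_prob : (\int[lebesgue_measure]_t (rho t)%:E = 1)%E)
  (* u has finite support Theta, 0 in Theta *)
  (hTh : forall k, u k != 0 <-> k \in Th)
  (h0 : (0 : Zd d) \in Th)
  (* (A2) *)
  (A2 : forall k, inner_bd [set k | k \in Th] k -> 0 < u k)
  (hm : 0 < m) (hs0 : 0 < s) (hs1 : s < 1 / 3) :
  exists Bs Cs : R,
  forall (lam : R), 0 < lam ->
  forall (dT : measure_display) (T : measurableType dT) (P : probability T R)
    (om : Zd d -> T -> R),
    (forall k, measurable_fun setT (om k)) ->
    mutually_independent P om ->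
    (forall k (A : set R), measurable A ->
       P (om k @^-1` A) = (\int[lebesgue_measure]_(t in A) (rho t)%:E)%E) ->
  forall (Gam : set (Zd d)) (z : R[i]) (L : nat) (b : R),
    Im z != 0 -> normc z <= m ->
    (diam Th + 2 <= L)%N ->
    0 < b < 1 ->
    (forall Lam, Lam `<=` Gam -> forall x, Lam x ->
       ((Bs * (L%:R ^+ (3 * (d - 1))) * Xi s lam #|` Th|
           / lam `^ (s / (#|` Th|%:R)))%:E *
        \sum_(w \in outer_bd (Wset Gam Th L x))
           \int[P]_t ((normc (Green u Th lam (fun k => om k t)
                        (Lam `\` Wset Gam Th L x) z x w))
                      `^ (s / (2 * #|` Th|%:R)))%:E < b%:E)%E) ->
    forall x y, Gam x -> Gam y ->
      (\int[P]_t ((normc (Green u Th lam (fun k => om k t) Gam z x y))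
                   `^ (s / (2 * #|` Th|%:R)))%:E
       <= ((Cs * Xi s lam #|` Th| / b)
           * expR (- ((`|ln b| / (L%:R + (diam Th)%:R + 2))
                      * (normoo (x - y))%:R)))%:E)%E.
Proof.
have [M0 hM0] := rho_bd; have [K0 hK0] := rho_supp.
pose M := Num.max M0 0; pose K := Num.max K0 0.
have Mge0 : 0 <= M by rewrite le_max lexx orbT.
have Kge0 : 0 <= K by rewrite le_max lexx orbT.
have hM t : rho t <= M by rewrite le_max hM0.
have hK t : K < `|t| -> rho t = 0 by rewrite gt_max => /andP[/hK0].
have [w w0 hw] := seq_pos_lower_bound Th (fun t => `|u t|)
  (fun t tT => etrans (normr_gt0 _) (iffRL (hTh t) tT)).
pose U := \sum_(t <- Th) `|u t|.
have U0 : 0 <= U by apply: sumr_ge0.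
have uw t : t \in Th -> w <= `|u t| <= U.
  move=> tT; rewrite hw//= /U (bigD1_seq t) ?fset_uniq//= lerDl.
  by apply: sumr_ge0.
(* Neither constant sees [lam], [z], [Gam], [L] or [b]: the density enters through [M] and [K], the
   function [u] through [w], [U] and [Th]. *)
exists (criterion_const Th w U M K m s), (step_bound Th w U M K m s 2 ^+ 2).
move=> lam lam0 dT T P om mom indom dist Gam z L b z0 zm hL b01 crit x y Gx Gy.
have z0' : complex.Im z != 0.
  by apply: contra_neq z0 => Imz; rewrite -complexIm Imz.
set tau := s / (2 * #|` Th|%:R).
have n0 : 0 < #|` Th|%:R :> R by rewrite ltr0n cardfs_gt0; apply/fset0Pn; exists 0.
have n1 : 1 <= #|` Th|%:R :> R by rewrite ler1n -(ltr0n R).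
have tau01 : 0 < tau <= 1.
  rewrite divr_gt0 ?mulr_gt0//= ler_pdivrMr ?mulr_gt0// mul1r.
  by move: hs1 n1; move: (#|` Th|%:R) => a; lra.
have [tau0 _] := andP tau01.
have conc k (c e : R) : 0 <= e -> (P [set t | (`|om k t - c| <= e)%R] <= (2 * M * e)%:E)%E.
  move=> e0; have mA : measurable [set a : R | (`|a - c| <= e)%R].
    rewrite (_ : [set a : R | _] = `[c - e, c + e]%classic)//.
    by apply/seteqP; split => a /=; rewrite in_itv /= -ler_distl.
  by have := dist k _ mA; rewrite /preimage /= => ->; exact: density_ball.
have bdom k : P [set t | (K < `|om k t|)%R] = 0%E.
  have mA : measurable [set a : R | (K < `|a|)%R].
    rewrite (_ : [set a : R | _] = Num.norm @^-1` `]K, +oo[%classic).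
      by rewrite -[X in measurable X]setTI; exact: (@normr_measurable R setT).
    by apply/seteqP; split => a /=; rewrite in_itv /= andbT.
  by have := dist k _ mA; rewrite /preimage /= => ->; exact: density_tail.
have meanE := mean_greenE u Th hTh h0 A2 w U w0 U0 uw P om M K mom indom Mge0 Kge0 conc bdom
  lam m s z lam0 hm zm z0' hs0 hs1.
have mean0 := mean_green_ge0 u Th hTh h0 A2 w U w0 U0 uw P om M K mom indom Mge0 Kge0 conc bdom
  lam m s z lam0 hm zm z0' hs0 hs1.
have cc0 : 0 <= criterion_const Th w U M K m s.
  apply: mulr_ge0 => //; apply: mulr_ge0; last by rewrite le_max ler01.
  by rewrite exprn_ge0// le_max ler01.
have crit' (Lam : {fset Zd d}) p : (forall q, q \in Lam -> Gam q) -> p \in Lam ->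
    criterion_const Th w U M K m s * L%:R ^+ (3 * (d - 1)) *
      (Xi s lam #|` Th| / lam `^ (s / #|` Th|%:R)) *
      \sum_(q <- Iset Gam Th L p Lam) collar_mean u Th P om lam s z Gam L Lam p p q <= b.
  move=> LG pL; have := crit [set` Lam] LG p pL; rewrite -Kset_set => h.
  rewrite -lee_fin; apply: le_trans (ltW h); rewrite [X in X * _]mulrA EFinM.
  rewrite (_ : \sum_(q \in _) _ = (\sum_(q \in outer_bd (Wset Gam Th L p))
      (mean_green u Th P om lam s z (Kset Gam Th L p Lam) p q)%:E)%E); last first.
    apply: eq_fsbigr => q _; rewrite -meanE; apply: eq_integral => t _.
    by rewrite green_finite.
  (* Off [Kset] the Green function is 0 by convention, so the sum over the whole outer boundary has
     finite support and is a genuine sum. Passing to [Iset] then only drops nonnegative terms. *)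
  rewrite fsbig_mkcond (fsbigTE (Kset Gam Th L p Lam)) => [|q qK]; last first.
    rewrite /patch; case: ifP => // _; rewrite -meanE.
    under eq_integral do rewrite /rgreen green_out ?negb_and ?qK ?orbT// normc0 powR0 ?gt_eqF//.
    by rewrite integral0.
  apply: lee_wpmul2l.
    by rewrite lee_fin divr_ge0 ?powR_ge0// mulr_ge0 ?le_max ?powR_ge0// mulr_ge0 ?exprn_ge0.
  rewrite /Iset -big_fset_condE big_mkcond -sumEFin; apply: lee_sum => q _.
  rewrite /collar_mean /patch; case: ifP => _; last by case: ifP => _ //; rewrite lee_fin.
  case: (boolP `[< _ >]) => [/asboolP oq|oq]; first by rewrite ifT// mem_set.
  by case: ifP => _; rewrite lee_fin.
pose B := step_bound Th w U M K m s 2 ^+ 2 * Xi s lam #|` Th| / b *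
  expR (- (`|ln b| / (L%:R + (diam Th)%:R + 2) * (normoo (x - y)%R)%:R)).
have meanB n : (\int[P]_t (normc (rgreen u Th (initial_part Gam n) lam z (om^~ t) x y) `^ tau)%:E
    <= B%:E)%E.
  have [/andP[xL yL]|xy] := boolP ((x \in initial_part Gam n) && (y \in initial_part Gam n)).
    rewrite [leLHS]meanE lee_fin.
    apply: (mean_green_decay u Th hTh h0 A2 w U w0 U0 uw P om M K mom indom Mge0 Kge0 conc bdom
      lam m s z lam0 hm zm z0' hs0 hs1 Gam L b hL b01 crit' (initial_part Gam n) x y _ xL yL).
    by move=> p; exact: mem_initial_part.
  under eq_integral do rewrite /rgreen green_out// normc0 powR0 ?gt_eqF//.
  rewrite integral0 lee_fin /B mulr_ge0 ?expR_ge0// divr_ge0//; last by case/andP: b01 => /ltW.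
  by rewrite mulr_ge0 ?sqr_ge0// le_max powR_ge0.
(* Fatou's lemma is applied to the finite-volume moments, which are measurable; the infinite-volume
   one is only compared with their lower limit pointwise. *)
apply: (@le_trans _ _ (\int[P]_t limn_einf (fun n =>
    (normc (rgreen u Th (initial_part Gam n) lam z (om^~ t) x y) `^ tau)%:E))%E).
  apply: le_lower_integral => t; first by rewrite lee_fin powR_ge0.
  exact: green_le_limn_einf.
apply: le_trans (fatou P measurableT _ _) _.
- move=> n; apply/measurable_EFinP; apply: measurable_rgreen => //; by rewrite gt_eqF.
- by move=> n t _; rewrite lee_fin powR_ge0.
by apply: limn_einf_le => n; exact: meanB.
Qed.
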